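(* Let $n\ge 5$ and let $r$ be the rank function of the generic $C_2^1$-cofactor matroid $\mathcal{C}^1_{2,n}$ on $E(K_n)$. Let $X\subseteq E(K_n)$. (a) $r(X)=\min\{|X\cup C_{\le t}|-t : (C_1,\dots,C_t)\text{ is a proper }K_5\text{-sequence in }K_n\}$. (b) If $X$ is a nonempty cyclic flat of $\mathcal{C}^1_{2,n}$, then there is a vertex $v\in V(X)$ such that $K(N_X(v))\subseteq X$ and $v$ is incident with exactly three edges of some base of $X$.
   Context: Vertices of $K_n$ are $v_1,\dots,v_n$. Choose $p(v_i)=(x_i,y_i)\in\mathbb{R}^2$ generic, i.e. the $2n$ coordinates are algebraically independent over $\mathbb{Q}$. The $C_2^1$-cofactor matrix is the $|E(K_n)|\times 3n$ matrix with three consecutive columns for each vertex. The row of an edge $v_iv_j$ with $i<j$ has $D_{ij}=((x_i-x_j)^2,(x_i-x_j)(y_i-y_j),(y_i-y_j)^2)$ in the columns of $v_i$, $-D_{ij}$ in the columns of $v_j$, and zeros elsewhere. $\mathcal{C}^1_{2,n}$ is the row matroid of this matrix; it does not depend on the generic choice of $p$. A set is cyclic if it is a union of circuits; the empty set counts as cyclic. A set is a flat if it equals its closure. A base of $X$ is a maximal independent subset of $X$. For $F\subseteq E(K_n)$, $V(F)$ is the set of vertices incident with $F$. $N_X(v)$ is the set of neighbours of $v$ in the graph $(V(X),X)$. $K(U)$ is the edge set of the complete graph on the vertex set $U$. A $K_5$-sequence is a finite sequence $(C_1,\dots,C_t)$, $t\ge0$, of edge sets of copies of $K_5$ in $K_n$.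 Write $C_{\le i}=C_1\cup\dots\cup C_i$ and $C_{\le 0}=\emptyset$. The sequence is proper if $C_i\not\subseteq C_{\le i-1}$ for all $2\le i\le t$. *)

(* Defs.v *)
From HB Require Import structures.
From mathcomp Require Import all_boot all_order all_algebra.
From mathcomp Require Import mpoly.
Set Implicit Arguments. Unset Strict Implicit. Unset Printing Implicit Defensive.
Import Order.TTheory GRing.Theory Num.Theory.
Local Open Scope ring_scope.

Definition edge (n : nat) := {e : 'I_n * 'I_n | (e.1 < e.2)%N}.

Definition incident n (v : 'I_n) (e : edge n) : bool :=
  ((val e).1 == v) || ((val e).2 == v).

Definition coords (R : realFieldType) n (x y : 'I_n -> R) (k : 'I_(n + n)) : R :=
  match split k with inl i => x i | inr i => y i end.

Definition generic (R : realFieldType) n (x y : 'I_n -> R) : Prop :=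
  forall P : {mpoly rat[n + n]}, P != 0 ->
    (map_mpoly (ratr : rat -> R) P).@[coords x y] != 0.

(* The row of the C^1_2-cofactor matrix for edge e = v_i v_j (i<j);
   column k corresponds to vertex k %/ 3, coordinate k %% 3. *)
Definition cofrow (R : realFieldType) n (x y : 'I_n -> R) (e : edge n)
  : 'rV[R]_(3 * n) :=
  let i := (val e).1 in let j := (val e).2 in
  let dx := x i - x j in let dy := y i - y j in
  \row_(k < 3 * n)
    let c := (k %% 3)%N in
    let D := if c == 0%N then dx ^+ 2 else if c == 1%N then dx * dy else dy ^+ 2 in
    if (k %/ 3)%N == val i then D
    else if (k %/ 3)%N == val j then - D else 0.

Definition crank (R : realFieldType) n (x y : 'I_n -> R) (X : {set edge n}) : nat :=
  \rank (\matrix_(k < #|X|) cofrow x y (enum_val k)).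

Definition cindep(R : realFieldType) n (x y : 'I_n -> R) (X : {set edge n}) : bool :=
  crank x y X == #|X|.

Definition ccircuit(R : realFieldType) n (x y : 'I_n -> R) (C : {set edge n}) : Prop :=
  ~~ cindep x y C /\ forall D : {set edge n}, D \proper C -> cindep x y D.

Definition ccyclic(R : realFieldType) n (x y : 'I_n -> R) (X : {set edge n}) : Prop :=
  forall e, e \in X -> exists C : {set edge n}, [/\ ccircuit x y C, e \in C & C \subset X].

Definition cclosure(R : realFieldType) n (x y : 'I_n -> R) (X : {set edge n}) : {set edge n} :=
  [set e | crank x y (e |: X) == crank x y X].

Definition cflat(R : realFieldType) n (x y : 'I_n -> R) (X : {set edge n}) : Prop :=
  cclosure x y X = X.

Definition cbase(R : realFieldType) n (x y : 'I_n -> R) (X B : {set edge n}) : Prop :=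
  [/\ B \subset X, cindep x y B &
      forall B' : {set edge n}, B \proper B' -> B' \subset X -> ~~ cindep x y B'].

Definition Vset n (F : {set edge n}) : {set 'I_n} :=
  [set v | [exists e in F, incident v e]].

Definition nbhd n (X : {set edge n}) (v : 'I_n) : {set 'I_n} :=
  [set u | [exists e in X, incident v e && incident u e && (u != v)]].

Definition Kset n (U : {set 'I_n}) : {set edge n} :=
  [set e | ((val e).1 \in U) && ((val e).2 \in U)].

(* K_5-sequences, given by the vertex sets U_i with C_i = K(U_i) *)
Definition K5seq n (s : seq {set 'I_n}) : Prop :=
  forall U, U \in s -> #|U| = 5%N.

Definition Cle n (s : seq {set 'I_n}) : {set edge n} :=
  \bigcup_(U <- s) Kset U.

Definition proper_K5seq n (s : seq {set 'I_n}) : Prop :=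
  K5seq s /\
  forall i, (1 <= i < size s)%N -> ~~ (Kset (nth set0 s i) \subset Cle (take i s)).

(* Main.v *)
(* A generic row space has at least the rank of the same matrix at any special
   position.  Placing a vertex [v] of degree 4 or 5 of a circuit on the line
   through two of its neighbours [i], [j], and comparing residues in the position
   parameter, one finds that the neighbours of [v] span a clique of the closure;
   for degree 5 one configuration, a pencil with equal weighted rows on opposite
   edges ([delta]), survives this and is excluded by induction ([pencil_all]).
   Since the rank of K(U) is at most 3|U| - 6, circuits have vertices of degree
   at most 5, and peeling off copies of K_5 there shows that every linear relation
   supported in a flat is a combination of the relations of its copies of K_5
   ([stress_span]).

   Call a vertex good when its neighbourhood is a clique of the cyclic flat X.
   Removing the edges private to one K_5, or a whole vertex, preserves
   12|V(X)| <= 5 #good + 4 r(X) ([good_count]); as r(X) <= 3|V(X)| - 6, good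
   vertices exist, which gives (b).  In (a), every new K_5 has a new edge that is
   redundant, whence the upper bound on the rank of the union; equality for flats
   comes by deleting a good vertex, adding back the copies of K_5 formed by it,
   three fixed neighbours and each further neighbour. *)
Require Import Defs.
From HB Require Import structures.
From mathcomp Require Import all_boot all_order all_algebra.
From mathcomp Require Import mpoly.
From mathcomp Require Import perm ring zify.
Set Implicit Arguments. Unset Strict Implicit. Unset Printing Implicit Defensive.
Import Order.TTheory GRing.Theory Num.Theory.

(** * The relation of a K_5 *)

Section Rows.
Local Open Scope ring_scope.
Variables (R : realFieldType) (n : nat).
Implicit Types (x y : 'I_n -> R) (i j k v : 'I_n).

(** When [v] lies on the line through its neighbours [a] and [b], the rows of [va] and [vb] have
    proportional blocks at [v] and combine to a multiple of the row of [ab]. In degree 4 the rank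
    bound leaves no room for this vector outside the span [W] of the edges avoiding [v]. In degree 5
    it leaves one dimension, and the K_5 relation on [v] and the neighbours other than [b] supplies
    a second vector free of [v]. The two are parallel modulo [W] for every position on the line, and
    since the coefficients have simple poles at distinct parameters, this splits into conditions on
    few edges at a time. The obstacle is that a pencil puts [delta] into a span although it is not
    an edge. The induction excluding pencils therefore adjoins [delta] to [W] as an extra row and,
    before descending to fewer vertices, trades it for true edges by exchange. In the count, 12 = 4
    * 3 balances the three dimensions lost with a vertex; the weights of vertices inside one K_5 are
    then 12 - 5 = 7 for a vertex that disappears and 5 for a good vertex that may cease to be
    good. *)

Definition br x y i j k : R :=
  (x j - x i) * (y k - y i) - (x k - x i) * (y j - y i).

Lemma br_cross x y i j k :
  (x i - x j) * (y i - y k) - (x i - x k) * (y i - y j) = br x y i j k.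
Proof. rewrite /br; ring. Qed.
Lemma brC x y i j k : br x y j i k = - br x y i j k.
Proof. rewrite /br; ring. Qed.
Lemma br_rot x y i j k : br x y i j k = br x y j k i.
Proof. rewrite /br; ring. Qed.

(** The Veronese image of a direction: linear relations among such vectors are relations among the
    values of binary quadratic forms. *)
Definition dv (a b : R) : 'rV[R]_3 :=
  \row_(c < 3) (if c == 0%N :> nat then a ^+ 2
                else if c == 1%N :> nat then a * b else b ^+ 2).

Definition emb i (d : 'rV[R]_3) : 'rV[R]_(3 * n) :=
  \row_k ((k %/ 3 == i)%N%:R * d 0 (inord (k %% 3))).

(** Right multiplication by [blk v] extracts the three columns of [v]. *)
Definition blk v : 'M[R]_(3 * n, 3) := \matrix_(k, c) ((k == 3 * v + c :> nat)%N)%:R.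

Lemma blk_lt v (c : 'I_3) : (3 * v + c < 3 * n)%N.
Proof. case: v c => [v hv] [c hc] /=. nia. Qed.

Lemma emb_blk i d v : emb i d *m blk v = if i == v then d else 0.
Proof.
apply/rowP => c; rewrite mxE.
rewrite (bigD1 (Ordinal (blk_lt v c))) //= big1 ?addr0; last first.
  move=> k hk; rewrite !mxE (_ : (k == 3 * v + c :> nat)%N = false) ?mulr0 //.
  by apply/negP => /eqP h; case/negP: hk; apply/eqP/val_inj.
rewrite !mxE /= eqxx mulr1.
have -> : ((3 * v + c) %/ 3 = v)%N by case: c => c hc /=; lia.
have -> : inord ((3 * v + c) %% 3) = c :> 'I_3.
  apply/val_inj; case: c => c hc; rewrite /= inordK; lia.
have -> : (nat_of_ord v == nat_of_ord i) = (i == v) by rewrite eq_sym.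
by case: eqP => _; rewrite ?mxE ?mul1r ?mul0r.
Qed.

(** A version of [cofrow] for ordered pairs: as [dv] is even, exchanging the ends only changes the
    sign, so the order of the ends never has to be discussed. *)
Definition erow x y i j : 'rV[R]_(3 * n) :=
  emb i (dv (x i - x j) (y i - y j)) - emb j (dv (x i - x j) (y i - y j)).

Lemma dvN a b : dv (- a) (- b) = dv a b.
Proof. by apply/rowP=> c; rewrite !mxE; do 2 ?[case: ifP => _]; ring. Qed.

Lemma erowC x y i j : erow x y j i = - erow x y i j.
Proof. by rewrite /erow -opprB -[y j - y i]opprB -[x j - x i]opprB dvN. Qed.

Lemma erow_blk x y i j v : i != j ->
  erow x y i j *m blk v =
  if v == i then dv (x i - x j) (y i - y j)
  else if v == j then - dv (x i - x j) (y i - y j) else 0.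
Proof.
move=> ij; rewrite mulmxBl !emb_blk ![_ == v]eq_sym.
case: (eqVneq v i) => [->|vi]; first by rewrite (negPf ij) subr0.
by case: (eqVneq v j) => _; rewrite sub0r ?oppr0.
Qed.

Lemma cofrowE x y (e : edge n) : cofrow x y e = erow x y (val e).1 (val e).2.
Proof.
apply/rowP => k; rewrite !mxE.
have h3 : (k %% 3 < 3)%N by rewrite ltn_mod.
rewrite inordK //.
case: (eqVneq (k %/ 3)%N (val (val e).1)) => [->|_].
  have -> : (val (val e).1 == val (val e).2)%N = false.
    by apply/negbTE; rewrite neq_ltn (valP e).
  by rewrite mul1r mul0r subr0.
case: (eqVneq (k %/ 3)%N (val (val e).2)) => _; by rewrite ?mul0r ?mul1r ?sub0r ?oppr0.
Qed.

(* Lagrange interpolation of binary quadratic forms at four directions. *)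
Lemma dv_rel4 (a1 b1 a2 b2 a3 b3 a4 b4 : R) :
  let w (s t s1 t1 : R) := s * t1 - s1 * t in
  w a1 b1 a2 b2 != 0 -> w a1 b1 a3 b3 != 0 -> w a1 b1 a4 b4 != 0 ->
  w a2 b2 a3 b3 != 0 -> w a2 b2 a4 b4 != 0 -> w a3 b3 a4 b4 != 0 ->
  (w a1 b1 a2 b2 * w a1 b1 a3 b3 * w a1 b1 a4 b4)^-1 *: dv a1 b1
  + (w a2 b2 a1 b1 * w a2 b2 a3 b3 * w a2 b2 a4 b4)^-1 *: dv a2 b2
  + (w a3 b3 a1 b1 * w a3 b3 a2 b2 * w a3 b3 a4 b4)^-1 *: dv a3 b3
  + (w a4 b4 a1 b1 * w a4 b4 a2 b2 * w a4 b4 a3 b3)^-1 *: dv a4 b4 = 0.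
Proof.
move=> w h12 h13 h14 h23 h24 h34.
have wN (s t s1 t1 : R) : w s1 t1 s t = - w s t s1 t1 by rewrite /w; ring.
rewrite (wN a1 b1 a2 b2) (wN a1 b1 a3 b3) (wN a1 b1 a4 b4).
rewrite (wN a2 b2 a3 b3) (wN a2 b2 a4 b4) (wN a3 b3 a4 b4).
apply/rowP => c.
have lin (v1 v2 v3 v4 : 'rV[R]_3) (k1 k2 k3 k4 : R) :
    (k1 *: v1 + k2 *: v2 + k3 *: v3 + k4 *: v4) 0 c =
    k1 * v1 0 c + k2 * v2 0 c + k3 * v3 0 c + k4 * v4 0 c by rewrite !mxE.
rewrite lin [RHS]mxE.
(* Every coordinate of [dv] is a binary quadratic form, so one computation with an arbitrary form
   covers all three. *)
have [al [be [ga E]]] : exists al be ga, forall p q,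
    dv p q 0 c = al * p ^+ 2 + be * (p * q) + ga * q ^+ 2.
  case: (eqVneq (c : nat) 0%N) => c0.
    by exists 1, 0, 0 => p q; rewrite mxE c0 /=; ring.
  case: (eqVneq (c : nat) 1%N) => c1.
    by exists 0, 1, 0 => p q; rewrite mxE (negPf c0) c1 /=; ring.
  by exists 0, 0, 1 => p q; rewrite mxE (negPf c0) (negPf c1); ring.
rewrite !E; move: h12 h13 h14 h23 h24 h34.
set w12 := w a1 b1 a2 b2; set w13 := w a1 b1 a3 b3; set w14 := w a1 b1 a4 b4.
set w23 := w a2 b2 a3 b3; set w24 := w a2 b2 a4 b4; set w34 := w a3 b3 a4 b4.
move=> h12 h13 h14 h23 h24 h34.
pose D p q := al * p ^+ 2 + be * (p * q) + ga * q ^+ 2.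
transitivity ((D a1 b1 * (w23 * w24 * w34) - D a2 b2 * (w13 * w14 * w34)
  + D a3 b3 * (w12 * w14 * w24) - D a4 b4 * (w12 * w13 * w23)) /
  (w12 * w13 * w14 * w23 * w24 * w34)).
  by rewrite /D; field; rewrite ?h12 ?h13 ?h14 ?h23 ?h24 ?h34.
by rewrite (_ : _ - _ = 0) ?mul0r // /D /w12 /w13 /w14 /w23 /w24 /w34 /w; ring.
Qed.

(* The coefficient of [erow i j] in the relation [K5rel] of the K_5 on these
   five vertices. *)
Definition sg x y i j k l m : R := (br x y i j k * br x y i j l * br x y i j m)^-1.

Lemma sgC x y i j k l m : sg x y j i k l m = - sg x y i j k l m.
Proof. by rewrite /sg !(brC x y i j) !mulrNN !mulrN invrN. Qed.

Definition gp5 x y a b c d e :=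
  [/\ br x y a b c != 0, br x y a b d != 0, br x y a b e != 0, br x y a c d != 0
   & [/\ br x y a c e != 0, br x y a d e != 0, br x y b c d != 0, br x y b c e != 0
   & br x y b d e != 0 /\ br x y c d e != 0]].

(** The determinants of the directions issuing from [a] are the brackets through [a], by [br_cross];
    the Lagrange coefficients of the four directions are thus the [sg]. *)
Lemma vertex_rel x y a b c d e : gp5 x y a b c d e ->
  sg x y a b c d e *: dv (x a - x b) (y a - y b)
  + sg x y a c b d e *: dv (x a - x c) (y a - y c)
  + sg x y a d b c e *: dv (x a - x d) (y a - y d)
  + sg x y a e b c d *: dv (x a - x e) (y a - y e) = 0.
Proof.
case=> h1 h2 h3 h4 [h5 h6 h7 h8 [h9 h10]].
have := @dv_rel4 (x a - x b) (y a - y b) (x a - x c) (y a - y c)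
  (x a - x d) (y a - y d) (x a - x e) (y a - y e).
rewrite /= !br_cross => /(_ h1 h2 h3 h4 h5 h6) <-.
by rewrite /sg.
Qed.

Lemma gp5_rot x y a b c d e : gp5 x y a b c d e -> gp5 x y b c d e a.
Proof.
case=> h1 h2 h3 h4 [h5 h6 h7 h8 [h9 h10]].
split=> //; first by rewrite -br_rot.
by split=> //; rewrite -1?br_rot //; split; rewrite // -br_rot.
Qed.

Ltac sgtac := rewrite -?sgC /sg; congr (_^-1); ring.

(** Seen from its two ends, an edge gets coefficients differing only in sign, as do the two blocks
    of its row. The five relations at the vertices therefore glue. *)
Lemma K5rel x y a b c d e : gp5 x y a b c d e ->
  sg x y a b c d e *: erow x y a b + sg x y a c b d e *: erow x y a c
  + sg x y a d b c e *: erow x y a d + sg x y a e b c d *: erow x y a e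
  + sg x y b c a d e *: erow x y b c + sg x y b d a c e *: erow x y b d
  + sg x y b e a c d *: erow x y b e + sg x y c d a b e *: erow x y c d
  + sg x y c e a b d *: erow x y c e + sg x y d e a b c *: erow x y d e = 0.
Proof.
move=> h.
have ra := vertex_rel h.
have h1 := gp5_rot h; have rb := vertex_rel h1.
have h2 := gp5_rot h1; have rc := vertex_rel h2.
have h3 := gp5_rot h2; have rd := vertex_rel h3.
have h4 := gp5_rot h3; have re := vertex_rel h4.
move: ra rb rc rd re => {h h1 h2 h3 h4}.
have DC i j : dv (x i - x j) (y i - y j) = dv (x j - x i) (y j - y i).
  by rewrite -dvN !opprB.
rewrite (_ : sg x y b c d e a = sg x y b c a d e); last by sgtac.
rewrite (_ : sg x y b d c e a = sg x y b d a c e); last by sgtac.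
rewrite (_ : sg x y b e c d a = sg x y b e a c d); last by sgtac.
rewrite (_ : sg x y b a c d e = - sg x y a b c d e); last by sgtac.
rewrite (_ : sg x y c d e a b = sg x y c d a b e); last by sgtac.
rewrite (_ : sg x y c e d a b = sg x y c e a b d); last by sgtac.
rewrite (_ : sg x y c a d e b = - sg x y a c b d e); last by sgtac.
rewrite (_ : sg x y c b d e a = - sg x y b c a d e); last by sgtac.
rewrite (_ : sg x y d a e b c = - sg x y a d b c e); last by sgtac.
rewrite (_ : sg x y d b e a c = - sg x y b d a c e); last by sgtac.
rewrite (_ : sg x y d c e a b = - sg x y c d a b e); last by sgtac.
rewrite (_ : sg x y e a b c d = - sg x y a e b c d); last by sgtac.
rewrite (_ : sg x y e b a c d = - sg x y b e a c d); last by sgtac.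
rewrite (_ : sg x y e c a b d = - sg x y c e a b d); last by sgtac.
rewrite (_ : sg x y e d a b c = - sg x y d e a b c); last by sgtac.
rewrite (DC b a) (DC c a) (DC d a) (DC e a) (DC c b) (DC d b) (DC e b) (DC d c) (DC e c) (DC e d).
move=> ra rb rc rd re; apply/rowP => k.
(* Column [k] involves only coordinate [k %% 3]; there the sum is the five local relations weighted
   by the indicators of the vertex of [k]. *)
pose ev (M : 'rV[R]_3) := M 0 (inord (k %% 3)).
move: (congr1 ev ra) (congr1 ev rb) (congr1 ev rc) (congr1 ev rd) (congr1 ev re).
rewrite /ev /erow {ra rb rc rd re ev}.
move: (sg x y a b c d e) (sg x y a c b d e) (sg x y a d b c e) (sg x y a e b c d)
  (sg x y b c a d e) (sg x y b d a c e) (sg x y b e a c d) (sg x y c d a b e)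
  (sg x y c e a b d) (sg x y d e a b c).
move: (dv (x a - x b) _) (dv (x a - x c) _) (dv (x a - x d) _) (dv (x a - x e) _)
  (dv (x b - x c) _) (dv (x b - x d) _) (dv (x b - x e) _) (dv (x c - x d) _)
  (dv (x c - x e) _) (dv (x d - x e) _).
move=> d0 d1 d2 d3 d4 d5 d6 d7 d8 d9 s0 s1 s2 s3 s4 s5 s6 s7 s8 s9.
rewrite !mxE.
move: (inord _) => c0.
move: (d0 0 c0) (d1 0 c0) (d2 0 c0) (d3 0 c0) (d4 0 c0) (d5 0 c0) (d6 0 c0) (d7 0 c0) (d8 0 c0) (d9 0 c0).
move: ((k %/ 3 == a)%N%:R) ((k %/ 3 == b)%N%:R) ((k %/ 3 == c)%N%:R)
  ((k %/ 3 == d)%N%:R) ((k %/ 3 == e)%N%:R).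
move=> A B C D E q0 q1 q2 q3 q4 q5 q6 q7 q8 q9 ga gb gc gd ge.
transitivity (A * 0 + B * 0 + C * 0 + D * 0 + E * 0 : R); last by ring.
rewrite -[in A * 0]ga -[in B * 0]gb -[in C * 0]gc -[in D * 0]gd -[in E * 0]ge.
ring.
Qed.

End Rows.

(** * Parallel vectors *)

Section Wedge.
Local Open Scope ring_scope.
Variables (F : fieldType) (N : nat).
Implicit Types u v w : 'rV[F]_N.

(* The vanishing of the exterior product. *)
Definition wedge u v := [forall i, forall j, u 0 i * v 0 j == u 0 j * v 0 i].

Lemma wedgeP u v : reflect (forall i j, u 0 i * v 0 j = u 0 j * v 0 i) (wedge u v).
Proof.
apply: (iffP forallP) => [h i j|h i]; first by move/forallP: (h i) => /(_ j) /eqP.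
by apply/forallP => j; apply/eqP.
Qed.

Lemma wedgeC u v : wedge u v = wedge v u.
Proof.
by apply/wedgeP/wedgeP => h i j; rewrite mulrC -h mulrC.
Qed.

Lemma wedge0 u : wedge u 0.
Proof. by apply/wedgeP => i j; rewrite !mxE !mulr0. Qed.

Lemma wedge_multiple u v : u != 0 -> wedge u v -> exists c, v = c *: u.
Proof.
move=> u0 /wedgeP h.
have [i ui] : exists i, u 0 i != 0.
  apply/existsP; rewrite -negb_forall; apply: contra u0 => /forallP z.
  by apply/eqP/rowP => i; rewrite mxE; apply/eqP.
exists (v 0 i / u 0 i); apply/rowP => j; rewrite mxE.
by apply: (mulfI ui); rewrite h; field.
Qed.

Lemma wedge_scale c u v : wedge u v -> wedge u (c *: v).
Proof. by move=> /wedgeP h; apply/wedgeP => i j; rewrite !mxE mulrCA h mulrCA. Qed.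

Lemma wedge_unscale c u v : c != 0 -> wedge u (c *: v) -> wedge u v.
Proof.
move=> c0 /(wedge_scale c^-1); by rewrite scalerA mulVf // scale1r.
Qed.

Lemma wedgeD u v w : wedge u v -> wedge u w -> wedge u (v + w).
Proof.
move=> /wedgeP h /wedgeP h'; apply/wedgeP => i j; by rewrite !mxE !mulrDr h h'.
Qed.

Lemma wedge_self u : wedge u u.
Proof. by apply/wedgeP => i j; rewrite mulrC. Qed.

Lemma wedge2_eq0 u v w : ~~ wedge u v -> wedge w u -> wedge w v -> w = 0.
Proof.
move=> nuv wu wv; apply/eqP; apply: contraNT nuv => w0.
have [c ->] := wedge_multiple w0 wu; have [d ->] := wedge_multiple w0 wv.
by apply/wedge_scale; rewrite wedgeC; apply/wedge_scale/wedge_self.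
Qed.

End Wedge.

Section Arrangements.
Variable I : finType.
Implicit Types T : {set I}.

(** An ordered labelling of a set: statements about a labelled five-set can then be reused at any
    permutation of the labels. *)
Definition arr T (s : seq I) := uniq s && (T == [set:: s]).

Lemma arr_perm T s s' : perm_eq s s' -> arr T s -> arr T s'.
Proof.
move=> p /andP[us /eqP ->]; rewrite /arr -(perm_uniq p) us /=.
by apply/eqP/setP => z; rewrite !inE (perm_mem p).
Qed.

End Arrangements.

(** Permutations of explicit lists are recognised by counting: each test becomes an opaque number
    and linear arithmetic decides. *)
Ltac permtac := apply/seq.permP => ? /=;
  repeat match goal with |- context [nat_of_bool ?b] => generalize (nat_of_bool b) end;
  clear; intros; lia.
Ltac arrtac H := by apply: arr_perm H; permtac.
Ltac usplit U := move: U; rewrite /= ?inE ?negb_or -?andbA => U;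
  repeat match type of U with is_true (_ && _) =>
    let h := fresh "uq_" in move/andP: U => [h U] end.
Ltac uq := rewrite /= ?inE ?negb_or ?andbT; repeat (apply/andP; split);
  first [done | by rewrite eq_sym].

(** * Vector-valued functions on the edges of a K_5 *)

Section Classify.
Local Open Scope ring_scope.
Variables (F : fieldType) (N : nat) (I : finType).
Implicit Types (a b c d e : I).
Variables (T : {set I}) (m : I -> I -> 'rV[F]_N).
Hypothesis mC : forall i j, m i j = m j i.
Hypothesis disj : forall a b c d e, arr T [:: a; b; c; d; e] -> wedge (m a b) (m c d).
Hypothesis conc : forall a b c d e, arr T [:: a; b; c; d; e] ->
  wedge (m a b) (m a c + m a d + m a e).

Definition cone_type a b c d e :=
  [/\ m b c = 0, m b d = 0, m b e = 0 & [/\ m c d = 0, m c e = 0 & m d e = 0]].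

Definition pencil_type a b c d e :=
  [/\ m e a = 0, m e b = 0, m e c = 0 & m e d = 0] /\
  [/\ m a b = m c d, m a c = m b d, m a d = m b c & ~~ wedge (m a b) (m a c)].

(** By [conc] the sum at [a] is parallel to both of two independent vectors. *)
Lemma conc_at_eq0 a b c d e : arr T [:: a; b; c; d; e] -> ~~ wedge (m a b) (m a c) ->
  m a b + m a c + m a d + m a e = 0.
Proof.
move=> H nw; apply: (wedge2_eq0 nw); rewrite wedgeC.
  by rewrite -!addrA; apply: wedgeD (wedge_self _) _; rewrite addrA; apply: conc H.
rewrite (addrC (m a b)) -!addrA; apply: wedgeD (wedge_self _) _; rewrite addrA.
by apply: (@conc a c b d e); arrtac H.
Qed.

(** The edges at [e] vanish one by one, each being disjoint from two edges with independent values.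
    The vanishing sums at [a], [b], [c] then express everything by [ab] and [ac]. *)
Lemma classify_bd a b c d e : arr T [:: a; b; c; d; e] -> ~~ wedge (m a b) (m a c) ->
  m b d != 0 -> pencil_type a b c d e.
Proof.
move=> H nw bd0.
have de0 : m d e = 0.
  apply: (wedge2_eq0 nw); first by apply: (@disj d e a b c); arrtac H.
  by apply: (@disj d e a c b); arrtac H.
have x0 : m a b != 0 by apply: contraNneq nw => ->; rewrite wedgeC wedge0.
have y0 : m a c != 0 by apply: contraNneq nw => ->; rewrite wedge0.
have [bt bdE] : exists bt, m b d = bt *: m a c.
  by apply: (wedge_multiple y0); apply: (@disj a c b d e); arrtac H.
have bt0 : bt != 0 by apply: contraNneq bd0; rewrite bdE => ->; rewrite scale0r.
have wy u : wedge (m b d) u -> wedge (m a c) u.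
  by rewrite wedgeC bdE => /(wedge_unscale bt0); rewrite wedgeC.
have ce0 : m c e = 0.
  apply: (wedge2_eq0 nw); first by apply: (@disj c e a b d); arrtac H.
  by rewrite wedgeC; apply: wy; apply: (@disj b d c e a); arrtac H.
have nwb : ~~ wedge (m b a) (m b d).
  by apply: contra nw; rewrite mC bdE => /(wedge_unscale bt0).
have Rb := @conc_at_eq0 b a d c e ltac:(arrtac H) nwb.
have [be beE] : exists be, m b e = be *: m a c.
  by apply: (wedge_multiple y0); apply: (@disj a c b e d); arrtac H.
have bcE : m b c = - m a b - (bt + be) *: m a c.
  apply/eqP; rewrite -subr_eq0 -[X in _ == X]Rb bdE beE (mC b a); apply/eqP/rowP => k.
  by rewrite !mxE; ring.
have nbcy : ~~ wedge (m b c) (m a c).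
  apply: contra nw => /wedgeP h; apply/wedgeP => i j; have := h j i.
  rewrite bcE !mxE => /eqP; rewrite -subr_eq0 => /eqP E; apply/eqP; rewrite -subr_eq0.
  by apply/eqP; rewrite -[RHS]E; ring.
have ae0 : m a e = 0.
  apply: (wedge2_eq0 nbcy); first by apply: (@disj a e b c d); arrtac H.
  rewrite wedgeC; apply: wy; by apply: (@disj b d a e c); arrtac H.
have Ra := conc_at_eq0 H nw.
have adE : m a d = - m a b - m a c.
  apply/eqP; rewrite -subr_eq0 -[X in _ == X]Ra ae0; apply/eqP/rowP => k.
  by rewrite !mxE; ring.
have nady : ~~ wedge (m a d) (m a c).
  apply: contra nw => /wedgeP h; apply/wedgeP => i j; have := h j i.
  rewrite adE !mxE => /eqP; rewrite -subr_eq0 => /eqP E; apply/eqP; rewrite -subr_eq0.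
  by apply/eqP; rewrite -[RHS]E; ring.
have be0 : m b e = 0.
  apply: (wedge2_eq0 nady); first by apply: (@disj b e a d c); arrtac H.
  by apply: (@disj b e a c d); arrtac H.
have bez : be = 0.
  by apply/eqP; move: be0 => /eqP; rewrite beE scaler_eq0 (negPf y0) orbF.
rewrite bez addr0 in bcE.
(* The disjoint edges [bc] and [ad] have values [- ab - bt ac] and [- ab - ac], which are parallel
   only for [bt = 1]. *)
have bt1 : bt = 1.
  have /wedgeP h : wedge (m b c) (m a d) by apply: (@disj b c a d e); arrtac H.
  apply/eqP; rewrite -subr_eq0; apply: contraNT nw => b1.
  apply/wedgeP => i j; apply: (mulfI b1); have := h i j; rewrite bcE adE !mxE => E.
  apply/eqP; rewrite -subr_eq0; apply/eqP.
  by move: E => /eqP; rewrite -subr_eq0 => /eqP E; rewrite -[RHS]oppr0 -E; ring.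
rewrite bt1 scale1r in bdE bcE.
have nwc : ~~ wedge (m c a) (m c b).
  by rewrite (mC c a) (mC c b) wedgeC.
have Rc := @conc_at_eq0 c a b d e ltac:(arrtac H) nwc.
have cdE : m c d = m a b.
  apply/eqP; rewrite -subr_eq0 -[X in _ == X]Rc ce0 (mC c a) (mC c b) bcE; apply/eqP/rowP => k.
  by rewrite !mxE; ring.
split; split; rewrite ?(mC e) //; by rewrite adE bcE.
Qed.

(** If some adjacent values [ab], [ac] are independent, a nonzero value on one of [bd], [be], [cd],
    [ce] produces a pencil after relabelling. If these four vanish, [conc] at [b] and at [c] makes
    [bc] parallel to both [ab] and [ac], and a cone is left. *)
Lemma classify :
  (forall a b c d e, arr T [:: a; b; c; d; e] -> wedge (m a b) (m a c)) \/
  ((exists a b c d e, arr T [:: a; b; c; d; e] /\ cone_type a b c d e) \/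
  (exists a b c d e, arr T [:: a; b; c; d; e] /\ pencil_type a b c d e)).
Proof.
case: (boolP [forall p : I * I * I * I * I,
   arr T [:: p.1.1.1.1; p.1.1.1.2; p.1.1.2; p.1.2; p.2] ==>
   wedge (m p.1.1.1.1 p.1.1.1.2) (m p.1.1.1.1 p.1.1.2)]) => [/forallP h|].
  by left=> a b c d e H; have := h (a, b, c, d, e); rewrite /= H.
rewrite negb_forall => /existsP [[[[[a b] c] d] e] /=]; rewrite negb_imply => /andP[H nw].
right.
have nw' : ~~ wedge (m a c) (m a b) by rewrite wedgeC.
have [bd0|/(classify_bd H nw) h] := eqVneq (m b d) 0; last by right; exists a, b, c, d, e.
have H1 : arr T [:: a; b; c; e; d] by arrtac H.
have [be0|/(classify_bd H1 nw) h] := eqVneq (m b e) 0; last by right; exists a, b, c, e, d.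
have H2 : arr T [:: a; c; b; d; e] by arrtac H.
have [cd0|/(classify_bd H2 nw') h] := eqVneq (m c d) 0; last by right; exists a, c, b, d, e.
have H3 : arr T [:: a; c; b; e; d] by arrtac H.
have [ce0|/(classify_bd H3 nw') h] := eqVneq (m c e) 0; last by right; exists a, c, b, e, d.
left; exists a, b, c, d, e; split=> //.
have x0 : m a b != 0 by apply: contraNneq nw => ->; rewrite wedgeC wedge0.
have y0 : m a c != 0 by apply: contraNneq nw => ->; rewrite wedge0.
have bcx : wedge (m b c) (m a b).
  apply/contraT; rewrite wedgeC mC => n1.
  have := @conc_at_eq0 b a c d e ltac:(arrtac H) n1; rewrite bd0 be0 !addr0 => E.
  have {}E : m b c = - m b a by rewrite -[LHS]addr0 -(subrr (m b a)) addrA (addrC (m b c)) E sub0r.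
  by move: n1; rewrite E -scaleN1r wedge_scale // wedge_self.
have bcy : wedge (m b c) (m a c).
  apply/contraT; rewrite wedgeC mC (mC b c) => n1.
  have := @conc_at_eq0 c a b d e ltac:(arrtac H) n1; rewrite cd0 ce0 !addr0 => E.
  have {}E : m c b = - m c a by rewrite -[LHS]addr0 -(subrr (m c a)) addrA (addrC (m c b)) E sub0r.
  by move: n1; rewrite E -scaleN1r wedge_scale // wedge_self.
split=> //; first exact: (wedge2_eq0 nw).
split=> //; apply: (wedge2_eq0 nw); first by apply: (@disj d e a b c); arrtac H.
by apply: (@disj d e a c b); arrtac H.
Qed.

End Classify.

(** * Separation of simple poles *)

Section Poles.
Local Open Scope ring_scope.
Variable R : realFieldType.

Lemma poly_cofinite0 (p : {poly R}) (bad : seq R) :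
  (forall t, t \notin bad -> p.[t] = 0) -> p = 0.
Proof.
move=> h; pose q := p * \prod_(b <- bad) ('X - b%:P).
have q0 : q = 0.
  apply/eqP; case: (eqVneq q 0) => // qn0.
  pose rs := [seq i%:R : R | i <- iota 0 (size q)].
  have : (size rs < size q)%N.
    apply: max_poly_roots => //.
      apply/allP => t _; rewrite rootE /q hornerM horner_prod.
      case: (boolP (t \in bad)) => tb; last by rewrite h ?mul0r.
      by rewrite (big_rem t) //= hornerXsubC subrr mul0r mulr0.
    by rewrite map_inj_uniq ?iota_uniq // => i j /eqP; rewrite eqr_nat => /eqP.
  by rewrite size_map size_iota ltnn.
have : p * \prod_(b <- bad) ('X - b%:P) == 0 by rewrite -/q q0.
rewrite mulf_eq0 => /orP[/eqP //|/eqP pr0].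
have : \prod_(b <- bad) ('X - b%:P) \is monic by apply: monic_prod_XsubC.
by rewrite pr0 monicE lead_coef0 eq_sym oner_eq0.
Qed.

Lemma exists_notin (bad : seq R) : exists t, t \notin bad.
Proof.
pose rs := [seq i%:R : R | i <- iota 0 (size bad).+1].
have urs : uniq rs by rewrite map_inj_uniq ?iota_uniq // => i j /eqP; rewrite eqr_nat => /eqP.
case: (boolP (all (mem bad) rs)) => [/allP sub|].
  by have := uniq_leq_size urs sub; rewrite size_map size_iota ltnn.
by rewrite -has_predC => /hasP[t _ tb]; exists t.
Qed.

(* A linear combination of 1/t and of three further simple fractions vanishes
   only if all its residues do. *)
Lemma residues0 (A B1 B2 B3 a1 b1 a2 b2 a3 b3 : R) (bad : seq R) :
  a1 != 0 -> a2 != 0 -> a3 != 0 -> b1 != 0 -> b2 != 0 -> b3 != 0 ->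
  a1 != b1 -> a2 != b2 -> a3 != b3 ->
  a1 * b2 - a2 * b1 != 0 -> a1 * b3 - a3 * b1 != 0 -> a2 * b3 - a3 * b2 != 0 ->
  (forall t, t \notin bad -> t != 0 ->
    a1 * (1 - t) + b1 * t != 0 -> a2 * (1 - t) + b2 * t != 0 -> a3 * (1 - t) + b3 * t != 0 ->
    A / t + B1 * b1 / (a1 * (1 - t) + b1 * t) + B2 * b2 / (a2 * (1 - t) + b2 * t)
      + B3 * b3 / (a3 * (1 - t) + b3 * t) = 0) ->
  [/\ A = 0, B1 = 0, B2 = 0 & B3 = 0].
Proof.
move=> a10 a20 a30 b10 b20 b30 ab1 ab2 ab3 d12 d13 d23 h.
have [l lE] : exists l : R -> R -> {poly R}, forall a b t, (l a b).[t] = a * (1 - t) + b * t.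
  by exists (fun a b => a%:P * (1 - 'X) + b%:P * 'X) => a b t; rewrite !hornerE.
(* The numerator over the common denominator. It vanishes off a finite set, hence everywhere, and
   its values at the four distinct poles are the residues up to nonzero factors. *)
pose P : {poly R} := A%:P * l a1 b1 * l a2 b2 * l a3 b3 +
  'X * ((B1 * b1)%:P * l a2 b2 * l a3 b3 + (B2 * b2)%:P * l a1 b1 * l a3 b3
        + (B3 * b3)%:P * l a1 b1 * l a2 b2).
have lroot (a b t : R) : a != b -> a * (1 - t) + b * t = 0 -> t = a / (a - b).
  move=> ab E; have ab' : a - b != 0 by rewrite subr_eq0.
  apply: (mulIf ab'); rewrite divfK //; apply/eqP; rewrite -subr_eq0.
  by rewrite -[X in _ == X]oppr0 -E; apply/eqP; ring.
have P0 : P = 0.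
  apply: (@poly_cofinite0 _ (0 :: a1 / (a1 - b1) :: a2 / (a2 - b2) :: a3 / (a3 - b3) :: bad)) => t.
  rewrite !inE !negb_or => /and5P[t0 t1 t2 t3 tb].
  have n1 : a1 * (1 - t) + b1 * t != 0 by apply: contraNneq t1 => /(lroot _ _ _ ab1) ->.
  have n2 : a2 * (1 - t) + b2 * t != 0 by apply: contraNneq t2 => /(lroot _ _ _ ab2) ->.
  have n3 : a3 * (1 - t) + b3 * t != 0 by apply: contraNneq t3 => /(lroot _ _ _ ab3) ->.
  have E := h t tb t0 n1 n2 n3.
  rewrite /P !(hornerM, hornerD) !lE !hornerE.
  rewrite -[RHS](mulr0 (t * (a1 * (1 - t) + b1 * t) * (a2 * (1 - t) + b2 * t) *
    (a3 * (1 - t) + b3 * t))) -E.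
  by field; rewrite n1 n2 n3 t0.
have PE t : A * (a1 * (1 - t) + b1 * t) * (a2 * (1 - t) + b2 * t) * (a3 * (1 - t) + b3 * t) +
  t * (B1 * b1 * (a2 * (1 - t) + b2 * t) * (a3 * (1 - t) + b3 * t)
     + B2 * b2 * (a1 * (1 - t) + b1 * t) * (a3 * (1 - t) + b3 * t)
     + B3 * b3 * (a1 * (1 - t) + b1 * t) * (a2 * (1 - t) + b2 * t)) = 0.
  have := congr1 (fun q : {poly R} => q.[t]) P0.
  by rewrite /P !(hornerM, hornerD) !lE !hornerE.
have z4 (p q r s : R) : q != 0 -> r != 0 -> s != 0 -> p * q * r * s = 0 -> p = 0.
  move=> q0 r0 s0 /eqP; rewrite !mulf_eq0 (negPf q0) (negPf r0) (negPf s0) !orbF.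
  by move/eqP.
have lv (a b a' b' : R) : a != b -> a' * (1 - a / (a - b)) + b' * (a / (a - b)) =
    (a * b' - a' * b) / (a - b).
  by move=> ab; field; rewrite subr_eq0.
split.
- have := PE 0; rewrite !(subr0, mulr1, mulr0, addr0, mul0r); exact: z4.
- have := PE (a1 / (a1 - b1)); rewrite !lv // subrr !(mul0r, mulr0, add0r, addr0).
  move=> E; apply: (z4 _ (b1 * (a1 / (a1 - b1))) (a1 * b2 - a2 * b1) (a1 * b3 - a3 * b1)) => //.
    by rewrite !mulf_neq0 ?invr_neq0 ?subr_eq0.
  have u : a1 - b1 != 0 by rewrite subr_eq0.
  transitivity ((a1 - b1) ^+ 2 * 0 : R); last by rewrite mulr0.
  by rewrite -E; field.
- have := PE (a2 / (a2 - b2)); rewrite !lv // subrr !(mul0r, mulr0, add0r, addr0).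
  move=> E; apply: (z4 _ (b2 * (a2 / (a2 - b2))) (a1 * b2 - a2 * b1) (a2 * b3 - a3 * b2)) => //.
    by rewrite !mulf_neq0 ?invr_neq0 ?subr_eq0.
  have u : a2 - b2 != 0 by rewrite subr_eq0.
  transitivity (- (a2 - b2) ^+ 2 * 0 : R); last by rewrite mulr0.
  by rewrite -E; field.
- have := PE (a3 / (a3 - b3)); rewrite !lv // subrr !(mul0r, mulr0, add0r, addr0).
  move=> E; apply: (z4 _ (b3 * (a3 / (a3 - b3))) (a1 * b3 - a3 * b1) (a2 * b3 - a3 * b2)) => //.
    by rewrite !mulf_neq0 ?invr_neq0 ?subr_eq0.
  have u : a3 - b3 != 0 by rewrite subr_eq0.
  transitivity ((a3 - b3) ^+ 2 * 0 : R); last by rewrite mulr0.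
  by rewrite -E; field.
Qed.

End Poles.

(** * Stars of a vertex, and a vertex moved onto a line *)

Section Local.
Local Open Scope ring_scope.
Variables (R : realFieldType) (n : nat).
Implicit Types (x y : 'I_n -> R) (i j k v a b c d e : 'I_n).

(** A product of two linear forms vanishing on two of the directions is a quadratic form that
    isolates the coefficient of the third. *)
Lemma dv_free (a1 b1 a2 b2 a3 b3 c1 c2 c3 : R) :
  a1 * b2 - a2 * b1 != 0 -> a1 * b3 - a3 * b1 != 0 -> a2 * b3 - a3 * b2 != 0 ->
  c1 *: dv a1 b1 + c2 *: dv a2 b2 + c3 *: dv a3 b3 = 0 -> [/\ c1 = 0, c2 = 0 & c3 = 0].
Proof.
move=> h12 h13 h23 E.
have E0 := congr1 (fun M : 'rV[R]_3 => M 0 (@Ordinal 3 0 isT)) E.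
have E1 := congr1 (fun M : 'rV[R]_3 => M 0 (@Ordinal 3 1 isT)) E.
have E2 := congr1 (fun M : 'rV[R]_3 => M 0 (@Ordinal 3 2 isT)) E.
move: E0 E1 E2; rewrite !mxE /= => E0 E1 E2.
have z (p q r : R) : q != 0 -> r != 0 -> p * q * r = 0 -> p = 0.
  by move=> q0 r0 /eqP; rewrite !mulf_eq0 (negPf q0) (negPf r0) !orbF => /eqP.
split.
- apply: (z _ _ _ h12 h13).
  transitivity (b2 * b3 * 0 - (a2 * b3 + a3 * b2) * 0 + a2 * a3 * 0 : R); last by ring.
  by rewrite -[in b2 * b3 * 0]E0 -[in (_ + _) * 0]E1 -[in a2 * a3 * 0]E2; ring.
- apply: (z _ _ _ h12 h23).
  transitivity (- (b1 * b3 * 0 - (a1 * b3 + a3 * b1) * 0 + a1 * a3 * 0 : R)); last by ring.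
  by rewrite -[in b1 * b3 * 0]E0 -[in (_ + _) * 0]E1 -[in a1 * a3 * 0]E2; ring.
- apply: (z _ _ _ h13 h23).
  transitivity (b1 * b2 * 0 - (a1 * b2 + a2 * b1) * 0 + a1 * a2 * 0 : R); last by ring.
  by rewrite -[in b1 * b2 * 0]E0 -[in (_ + _) * 0]E1 -[in a1 * a2 * 0]E2; ring.
Qed.

(** Modulo [W], which is zero in the columns of [v], a combination of the rows of [M] is determined
    by its block at [v]. *)
Lemma add_free_star m q (W : 'M[R]_(m, 3 * n)) (M : 'M[R]_(q, 3 * n)) v :
  W *m blk R v = 0 -> row_free (M *m blk R v) ->
  \rank (W + M)%MS = (\rank W + q)%N /\
  forall f : 'rV[R]_(3 * n), (f <= W + M)%MS -> f *m blk R v = 0 -> (f <= W)%MS.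
Proof.
move=> W0 Mf.
have rM : \rank M = q.
  apply/eqP; rewrite eqn_leq rank_leq_row /=.
  by rewrite -{1}(eqP Mf) mxrankM_maxl.
split.
  rewrite -{2}rM; apply: mxrank_disjoint_sum; apply/eqP/rowV0P => u.
  rewrite sub_capmx => /andP[/submxP[p ->]] /submxP[r E].
  have : r *m (M *m blk R v) = 0 by rewrite mulmxA -E -mulmxA W0 mulmx0.
  rewrite -[RHS](mul0mx _ (M *m blk R v)) => /(row_free_inj Mf) r0.
  by rewrite E r0 mul0mx.
move=> f /sub_addsmxP[[p r] /= E] f0.
have : r *m (M *m blk R v) = 0.
  by rewrite mulmxA -[LHS]add0r -[X in X + _](mulmx0 _ p) -W0 mulmxA -mulmxDl -E.
rewrite -[RHS](mul0mx _ (M *m blk R v)) => /(row_free_inj Mf) r0.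
by rewrite E r0 mul0mx addr0 submxMl.
Qed.

Lemma rank1_wedge (B : 'M[R]_(3 * n)) (u v : 'rV[R]_(3 * n)) :
  (\rank B <= 1)%N -> (u <= B)%MS -> (v <= B)%MS -> wedge u v.
Proof.
move=> rB uB vB; case: (eqVneq u 0) => [->|u0]; first by rewrite wedgeC wedge0.
have ru : \rank u = 1%N by rewrite rank_rV u0.
have BU : (B <= u)%MS by rewrite -(mxrank_leqif_sup uB) eqn_leq mxrankS // ru.
have /sub_rVP[c ->] : (v <= u)%MS by apply: submx_trans BU.
exact/wedge_scale/wedge_self.
Qed.

(** [cokermx W] represents the quotient by [W], in which the two images share a space of dimension
    at most one. *)
Lemma wedge_mod m (W : 'M[R]_(m, 3 * n)) (u v : 'rV[R]_(3 * n)) :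
  (\rank (W + u + v)%MS <= \rank W + 1)%N -> wedge (u *m cokermx W) (v *m cokermx W).
Proof.
move=> h; set A := (W + u + v)%MS in h *.
have WA : (W <= A)%MS by rewrite /A (submx_trans (addsmxSl W u)) ?addsmxSl.
have kW : (kermx (cokermx W) <= W)%MS.
  by rewrite submxE mulmx_ker.
apply: (@rank1_wedge (A *m cokermx W)).
- have := mxrank_mul_ker A (cokermx W).
  have : (\rank W <= \rank (A :&: kermx (cokermx W))%MS)%N.
    apply: mxrankS; rewrite sub_capmx WA /=; apply/sub_kermxP.
    by rewrite mulmx_coker.
  lia.
- by apply: submxMr; rewrite /A (submx_trans _ (addsmxSl _ _)) ?addsmxSr.
- by apply: submxMr; rewrite /A addsmxSr.
Qed.

Definition upd (f : 'I_n -> R) v r : 'I_n -> R := fun i => if i == v then r else f i.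

Lemma upd_neq f v r i : i != v -> upd f v r i = f i.
Proof. by rewrite /upd => /negPf ->. Qed.
Lemma upd_eq f v r : upd f v r v = r.
Proof. by rewrite /upd eqxx. Qed.

Lemma erow_upd x y v p q i j : i != v -> j != v ->
  erow (upd x v p) (upd y v q) i j = erow x y i j.
Proof. by move=> iv jv; rewrite /erow !upd_neq. Qed.

Lemma br_upd x y v p q i j k : i != v -> j != v -> k != v ->
  br (upd x v p) (upd y v q) i j k = br x y i j k.
Proof. by move=> iv jv kv; rewrite /br !upd_neq. Qed.

(* The last condition rules out that two of the lines spanned by the vertices
   are parallel. *)
Definition gp x y :=
  (forall i j k, uniq [:: i; j; k] -> br x y i j k != 0) /\
  (forall i j k l, uniq [:: i; j; k; l] -> br x y i j k != br x y i j l).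

Definition star x y v (T : {set 'I_n}) : 'M[R]_(3 * n) :=
  (\sum_(u in T) <<erow x y v u>>)%MS.

Lemma sub_star x y v (T : {set 'I_n}) u : u \in T -> (erow x y v u <= star x y v T)%MS.
Proof. by move=> uT; apply: (sumsmx_sup u) => //; rewrite genmxE. Qed.

Lemma star3_free x y v (a b c : 'I_n) : a != v -> b != v -> c != v ->
  br x y v a b != 0 -> br x y v a c != 0 -> br x y v b c != 0 ->
  row_free (col_mx (erow x y v a) (col_mx (erow x y v b) (erow x y v c)) *m blk R v).
Proof.
move=> av bv cv h1 h2 h3; apply: inj_row_free => w.
rewrite -[w](@hsubmxK _ 1 1 2) -[rsubmx w](@hsubmxK _ 1 1 1).
rewrite !mul_col_mx !mul_row_col !erow_blk ?[v == _]eq_sym // !eqxx.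
set p := lsubmx _; set q := lsubmx _; set r := rsubmx _.
rewrite (mx11_scalar p) (mx11_scalar q) (mx11_scalar r) !mul_scalar_mx addrA => E.
by have [] := dv_free _ _ _ E; rewrite ?br_cross // => -> -> ->; rewrite !raddf0 !row_mx0.
Qed.

Lemma sub_star3 x y v (T : {set 'I_n}) (a b c : 'I_n) : a \in T -> b \in T -> c \in T ->
  (col_mx (erow x y v a) (col_mx (erow x y v b) (erow x y v c)) <= star x y v T)%MS.
Proof. by move=> aT bT cT; rewrite !col_mx_sub !sub_star. Qed.

Section OnLine.
Variables (x y : 'I_n -> R) (v a b c d e : 'I_n) (t : R).
Let p := x a + t * (x b - x a).
Let q := y a + t * (y b - y a).
Let x' := upd x v p.
Let y' := upd y v q.

(** The directions from [a] and [b] to [v] are [t] and [t - 1] times that from [a] to [b]; these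
    coefficients cancel the two blocks at [v]. *)
Lemma line_row (av : a != v) (bv : b != v) :
  (1 - t) ^+ 2 *: erow x' y' v a - t ^+ 2 *: erow x' y' v b =
  - (t ^+ 2 * (1 - t) ^+ 2) *: erow x y a b.
Proof.
rewrite /erow /x' /y' !upd_eq !upd_neq //.
apply/rowP => k; rewrite !mxE.
move: (k %/ 3 == v)%N%:R (k %/ 3 == a)%N%:R (k %/ 3 == b)%N%:R => V A B.
by do 2 ?[case: ifP => _]; rewrite /p /q; ring.
Qed.

Lemma br_line_ac (av : a != v) (cv : c != v) : br x' y' v a c = t * br x y a c b.
Proof. rewrite /br /x' /y' !upd_eq !upd_neq // /p /q. ring. Qed.

Lemma br_line_cd (cv : c != v) (dv : d != v) :
  br x' y' v c d = br x y c d a * (1 - t) + br x y c d b * t.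
Proof. by rewrite /br /x' /y' !upd_eq !upd_neq // /p /q; ring. Qed.

End OnLine.

End Local.

(** * Vertices of degree 4 and 5 *)

Section Local45.
Local Open Scope ring_scope.
Variables (R : realFieldType) (n : nat).
Variables (x y : 'I_n -> R).
Hypothesis Hgp : gp x y.
Implicit Types (i j k v a b c d e : 'I_n).

Lemma br_neq0 i j k : uniq [:: i; j; k] -> br x y i j k != 0.
Proof. by case: Hgp => h _; apply: h. Qed.

Lemma br_neq i j k l : uniq [:: i; j; k; l] -> br x y i j k != br x y i j l.
Proof. by case: Hgp => _ h; apply: h. Qed.

Section Star.
Variables (m : nat) (W : 'M[R]_(m, 3 * n)) (v : 'I_n) (T : {set 'I_n}).
Hypothesis W0 : W *m blk R v = 0.

(** With [v] on the line [ab], the rows to [a], [c], [d] use up the three available dimensions, so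
    the combination of [line_row], whose block at [v] is zero, must lie in [W]. *)
Lemma star4_rows a b c d :
  (forall p q, (\rank (W + star (upd x v p) (upd y v q) v T)%MS <= \rank W + 3)%N) ->
  uniq [:: v; a; b; c; d] -> a \in T -> b \in T -> c \in T -> d \in T ->
  (erow x y a b <= W)%MS.
Proof.
move=> H U aT bT cT dT; usplit U.
have Hac : br x y a c b != 0 by apply: br_neq0; uq.
have Had : br x y a d b != 0 by apply: br_neq0; uq.
have Hcda : br x y c d a != br x y c d b by apply: br_neq; uq.
(* Excluded are [v] at [a], [v] at [b], and [v] on the line [cd], where the blocks of [vc] and [vd]
   become parallel. *)
have [t] := exists_notin [:: 0; 1; br x y c d a / (br x y c d a - br x y c d b)].
rewrite !inE !negb_or => /and3P[t0 t1 t2].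
pose p := x a + t * (x b - x a); pose q := y a + t * (y b - y a).
have [va vb vc vd] : [/\ a != v, b != v, c != v & d != v] by split; uq.
have f := line_row x y t va vb.
have fr : row_free (col_mx (erow (upd x v p) (upd y v q) v a)
   (col_mx (erow (upd x v p) (upd y v q) v c) (erow (upd x v p) (upd y v q) v d)) *m blk R v).
  apply: star3_free => //; rewrite ?br_line_ac ?mulf_neq0 // br_line_cd //.
  apply: contra t2 => /eqP E; apply/eqP.
  have nz0 : br x y c d a - br x y c d b != 0 by rewrite subr_eq0.
  apply: (mulIf nz0); rewrite divfK //; apply/eqP; rewrite -subr_eq0.
  by rewrite -[X in _ == X]oppr0 -E; apply/eqP; ring.
have [rk sub] := add_free_star W0 fr.
set M := col_mx _ _ in fr rk sub.
have MS : (W + M <= W + star (upd x v p) (upd y v q) v T)%MS.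
  by apply: addsmxS => //; apply: sub_star3.
have SM : (W + star (upd x v p) (upd y v q) v T <= W + M)%MS.
  by rewrite -(mxrank_leqif_sup MS) eqn_leq mxrankS //= rk H.
have nz : - (t ^+ 2 * (1 - t) ^+ 2) != 0.
  by rewrite oppr_eq0 mulf_neq0 // expf_neq0 // subr_eq0 eq_sym.
rewrite -(eqmx_scale _ nz) -f; apply: sub.
  apply: submx_trans SM; apply: submx_trans (addsmxSr _ _).
  by rewrite addmx_sub ?eqmx_opp ?scalemx_sub ?sub_star.
rewrite f -scalemxAl erow_blk; last by uq.
by rewrite ![v == _]eq_sym (negPf va) (negPf vb) scaler0.
Qed.

(** The term of the edge [ij] in the K_5 relation on the five indices, taken modulo [W]. *)
Let m_ (i j k l r : 'I_n) := (sg x y i j k l r *: erow x y i j) *m cokermx W.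

(** With [v] at parameter [t] of the line [ab], the row of [ab] and the part [f2] without [v] of the
    K_5 relation on [v], [a], [c], [d], [e] both have zero block at [v]. Three independent rows of
    the star leave one dimension for the two, so they are parallel modulo [W] for almost all [t];
    the four assertions are the residues of this identity. *)
Lemma star5_wedge a b c d e :
  (forall p q, (\rank (W + star (upd x v p) (upd y v q) v T)%MS <= \rank W + 4)%N) ->
  uniq [:: v; a; b; c; d; e] -> a \in T -> b \in T -> c \in T -> d \in T -> e \in T ->
  [/\ wedge (m_ a b c d e) (m_ a c b d e + m_ a d b c e + m_ a e b c d),
      wedge (m_ a b c d e) (m_ c d a b e),
      wedge (m_ a b c d e) (m_ c e a b d) & wedge (m_ a b c d e) (m_ d e a b c)].
Proof.
move=> H U aT bT cT dT eT; usplit U.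
have [va vb vc vd] : [/\ a != v, b != v, c != v & d != v] by split; uq.
have ve : e != v by uq.
have Hac : br x y a c b != 0 by apply: br_neq0; uq.
have Had : br x y a d b != 0 by apply: br_neq0; uq.
have Hae : br x y a e b != 0 by apply: br_neq0; uq.
have K1 : br x y a c d != 0 by apply: br_neq0; uq.
have K2 : br x y a c e != 0 by apply: br_neq0; uq.
have K3 : br x y a d e != 0 by apply: br_neq0; uq.
have Kadc : br x y a d c != 0 by apply: br_neq0; uq.
have Kaec : br x y a e c != 0 by apply: br_neq0; uq.
have Kaed : br x y a e d != 0 by apply: br_neq0; uq.
have K4 : br x y c d e != 0 by apply: br_neq0; uq.
have K5 : br x y c d a != 0 by apply: br_neq0; uq.
have K6 : br x y c e a != 0 by apply: br_neq0; uq.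
have K7 : br x y d e a != 0 by apply: br_neq0; uq.
have K8 : br x y c d b != 0 by apply: br_neq0; uq.
have K9 : br x y c e b != 0 by apply: br_neq0; uq.
have K10 : br x y d e b != 0 by apply: br_neq0; uq.
have K11 : br x y a b c != 0 by apply: br_neq0; uq.
have N1 : br x y c d a != br x y c d b by apply: br_neq; uq.
have N2 : br x y c e a != br x y c e b by apply: br_neq; uq.
have N3 : br x y d e a != br x y d e b by apply: br_neq; uq.
(* By the quadratic bracket relations these determinants factor, so the poles on the lines [cd],
   [ce], [de] are distinct. *)
have P1 : br x y c d a * br x y c e b - br x y c e a * br x y c d b != 0.
  suff -> : br x y c d a * br x y c e b - br x y c e a * br x y c d b
    = - (br x y c d e * br x y a c b) by rewrite oppr_eq0 mulf_neq0.
  by rewrite /br; ring.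
have P2 : br x y c d a * br x y d e b - br x y d e a * br x y c d b != 0.
  suff -> : br x y c d a * br x y d e b - br x y d e a * br x y c d b
    = - (br x y c d e * br x y a d b) by rewrite oppr_eq0 mulf_neq0.
  by rewrite /br; ring.
have P3 : br x y c e a * br x y d e b - br x y d e a * br x y c e b != 0.
  suff -> : br x y c e a * br x y d e b - br x y d e a * br x y c e b
    = - (br x y c d e * br x y a e b) by rewrite oppr_eq0 mulf_neq0.
  by rewrite /br; ring.
suff key (i j : 'I_(3 * n)) :
  let w u := m_ a b c d e 0 i * u 0 j - m_ a b c d e 0 j * u 0 i in
  [/\ w (m_ a c b d e + m_ a d b c e + m_ a e b c d) = 0, w (m_ c d a b e) = 0,
      w (m_ c e a b d) = 0 & w (m_ d e a b c) = 0].
  by split; apply/wedgeP => i j; have [k1 k2 k3 k4] := key i j; apply/eqP;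
    rewrite -subr_eq0; apply/eqP.
move=> w.
(* The pole at 0 is [v] at [a]; the others are the intersections of [ab] with [cd], [ce], [de]. At
   [t = 1] the multiple of the row [ab] in [line_row] vanishes, so this value is excluded. *)
apply: (residues0 (bad := [:: 1]) K5 K6 K7 K8 K9 K10 N1 N2 N3 P1 P2 P3) => t.
rewrite inE => t1 t0 l1 l2 l3.
pose x' := upd x v (x a + t * (x b - x a)); pose y' := upd y v (y a + t * (y b - y a)).
have Bac : br x' y' v a c = t * br x y a c b by apply: br_line_ac.
have Bad : br x' y' v a d = t * br x y a d b by apply: br_line_ac.
have Bae : br x' y' v a e = t * br x y a e b by apply: br_line_ac.
have Bcd : br x' y' v c d = br x y c d a * (1 - t) + br x y c d b * t by apply: br_line_cd.
have Bce : br x' y' v c e = br x y c e a * (1 - t) + br x y c e b * t by apply: br_line_cd.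
have Bde : br x' y' v d e = br x y d e a * (1 - t) + br x y d e b * t by apply: br_line_cd.
have bE i' j' k' : i' != v -> j' != v -> k' != v -> br x' y' i' j' k' = br x y i' j' k'.
  exact: br_upd.
have g5 : gp5 x' y' v a c d e.
  split; rewrite ?Bac ?Bad ?Bae ?Bcd ?mulf_neq0 //.
  by split; rewrite ?Bce ?Bde ?bE //; split; rewrite bE.
have rel := K5rel g5.
pose f2 := sg x' y' a c v d e *: erow x' y' a c + sg x' y' a d v c e *: erow x' y' a d
  + sg x' y' a e v c d *: erow x' y' a e + sg x' y' c d v a e *: erow x' y' c d
  + sg x' y' c e v a d *: erow x' y' c e + sg x' y' d e v a c *: erow x' y' d e.
have f2S : (f2 <= star x' y' v T)%MS.
  have -> : f2 = - (sg x' y' v a c d e *: erow x' y' v a + sg x' y' v c a d e *: erow x' y' v c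
     + sg x' y' v d a c e *: erow x' y' v d + sg x' y' v e a c d *: erow x' y' v e).
    by apply/eqP; rewrite -addr_eq0 -[X in _ == X]rel /f2; apply/eqP/rowP => k; rewrite !mxE; ring.
  by rewrite eqmx_opp !addmx_sub ?scalemx_sub ?sub_star.
have er i' j' : i' != v -> j' != v -> erow x' y' i' j' = erow x y i' j' by exact: erow_upd.
have s1 : sg x' y' a c v d e = t^-1 * sg x y a c b d e.
  by rewrite /sg -[br x' y' a c v]br_rot Bac !bE //; field; rewrite ?K1 ?K2 ?Hac ?t0.
have s2 : sg x' y' a d v c e = t^-1 * sg x y a d b c e.
  by rewrite /sg -[br x' y' a d v]br_rot Bad !bE //; field; rewrite ?Kadc ?K3 ?Had ?t0.
have s3 : sg x' y' a e v c d = t^-1 * sg x y a e b c d.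
  by rewrite /sg -[br x' y' a e v]br_rot Bae !bE //; field; rewrite ?Kaec ?Kaed ?Hae ?t0.
have s4 : sg x' y' c d v a e = br x y c d b / (br x y c d a * (1 - t) + br x y c d b * t) * sg x y c d a b e.
  by rewrite /sg -[br x' y' c d v]br_rot Bcd !bE //; field; rewrite ?l1 ?K5 ?K8 ?K4.
have Kced : br x y c e d != 0 by apply: br_neq0; uq.
have Kdec : br x y d e c != 0 by apply: br_neq0; uq.
have s5 : sg x' y' c e v a d = br x y c e b / (br x y c e a * (1 - t) + br x y c e b * t) * sg x y c e a b d.
  by rewrite /sg -[br x' y' c e v]br_rot Bce !bE //; field; rewrite ?l2 ?K6 ?K9 ?Kced.
have s6 : sg x' y' d e v a c = br x y d e b / (br x y d e a * (1 - t) + br x y d e b * t) * sg x y d e a b c.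
  by rewrite /sg -[br x' y' d e v]br_rot Bde !bE //; field; rewrite ?l3 ?K7 ?K10 ?Kdec.
have f2E : f2 *m cokermx W = t^-1 *: (m_ a c b d e + m_ a d b c e + m_ a e b c d)
   + (br x y c d b / (br x y c d a * (1 - t) + br x y c d b * t)) *: m_ c d a b e
   + (br x y c e b / (br x y c e a * (1 - t) + br x y c e b * t)) *: m_ c e a b d
   + (br x y d e b / (br x y d e a * (1 - t) + br x y d e b * t)) *: m_ d e a b c.
  by rewrite /f2 !er // s1 s2 s3 s4 s5 s6 /m_ !mulmxDl -!scalemxAl !scalerDr !scalerA.
have f2b : f2 *m blk R v = 0.
  have z i' j' : i' != v -> j' != v -> i' != j' -> erow x y i' j' *m blk R v = 0.
    move=> h1 h2 h3; rewrite erow_blk // ![v == _]eq_sym.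
    by rewrite (negPf h1) (negPf h2).
  by rewrite /f2 !er // !mulmxDl -!scalemxAl !z ?scaler0 ?addr0 //; uq.
have fr : row_free (col_mx (erow x' y' v a)
   (col_mx (erow x' y' v c) (erow x' y' v d)) *m blk R v).
  by case: g5 => h1 h2 _ h3 _; apply: star3_free.
pose W1 := (W + erow x y a b + f2)%MS.
have nab : a != b by uq.
have W10 : W1 *m blk R v = 0.
  apply/eqP; rewrite -submx0 /W1 addsmxMr addsmx_sub addsmxMr addsmx_sub.
  by rewrite W0 f2b erow_blk // ![v == _]eq_sym (negPf va) (negPf vb) !sub0mx.
have [rk _] := add_free_star W10 fr.
have f1S : (erow x y a b <= star x' y' v T)%MS.
  have nz : - (t ^+ 2 * (1 - t) ^+ 2) != 0.
    by rewrite oppr_eq0 mulf_neq0 // expf_neq0 // subr_eq0 eq_sym.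
  rewrite -(eqmx_scale _ nz) -(line_row x y t va vb).
  by rewrite addmx_sub ?eqmx_opp ?scalemx_sub // ?sub_star.
have rW1 : (\rank W1 <= \rank W + 1)%N.
  have : (\rank (W1 + col_mx (erow x' y' v a) (col_mx (erow x' y' v c) (erow x' y' v d)))%MS
     <= \rank (W + star x' y' v T)%MS)%N.
    apply: mxrankS; rewrite !addsmx_sub addsmxSl /=.
    by rewrite !(submx_trans _ (addsmxSr _ _)) // sub_star3.
  rewrite rk => h1; have h2 := leq_trans h1 (H _ _).
  by rewrite -(leq_add2r 3) -addnA.
have /wedgeP := wedge_scale (sg x y a b c d e) (etrans (wedgeC _ _) (wedge_mod rW1)).
rewrite scalemxAl -/(m_ a b c d e) f2E => /(_ j i).
rewrite /w !mxE.
move: (m_ a b c d e 0 i) (m_ a b c d e 0 j) => u1 u2 E.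
apply/eqP; move: E => /eqP; rewrite -subr_eq0 => /eqP E; rewrite -[X in _ == X]E.
by apply/eqP; ring.
Qed.

End Star.
End Local45.

(** * Generic positions *)

Section Generic.
Local Open Scope ring_scope.
Variables (R : realFieldType) (n : nat).
Implicit Types (x y : 'I_n -> R) (f g : ('I_n -> R) -> ('I_n -> R) -> R).

(** The functions that [generic] can test; the class is closed under sums and products, hence
    contains all minors of the matrices in use. *)
Definition ratpoly f := exists P : {mpoly rat[n + n]},
  forall x y, f x y = (map_mpoly (ratr : rat -> R) P).@[coords x y].

Lemma ratpolyD f g : ratpoly f -> ratpoly g -> ratpoly (fun x y => f x y + g x y).
Proof. by case=> P hP [Q hQ]; exists (P + Q) => x y; rewrite hP hQ !rmorphD. Qed.
Lemma ratpolyM f g : ratpoly f -> ratpoly g -> ratpoly (fun x y => f x y * g x y).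
Proof. by case=> P hP [Q hQ]; exists (P * Q) => x y; rewrite hP hQ !rmorphM. Qed.
Lemma ratpolyN f : ratpoly f -> ratpoly (fun x y => - f x y).
Proof. by case=> P hP; exists (- P) => x y; rewrite hP !rmorphN. Qed.
Lemma ratpolyB f g : ratpoly f -> ratpoly g -> ratpoly (fun x y => f x y - g x y).
Proof. by move=> hf /ratpolyN; apply: ratpolyD. Qed.
Lemma ratpoly_nat k : ratpoly (fun _ _ => k%:R).
Proof. by exists k%:R => x y; rewrite !rmorph_nat. Qed.
Lemma ratpoly_sign s : ratpoly (fun _ _ => (-1) ^+ s).
Proof. by exists ((-1) ^+ s) => x y; rewrite !rmorphXn !rmorphN !rmorph1. Qed.
Lemma ratpolyX f k : ratpoly f -> ratpoly (fun x y => f x y ^+ k).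
Proof. by case=> P hP; exists (P ^+ k) => x y; rewrite hP !rmorphXn. Qed.
Lemma ratpoly_x i : ratpoly (fun x _ => x i).
Proof.
exists 'X_(lshift n i) => x y; rewrite map_mpolyX mevalXU /coords.
by rewrite -[lshift n i]/(unsplit (inl i)) unsplitK.
Qed.
Lemma ratpoly_y i : ratpoly (fun _ y => y i).
Proof.
exists 'X_(rshift n i) => x y; rewrite map_mpolyX mevalXU /coords.
by rewrite -[rshift n i]/(unsplit (inr i)) unsplitK.
Qed.
Lemma ratpoly_ext f g : (forall x y, f x y = g x y) -> ratpoly f -> ratpoly g.
Proof. by move=> h [P hP]; exists P => x y; rewrite -h. Qed.

Lemma ratpoly_sum (I : Type) (r : seq I) (F : I -> ('I_n -> R) -> ('I_n -> R) -> R) :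
  (forall i, ratpoly (F i)) -> ratpoly (fun x y => \sum_(i <- r) F i x y).
Proof.
move=> h; elim: r => [|a r IH].
  by apply: ratpoly_ext (ratpoly_nat 0) => x y; rewrite big_nil.
by apply: ratpoly_ext (ratpolyD (h a) IH) => x y; rewrite big_cons.
Qed.
Lemma ratpoly_prod (I : Type) (r : seq I) (F : I -> ('I_n -> R) -> ('I_n -> R) -> R) :
  (forall i, ratpoly (F i)) -> ratpoly (fun x y => \prod_(i <- r) F i x y).
Proof.
move=> h; elim: r => [|a r IH].
  by apply: ratpoly_ext (ratpoly_nat 1) => x y; rewrite big_nil.
by apply: ratpoly_ext (ratpolyM (h a) IH) => x y; rewrite big_cons.
Qed.

Lemma ratpoly_br i j k : ratpoly (fun x y => br x y i j k).
Proof.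
by apply: ratpolyB; apply: ratpolyM; apply: ratpolyB; (exact: ratpoly_x || exact: ratpoly_y).
Qed.

Lemma ratpoly_erow i j k : ratpoly (fun x y => erow x y i j 0 k).
Proof.
apply: (@ratpoly_ext (fun x y =>
  ((k %/ 3 == i)%N%:R - (k %/ 3 == j)%N%:R) *
  (if (k %% 3 == 0)%N then (x i - x j) ^+ 2
   else if (k %% 3 == 1)%N then (x i - x j) * (y i - y j) else (y i - y j) ^+ 2))).
  move=> x y; rewrite /erow !mxE inordK ?ltn_mod // -mulrBl; congr (_ * _).
apply: ratpolyM; first by apply: ratpolyB; exact: ratpoly_nat.
have hx : ratpoly (fun x y => x i - x j) by apply: ratpolyB; exact: ratpoly_x.
have hy : ratpoly (fun x y => y i - y j) by apply: ratpolyB; exact: ratpoly_y.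
case: (k %% 3 == 0)%N; first exact: ratpolyX.
case: (k %% 3 == 1)%N; last exact: ratpolyX.
exact: ratpolyM.
Qed.

Section AtGeneric.
Variables (x y : 'I_n -> R).
Hypothesis hgen : generic x y.

Lemma generic_neq0 f x' y' : ratpoly f -> f x' y' != 0 -> f x y != 0.
Proof.
case=> P hP; rewrite !hP => h; apply: hgen.
by apply: contraNneq h => ->; rewrite !rmorph0.
Qed.

(** A nonsingular minor of maximal size at the special position is a polynomial that is not
    identically zero, so it survives at the generic position. *)
Lemma generic_rank q N (M : ('I_n -> R) -> ('I_n -> R) -> 'M[R]_(q, N)) :
  (forall i j, ratpoly (fun x y => M x y i j)) ->
  forall x' y', (\rank (M x' y') <= \rank (M x y))%N.
Proof.
move=> hM x' y'; set A := M x' y'.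
pose f := maxrankfun A.
have fB : row_full (rowsub f A)^T.
  by rewrite /row_full mxrank_tr; apply: maxrowsub_free.
pose g := fullrankfun fB.
have u : \det (rowsub g (rowsub f A)^T) != 0.
  by rewrite -unitfE; have := fullrowsub_unit fB; rewrite unitmxE.
have := @generic_neq0 (fun x y => \det (rowsub g (rowsub f (M x y))^T)) x' y' _ u.
have hd : ratpoly (fun x y => \det (rowsub g (rowsub f (M x y))^T)).
  rewrite /determinant; apply: ratpoly_sum => s; apply: ratpolyM; first exact: ratpoly_sign.
  apply: ratpoly_prod => i; have hE := hM (f (s i)) (g i).
  by apply: (ratpoly_ext _ hE) => x0 y0; rewrite !mxE.
move=> /(_ hd) d0.
have rk : \rank (rowsub g (rowsub f (M x y))^T) = \rank A.
  by apply: mxrank_unit; rewrite unitmxE unitfE.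
rewrite -[leqLHS]rk.
apply: leq_trans (mxrankS (rowsub_sub _ _)) _; rewrite mxrank_tr.
exact/mxrankS/rowsub_sub.
Qed.

Lemma generic_gp : gp x y.
Proof.
split=> [i j k|i j k l]; rewrite /= !inE ?negb_or ?andbT -?andbA.
  move=> /and3P[ij ik jk].
  (* With [j] and [k] at the two unit points and all other vertices at the origin, the bracket of
     [i], [j], [k] is 1; that of [i], [j], [l] is 0, which settles the second condition as well. *)
  apply: (@generic_neq0 _ (fun z => (z == j)%:R) (fun z => (z == k)%:R) (ratpoly_br i j k)).
  rewrite /br !eqxx (negPf ij) (negPf ik) (negPf jk) [k == j]eq_sym (negPf jk).
  by rewrite !subr0 mulr1 mulr0 subr0 oner_eq0.
case/and5P=> ij ik il jk /andP[jl kl].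
rewrite -subr_eq0.
apply: (@generic_neq0 _ (fun z => (z == j)%:R) (fun z => (z == k)%:R)
  (ratpolyB (ratpoly_br i j k) (ratpoly_br i j l))).
rewrite /br !eqxx (negPf ij) (negPf ik) (negPf jk) [k == j]eq_sym (negPf jk).
rewrite [l == j]eq_sym (negPf jl) [l == k]eq_sym (negPf kl).
by rewrite !(subr0, mulr1, mulr0, mul1r) oner_eq0.
Qed.

End AtGeneric.
End Generic.

(** * Graphs and row spaces *)

Section Edges.
Variable n : nat.
Implicit Types (G H X : {set edge n}) (U : {set 'I_n}) (e : edge n) (i j u v : 'I_n).

(** Symmetric adjacency conceals the convention that an edge is an increasing pair; inclusions of
    edge sets are proved through it. *)
Definition adj G i j := [exists e in G, (val e == (i, j)) || (val e == (j, i))].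

Lemma adjP G i j :
  reflect (exists2 e, e \in G & val e = (i, j) \/ val e = (j, i)) (adj G i j).
Proof.
apply: (iffP existsP) => [[e /andP[eG /orP[/eqP h|/eqP h]]]|[e eG h]].
- by exists e => //; left.
- by exists e => //; right.
- by exists e; rewrite eG; case: h => ->; rewrite eqxx ?orbT.
Qed.

Lemma adjC G i j : adj G i j = adj G j i.
Proof. by apply: eq_existsb => e; rewrite orbC. Qed.

Lemma edge_neq e : (val e).1 != (val e).2.
Proof. by rewrite -(inj_eq val_inj) neq_ltn (valP e). Qed.

Lemma adj_neq G i j : adj G i j -> i != j.
Proof.
by case/adjP=> e _ h; have := edge_neq e; case: h => -> //=; rewrite eq_sym.
Qed.

Lemma adj_irr G i : adj G i i = false.
Proof. by apply/idP => /adj_neq; rewrite eqxx. Qed.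

Lemma adj_edge G e : e \in G -> adj G (val e).1 (val e).2.
Proof. by move=> eG; apply/adjP; exists e => //; left; case: (val e). Qed.

Lemma edge_eqP e e' i j :
  (val e = (i, j) \/ val e = (j, i)) -> (val e' = (i, j) \/ val e' = (j, i)) -> e = e'.
Proof.
have h0 := valP e; have h1 := valP e'.
by move=> [h|h] [h'|h']; apply: val_inj; rewrite /= in h0 h1 *; move: h0 h1; rewrite h h' //=; lia.
Qed.

Lemma adj_edgeE G e : adj G (val e).1 (val e).2 = (e \in G).
Proof.
apply/idP/idP; last exact: adj_edge.
case/adjP=> e' e'G h; rewrite (@edge_eqP e e' (val e).1 (val e).2) //.
by left; case: (val e).
Qed.

Lemma edge_of i j : i != j -> exists e, val e = (i, j) \/ val e = (j, i).
Proof.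
rewrite -(inj_eq val_inj) neq_ltn => /orP[h|h].
  by exists (Sub (i, j) h); left.
by exists (Sub (j, i) h); right.
Qed.

Lemma adj_setU G H i j : adj (G :|: H) i j = adj G i j || adj H i j.
Proof.
apply/adjP/orP => [[e]|[]/adjP[e eG h]]; rewrite ?inE; last 2 first.
- by exists e; rewrite // inE eG.
- by exists e; rewrite // inE eG orbT.
by case/orP=> eG h; [left|right]; apply/adjP; exists e.
Qed.

Lemma adj_set0 i j : adj set0 i j = false.
Proof. by apply/adjP => -[e]; rewrite inE. Qed.

Lemma adj_Kset U i j : adj (Kset U) i j = [&& i != j, i \in U & j \in U].
Proof.
apply/idP/idP => [h|/and3P[ij iU jU]].
  rewrite (adj_neq h) /=; case/adjP: h => e; rewrite inE => /andP[h1 h2] [h|h];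
  by move: h1 h2; rewrite h /= => -> ->.
have [e h] := edge_of ij; apply/adjP; exists e => //.
by rewrite inE; case: h => -> /=; rewrite iU jU.
Qed.

Lemma adj_subP G H : reflect (forall i j, adj G i j -> adj H i j) (G \subset H).
Proof.
apply: (iffP subsetP) => [h i j /adjP[e eG he]|h e]; last by rewrite -!adj_edgeE; apply: h.
by apply/adjP; exists e => //; apply: h.
Qed.

Lemma nbhdE G v u : (u \in nbhd G v) = adj G v u.
Proof.
rewrite inE; apply/existsP/adjP => [[e /andP[eG /andP[/andP[]]]]|[e eG h]].
  rewrite /incident => h1 h2 uv; exists e => //.
  move: h1 h2; case: (val e) => p q /= /orP[]/eqP->/orP[]/eqP h; subst.
  - by rewrite eqxx in uv.
  - by left.
  - by right.
  - by rewrite eqxx in uv.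
exists e; rewrite eG /incident.
have := edge_neq e; by case: h => -> /=; rewrite !eqxx ?orbT //= eq_sym.
Qed.

Definition del G v := [set e in G | ~~ incident v e].

Lemma adj_del G v i j : adj (del G v) i j = [&& i != v, j != v & adj G i j].
Proof.
apply/adjP/and3P => [[e]|[iv jv /adjP[e eG h]]].
  rewrite inE /incident negb_or => /and3P[eG h1 h2] h.
  by case: h => h; move: h1 h2; rewrite h /= => h1 h2; split=> //;
    apply/adjP; exists e => //; rewrite h; [left|right].
exists e => //; rewrite inE eG /incident negb_or /=.
by case: h => -> /=; rewrite iv jv.
Qed.

Lemma del_sub G v : del G v \subset G.
Proof. by apply/subsetP => e; rewrite inE => /andP[]. Qed.

Lemma VsetE G v : (v \in Vset G) = (nbhd G v != set0).
Proof.
apply/idP/set0Pn => [|[u]]; rewrite !inE.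
  case/existsP=> e /andP[eG]; rewrite /incident => /orP[]/eqP h.
    by exists (val e).2; rewrite nbhdE -h adj_edge.
  by exists (val e).1; rewrite nbhdE -h adjC adj_edge.
case/existsP=> e /and3P[eG /andP[h _] _].
by apply/existsP; exists e; rewrite eG.
Qed.

Lemma adj_Vset G i j : adj G i j -> i \in Vset G.
Proof. by rewrite VsetE -nbhdE => h; apply/set0Pn; exists j. Qed.

Lemma Kset_sub U U' : U \subset U' -> Kset U \subset Kset U'.
Proof.
move=> /subsetP h; apply/adj_subP => i j.
by rewrite !adj_Kset => /and3P[-> /h -> /h ->].
Qed.

Lemma nbhd_Kset U v : v \in U -> nbhd (Kset U) v = U :\ v.
Proof.
by move=> vU; apply/setP => u; rewrite nbhdE adj_Kset in_setD1 vU eq_sym.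
Qed.

Lemma del_Kset U v : del (Kset U) v = Kset (U :\ v).
Proof.
apply/eqP; rewrite eqEsubset; apply/andP; split; apply/adj_subP => i j;
  rewrite adj_del !adj_Kset !in_setD1.
  by case/and3P=> -> -> /and3P[-> -> ->].
by case/and3P=> -> /andP[-> ->] /andP[-> ->].
Qed.

Lemma Vset_sub G H v : G \subset H -> v \in Vset G -> v \in Vset H.
Proof.
move=> /adj_subP GH; rewrite VsetE => /set0Pn[z]; rewrite nbhdE => /GH.
exact: adj_Vset.
Qed.

Definition other v e : 'I_n := if (val e).1 == v then (val e).2 else (val e).1.

Lemma otherP v e : incident v e -> val e = (v, other v e) \/ val e = (other v e, v).
Proof.
rewrite /incident /other; case: (val e) => p q /=.
case: (eqVneq p v) => [->|pv] /=; first by left.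
by move/eqP->; right.
Qed.

Lemma card_star G v : #|[set e in G | incident v e]| = #|nbhd G v|.
Proof.
have -> : nbhd G v = other v @: [set e in G | incident v e].
  apply/setP => u; rewrite nbhdE; apply/adjP/imsetP => [[e eG h]|[e]].
    have ve : incident v e by rewrite /incident; case: h => -> /=; rewrite eqxx ?orbT.
    exists e; first by rewrite inE eG.
    have := edge_neq e; rewrite /other; case: h => -> /=; rewrite ?eqxx // => uv.
    by rewrite (negPf uv).
  by rewrite inE => /andP[eG ve] ->; exists e => //; apply: otherP.
rewrite card_in_imset // => e e'; rewrite !inE => /andP[_ h] /andP[_ h'] E.
by apply: (@edge_eqP e e' v (other v e)); [|rewrite E]; apply: otherP.
Qed.

Lemma card_del G v : #|G| = (#|del G v| + #|nbhd G v|)%N.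
Proof.
rewrite -card_star -(cardsID [set e | incident v e] G) addnC; congr (_ + _)%N.
  by apply: eq_card => e; rewrite !inE andbC.
by apply: eq_card => e; rewrite !inE.
Qed.

Lemma handshake G U : G \subset Kset U -> (\sum_(v in U) #|nbhd G v| = 2 * #|G|)%N.
Proof.
move=> GU.
transitivity (\sum_(v in U) \sum_(e in G) (incident v e : nat))%N.
  apply: eq_bigr => v _; rewrite -card_star -sum1_card big_mkcond [RHS]big_mkcond /=.
  by apply: eq_bigr => e _; rewrite inE; case: (e \in G); case: (incident v e).
rewrite exchange_big /= mulnC -sum_nat_const.
apply: eq_bigr => e eG.
have := subsetP GU _ eG; rewrite inE => /andP[h1 h2].
rewrite (bigD1 (val e).1) //= (bigD1 (val e).2) /=; last first.
  by rewrite h2 eq_sym edge_neq.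
rewrite big1 ?/incident ?eqxx ?orbT // => v /andP[/andP[_ v1] v2].
by rewrite ![_ == v]eq_sym (negPf v1) (negPf v2).
Qed.

End Edges.

(** * Row spaces of edge sets *)

Section Spans.
Local Open Scope ring_scope.
Variables (R : realFieldType) (n : nat).
Implicit Types (x y : 'I_n -> R) (G H X : {set edge n}) (U T : {set 'I_n}).
Implicit Types (i j u v a b c d : 'I_n).

Definition rowspan x y G : 'M[R]_(3 * n) := (\sum_(e in G) <<cofrow x y e>>)%MS.

Definition rows x y G : 'M[R]_(#|G|, 3 * n) := \matrix_(k < #|G|) cofrow x y (enum_val k).

Lemma rowsE x y G : (rows x y G :=: rowspan x y G)%MS.
Proof.
apply/eqmxP/andP; split.
  apply/row_subP => k; rewrite rowK; apply: (sumsmx_sup (enum_val k)); first exact: enum_valP.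
  by rewrite genmxE.
apply/sumsmx_subP => e eG; rewrite genmxE.
by rewrite -(enum_rankK_in eG eG) -(rowK (fun k => cofrow x y (enum_val k))) row_sub.
Qed.

Lemma crankE x y G : crank x y G = \rank (rowspan x y G).
Proof. by rewrite -(rowsE x y G). Qed.

Lemma S_edge x y G e : e \in G -> (cofrow x y e <= rowspan x y G)%MS.
Proof. by move=> eG; apply: (sumsmx_sup e) => //; rewrite genmxE. Qed.

Lemma erow_edge x y e i j : val e = (i, j) \/ val e = (j, i) ->
  (erow x y i j :=: cofrow x y e)%MS.
Proof.
case=> h; rewrite cofrowE h /=; first exact: eqmx_refl.
by rewrite erowC; apply: eqmx_opp.
Qed.

Lemma S_adj x y G i j : adj G i j -> (erow x y i j <= rowspan x y G)%MS.
Proof. by case/adjP=> e eG h; rewrite (erow_edge x y h) S_edge. Qed.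

Lemma S_subP x y G m (W : 'M[R]_(m, 3 * n)) :
  (forall i j, adj G i j -> (erow x y i j <= W)%MS) -> (rowspan x y G <= W)%MS.
Proof.
by move=> h; apply/sumsmx_subP => e eG; rewrite genmxE cofrowE; apply/h/adj_edge.
Qed.

Lemma S_sub x y G H : G \subset H -> (rowspan x y G <= rowspan x y H)%MS.
Proof. by move/adj_subP=> h; apply: S_subP => i j /h; apply: S_adj. Qed.

Lemma S_setU x y G H : (rowspan x y (G :|: H) :=: rowspan x y G + rowspan x y H)%MS.
Proof.
apply/eqmxP/andP; split.
  apply: S_subP => i j; rewrite adj_setU => /orP[]/(S_adj x y) h.
    exact: submx_trans (addsmxSl _ _).
  exact: submx_trans (addsmxSr _ _).
by rewrite addsmx_sub !S_sub ?subsetUl ?subsetUr.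
Qed.

Lemma erowN_sub x y i j m (W : 'M[R]_(m, 3 * n)) : (erow x y j i <= W)%MS = (erow x y i j <= W)%MS.
Proof. by rewrite erowC eqmx_opp. Qed.

Lemma S_del_star x y G v :
  (rowspan x y G :=: rowspan x y (del G v) + star x y v (nbhd G v))%MS.
Proof.
apply/eqmxP/andP; split.
  apply: S_subP => i j h.
  have [iv|iv] := eqVneq i v.
    by apply: submx_trans (addsmxSr _ _); rewrite iv sub_star // nbhdE -iv.
  have [jv|jv] := eqVneq j v.
    by apply: submx_trans (addsmxSr _ _); rewrite erowC eqmx_opp jv sub_star // nbhdE -jv adjC.
  by apply: submx_trans (addsmxSl _ _); apply: S_adj; rewrite adj_del iv jv.
rewrite addsmx_sub S_sub ?del_sub //=; apply/sumsmx_subP => u; rewrite nbhdE genmxE.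
exact: S_adj.
Qed.

Lemma S_blk0 x y G v : (forall u, adj G v u = false) -> rowspan x y G *m blk R v = 0.
Proof.
move=> h; apply/eqP; rewrite -submx0 /rowspan sumsmxMr_gen.
apply/sumsmx_subP => e eG; rewrite genmxE (eqmxMr _ (genmxE _)) cofrowE erow_blk ?edge_neq //.
have h1 : (v == (val e).1) = false.
  by apply/negP => /eqP E; have := adj_edge eG; rewrite -E h.
have h2 : (v == (val e).2) = false.
  by apply/negP => /eqP E; have := adj_edge eG; rewrite -E adjC h.
by rewrite h1 h2 sub0mx.
Qed.

Lemma S_del_blk x y G v : rowspan x y (del G v) *m blk R v = 0.
Proof. by apply: S_blk0 => u; rewrite adj_del eqxx. Qed.

Lemma S_upd x y G v p q : (forall u, adj G v u = false) ->
  (rowspan (upd x v p) (upd y v q) G = rowspan x y G)%MS.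
Proof.
move=> h; apply: eq_bigr => e eG; rewrite !cofrowE erow_upd //.
  by apply/negP => /eqP E; have := adj_edge eG; rewrite E h.
by apply/negP => /eqP E; have := adj_edge eG; rewrite E adjC h.
Qed.

Lemma S_rank_card x y G : (\rank (rowspan x y G) <= #|G|)%N.
Proof. by rewrite -(rowsE x y G) rank_leq_row. Qed.

Definition indep x y G := \rank (rowspan x y G) == #|G|.

Lemma cindepE x y G : cindep x y G = indep x y G.
Proof. by rewrite /cindep crankE. Qed.

Lemma S_set0 x y : rowspan x y set0 = 0.
Proof. by rewrite /rowspan big_set0. Qed.

Lemma indep0 x y : indep x y set0.
Proof. by rewrite /indep S_set0 mxrank0 cards0. Qed.

Lemma indep_sub x y G H : G \subset H -> indep x y H -> indep x y G.
Proof.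
move=> GH /eqP iH; rewrite /indep eqn_leq S_rank_card /=.
have E : H = G :|: (H :\: G).
  by apply/setP => e; rewrite !inE; case: (boolP (e \in G)) => [/(subsetP GH)->|_].
have := (mxrank_adds_leqif (rowspan x y G) (rowspan x y (H :\: G))).1.
rewrite -(S_setU x y G (H :\: G)) -E iH.
move=> h1; have := leq_trans h1 (leq_add (leqnn _) (S_rank_card x y (H :\: G))).
by rewrite -(cardsID G H) (setIidPr GH) leq_add2r.
Qed.

Lemma S_setU1 x y G e : (rowspan x y (e |: G) :=: rowspan x y G + cofrow x y e)%MS.
Proof.
apply/eqmxP/andP; split.
  rewrite (S_setU x y [set e] G) addsmx_sub addsmxSl andbT.
  by rewrite {1}/rowspan big_set1 genmxE addsmxSr.
by rewrite addsmx_sub S_sub ?subsetUr //= S_edge // setU11.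
Qed.

Lemma rank_setU1 x y G e : ~~ (cofrow x y e <= rowspan x y G)%MS ->
  \rank (rowspan x y (e |: G)) = (\rank (rowspan x y G)).+1.
Proof.
move=> h.
have E := S_setU1 x y G e.
rewrite E; apply/eqP; rewrite eqn_leq; apply/andP; split.
  apply: leq_trans (mxrank_adds_leqif _ _).1 _.
  by rewrite -[leqRHS]addn1 leq_add2l rank_leq_row.
rewrite ltn_neqAle mxrankS ?addsmxSl // andbT.
by apply: contra h; rewrite (mxrank_leqif_sup (addsmxSl _ _)) addsmx_sub => /andP[].
Qed.

Lemma indep_setU1 x y G e : indep x y G -> ~~ (cofrow x y e <= rowspan x y G)%MS ->
  indep x y (e |: G).
Proof.
move=> /eqP iG h; rewrite /indep rank_setU1 // iG cardsU1.
by have -> : e \notin G by apply: contra h; apply: S_edge.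
Qed.

Lemma base_extend x y (I G : {set edge n}) : I \subset G -> indep x y I ->
  exists B : {set edge n}, [/\ I \subset B, B \subset G, indep x y B & (rowspan x y G <= rowspan x y B)%MS].
Proof.
move=> IG iI.
have h0 : [&& I \subset I, I \subset G & indep x y I] by rewrite subxx IG.
case: (@arg_maxnP _ I (fun B : {set edge n} => [&& I \subset B, B \subset G & indep x y B])
  (fun B => #|B|) h0) => B /and3P[IB BG iB] Bmax.
exists B; split=> //; apply/sumsmx_subP => e eG; rewrite genmxE.
apply/contraT => ne.
have eB : e \notin B by apply: contra ne; apply: S_edge.
have := Bmax (e |: B); rewrite indep_setU1 // subUset sub1set eG BG.
by rewrite (subset_trans IB (subsetUr _ _)) => /(_ isT) /=; rewrite /geq /= cardsU1 eB add1n ltnn.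
Qed.

End Spans.

Section Arr.
Variable I : finType.
Implicit Types (T : {set I}) (s : seq I).

Lemma arr_extend T s : uniq s -> {subset s <= T} ->
  exists2 s', size s' = (#|T| - size s)%N & arr T (s ++ s').
Proof.
move=> us sT; exists (enum (T :\: [set:: s])).
  rewrite -cardE cardsD; congr (_ - _)%N.
  have -> : T :&: [set:: s] = [set:: s].
    by apply/setIidPr/subsetP => z; rewrite inE; apply: sT.
  by rewrite cardsE; apply/card_uniqP.
rewrite /arr cat_uniq us enum_uniq andbT /=; apply/andP; split.
  by apply/hasPn => z; rewrite mem_enum !inE => /andP[].
apply/eqP/setP => z; rewrite !inE mem_cat mem_enum !inE.
by case: (boolP (z \in s)) => [/sT ->|].
Qed.

Lemma arr_enum T : arr T (enum T).
Proof. by rewrite /arr enum_uniq; apply/eqP/setP => z; rewrite inE mem_enum. Qed.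

Lemma arr_mem T s z : arr T s -> (z \in T) = (z \in s).
Proof. by case/andP=> _ /eqP ->; rewrite inE. Qed.

Lemma arr_uniq T s : arr T s -> uniq s.
Proof. by case/andP. Qed.

Lemma arr_ext2 T a b : #|T| = 5 -> a != b -> a \in T -> b \in T ->
  exists c d e, arr T [:: a; b; c; d; e].
Proof.
move=> T5 ab aT bT.
have [|z|s' sz H] := @arr_extend T [:: a; b]; first by rewrite /= inE ab.
  by rewrite !inE => /orP[]/eqP->.
by move: sz H; rewrite T5; case: s' => [|c [|d [|e []]]] // _ H; exists c, d, e.
Qed.

Lemma arr_ext3 T a b c : #|T| = 5 -> uniq [:: a; b; c] -> a \in T -> b \in T -> c \in T ->
  exists d e, arr T [:: a; b; c; d; e].
Proof.
move=> T5 u aT bT cT.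
have [|z|s' sz H] := @arr_extend T [:: a; b; c]; first by [].
  by rewrite !inE => /or3P[]/eqP->.
by move: sz H; rewrite T5; case: s' => [|d [|e []]] // _ H; exists d, e.
Qed.

Lemma arr_ext4 T a b c d : #|T| = 5 -> uniq [:: a; b; c; d] ->
  a \in T -> b \in T -> c \in T -> d \in T -> exists e, arr T [:: a; b; c; d; e].
Proof.
move=> T5 u aT bT cT dT.
have [|z|s' sz H] := @arr_extend T [:: a; b; c; d]; first by [].
  by rewrite !inE => /or4P[]/eqP->.
by move: sz H; rewrite T5; case: s' => [|e []] // _ H; exists e.
Qed.

End Arr.

Section Quot.
Local Open Scope ring_scope.
Variables (F : fieldType) (m N : nat) (W : 'M[F]_(m, N)).
Implicit Types u v f : 'rV[F]_N.

Lemma sub_coker u : (u <= W)%MS = (u *m cokermx W == 0).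
Proof. by rewrite submxE. Qed.

Lemma sub_mod_scale u v : reflect (exists c, u *m cokermx W = c *: (v *m cokermx W)) (u <= W + v)%MS.
Proof.
apply: (iffP idP) => [/sub_addsmxP[[p q] /= ->]|[c E]].
  exists (q 0 0); rewrite mulmxDl -mulmxA mulmx_coker mulmx0 add0r (mx11_scalar q).
  by rewrite mul_scalar_mx -scalemxAl mxE eqxx mulr1n.
rewrite -[u](subrK (c *: v)); apply: addmx_sub_adds; last exact: scalemx_sub.
by rewrite sub_coker mulmxBl -scalemxAl E subrr.
Qed.

Lemma nwedge_cap u v f : ~~ wedge (u *m cokermx W) (v *m cokermx W) ->
  (f <= W + u)%MS -> (f <= W + v)%MS -> (f <= W)%MS.
Proof.
move=> nw /sub_mod_scale[c fu] /sub_mod_scale[d fv]; rewrite sub_coker fu.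
have [->|c0] := eqVneq c 0; first by rewrite scale0r.
case/negP: nw; rewrite wedgeC; apply: (wedge_unscale c0).
by rewrite -fu fv; apply: wedge_scale; rewrite wedge_self.
Qed.

End Quot.

(** * Cliques in a span, and the configurations at a vertex of degree 5 *)

Section Trichotomy.
Local Open Scope ring_scope.
Variables (R : realFieldType) (n : nat) (x y : 'I_n -> R).
Hypothesis Hgp : gp x y.
Implicit Types (G : {set edge n}) (T U : {set 'I_n}) (i j u v a b c d e : 'I_n).

Lemma gp5_of a b c d e : uniq [:: a; b; c; d; e] -> gp5 x y a b c d e.
Proof.
move=> U; usplit U.
by split; try (apply: br_neq0 => //; uq); split; try (apply: br_neq0 => //; uq);
  split; apply: br_neq0 => //; uq.
Qed.

Lemma sg_neq0 a b c d e : uniq [:: a; b; c; d; e] -> sg x y a b c d e != 0.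
Proof.
move=> U; usplit U.
by rewrite /sg invr_neq0 // !mulf_neq0 // br_neq0 //; uq.
Qed.

(** All ten coefficients of the K_5 relation are nonzero, so any nine rows yield the tenth. *)
Lemma K5_close m (W : 'M[R]_(m, 3 * n)) a b c d e : uniq [:: a; b; c; d; e] ->
  [/\ (erow x y a c <= W)%MS, (erow x y a d <= W)%MS & (erow x y a e <= W)%MS] ->
  [/\ (erow x y b c <= W)%MS, (erow x y b d <= W)%MS & (erow x y b e <= W)%MS] ->
  [/\ (erow x y c d <= W)%MS, (erow x y c e <= W)%MS & (erow x y d e <= W)%MS] ->
  (erow x y a b <= W)%MS.
Proof.
move=> U [h1 h2 h3] [h4 h5 h6] [h7 h8 h9].
rewrite -(eqmx_scale _ (sg_neq0 U)).
have := K5rel (gp5_of U); rewrite -!addrA => /eqP; rewrite addr_eq0 => /eqP ->.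
by rewrite eqmx_opp !addmx_sub // scalemx_sub.
Qed.

(** For a further [u] in [T], the row [vu] is the missing one of the K_5 on [v], [u], [a], [b],
    [c]. *)
Lemma clique_star m (W : 'M[R]_(m, 3 * n)) v T a b c :
  v \notin T -> uniq [:: a; b; c] -> a \in T -> b \in T -> c \in T ->
  (forall i j, i \in T -> j \in T -> i != j -> (erow x y i j <= W)%MS) ->
  (star x y v T <= W + col_mx (erow x y v a) (col_mx (erow x y v b) (erow x y v c)))%MS.
Proof.
move=> vT U aT bT cT h; set M := col_mx _ _.
have hM w : (w <= M)%MS -> (w <= W + M)%MS by move=> hw; apply: submx_trans (addsmxSr _ _).
have : (M <= M)%MS by []; rewrite {1}/M !col_mx_sub => /and3P[/hM ha /hM hb /hM hc].
have hW i j : i \in T -> j \in T -> i != j -> (erow x y i j <= W + M)%MS.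
  by move=> iT jT ij; apply: submx_trans (addsmxSl _ _); apply: h.
apply/sumsmx_subP => u uT; rewrite genmxE.
have [->//|ua] := eqVneq u a; have [->//|ub] := eqVneq u b; have [->//|uc] := eqVneq u c.
usplit U.
have [va vb vc vu] : [/\ v != a, v != b, v != c & v != u].
  by split; apply: contraNneq vT => ->.
apply: (@K5_close _ _ v u a b c) => //; first by uq.
  by split; apply: hW.
by split; apply: hW.
Qed.

Lemma rank_clique_star m (W : 'M[R]_(m, 3 * n)) v T : v \notin T ->
  (forall i j, i \in T -> j \in T -> i != j -> (erow x y i j <= W)%MS) ->
  (\rank (W + star x y v T)%MS <= \rank W + 3)%N.
Proof.
move=> vT h.
have gen q (M : 'M[R]_(q, 3 * n)) : (q <= 3)%N -> (star x y v T <= W + M)%MS ->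
    (\rank (W + star x y v T)%MS <= \rank W + 3)%N.
  move=> q3 hs; apply: (@leq_trans (\rank (W + M)%MS)).
    by apply: mxrankS; rewrite addsmx_sub addsmxSl hs.
  apply: leq_trans (mxrank_adds_leqif _ _).1 _; rewrite leq_add2l.
  exact: leq_trans (rank_leq_row _) q3.
have sz : size (enum T) = #|T| by rewrite cardE.
have := mem_enum T; have := enum_uniq T; case E : (enum T) => [|a [|b [|c s]]] U memT.
- apply: (gen _ (0 : 'M_(0, _))) => //; apply/sumsmx_subP => u.
  by rewrite -memT.
- apply: (gen _ (erow x y v a)) => //; apply/sumsmx_subP => u.
  by rewrite -memT inE => /eqP ->; rewrite genmxE addsmxSr.
- apply: (gen _ (col_mx (erow x y v a) (erow x y v b))) => //; apply/sumsmx_subP => u.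
  have : (col_mx (erow x y v a) (erow x y v b) <= W + col_mx (erow x y v a) (erow x y v b))%MS.
    exact: addsmxSr.
  by rewrite col_mx_sub => /andP[ha hb]; rewrite -memT !inE => /orP[]/eqP ->; rewrite genmxE.
- apply: (gen _ (col_mx (erow x y v a) (col_mx (erow x y v b) (erow x y v c)))) => //.
  apply: clique_star => //; rewrite -?memT ?inE ?eqxx ?orbT //.
  by move: U; rewrite /= !inE !negb_or -!andbA => /and5P[-> -> _ -> _].
Qed.

(** A triangle has three edges, and every further vertex of a clique adds at most 3 to the rank. *)
Lemma rank_Kset U : (3 <= #|U|)%N -> (\rank (rowspan x y (Kset U)) + 6 <= 3 * #|U|)%N.
Proof.
move: {2}#|U| (erefl #|U|) => k; elim: k U => [|k IH] U Uk; first by rewrite Uk.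
rewrite Uk => k3.
have [k2|k2] := leqP k 2.
  have cU : #|Kset U| = 3.
    have := handshake (subxx (Kset U)).
    rewrite (eq_bigr (fun _ => 2%N)); last first.
      move=> v vU; rewrite nbhd_Kset //; have := cardsD1 v U; rewrite vU Uk /= => E.
      by move: E k2 k3; rewrite add1n; move: #|_| => q; lia.
    by rewrite sum_nat_const Uk; lia.
  by have := S_rank_card x y (Kset U); rewrite cU; move: (\rank _) => r; lia.
have /set0Pn[v vU] : U != set0 by rewrite -card_gt0 Uk.
have cUv : #|U :\ v| = k by have := cardsD1 v U; rewrite vU Uk; lia.
have := IH (U :\ v) cUv; rewrite cUv => /(_ k2) h.
have h2 : (\rank (rowspan x y (Kset U)) <= \rank (rowspan x y (Kset (U :\ v))) + 3)%N.
  rewrite (S_del_star x y _ v) del_Kset nbhd_Kset //; apply: rank_clique_star.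
    by rewrite !inE eqxx.
  by move=> i j iU jU ij; apply: S_adj; rewrite adj_Kset ij iU jU.
by move: h h2; move: (\rank _) (\rank _) => r1 r2; lia.
Qed.

(* Proportional to the difference of the [sg]-weighted rows of [ab] and [cd],
   cleared of denominators. *)
Definition delta (x y : 'I_n -> R) a b c d e : 'rV[R]_(3 * n) :=
  (br x y c d a * br x y c d b * br x y c d e) *: erow x y a b
  - (br x y a b c * br x y a b d * br x y a b e) *: erow x y c d.

Lemma deltaE a b c d e : uniq [:: a; b; c; d; e] ->
  delta x y a b c d e = (sg x y a b c d e * sg x y c d a b e)^-1 *:
    (sg x y a b c d e *: erow x y a b - sg x y c d a b e *: erow x y c d).
Proof.
move=> U; usplit U; rewrite /delta /sg [RHS]scalerBr !scalerA.
have h1 : br x y a b c != 0 by apply: br_neq0 => //; uq.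
have h2 : br x y a b d != 0 by apply: br_neq0 => //; uq.
have h3 : br x y a b e != 0 by apply: br_neq0 => //; uq.
have h4 : br x y c d a != 0 by apply: br_neq0 => //; uq.
have h5 : br x y c d b != 0 by apply: br_neq0 => //; uq.
have h6 : br x y c d e != 0 by apply: br_neq0 => //; uq.
by congr (_ *: _ - _ *: _); field; rewrite ?h1 ?h2 ?h3 ?h4 ?h5 ?h6.
Qed.

Section Five.
Variables (m : nat) (W : 'M[R]_(m, 3 * n)) (v : 'I_n) (T : {set 'I_n}).
Hypothesis W0 : W *m blk R v = 0.
Hypothesis T5 : #|T| = 5%N.
Hypothesis vT : v \notin T.
Hypothesis HT :
  forall p q, (\rank (W + star (upd x v p) (upd y v q) v T)%MS <= \rank W + 4)%N.

(** The form that [classify] requires: a product over the remaining three vertices replaces the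
    labels of [sg], and its sign change under exchange of the ends cancels that of the row. *)
Let mu i j : 'rV[R]_(3 * n) :=
  if [&& i != j, i \in T & j \in T] then
    ((\prod_(k in T :\ i :\ j) br x y i j k)^-1 *: erow x y i j) *m cokermx W
  else 0.

Lemma muE a b c d e : arr T [:: a; b; c; d; e] ->
  mu a b = (sg x y a b c d e *: erow x y a b) *m cokermx W.
Proof.
move=> H; have U := arr_uniq H; usplit U.
rewrite /mu uq_ !(arr_mem _ H) !inE !eqxx ?orbT /=.
congr ((_^-1 *: _) *m _).
have -> : T :\ a :\ b = c |: (d |: [set e]).
  apply/setP => z; rewrite !inE (arr_mem z H) !inE.
  have [->|zb] := eqVneq z b; first by rewrite (negPf uq_3) (negPf uq_4) (negPf uq_5).
  have [->|za] := eqVneq z a; first by rewrite (negPf uq_0) (negPf uq_1) (negPf uq_2).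
  by [].
rewrite big_setU1 /=; last by rewrite !inE negb_or uq_6 uq_7.
by rewrite big_setU1 /= ?inE // big_set1 mulrA.
Qed.

Lemma muC i j : mu i j = mu j i.
Proof.
rewrite /mu [in RHS]eq_sym [(j \in T) && _]andbC.
case: ifP => // /and3P[ij iT jT].
have [c [d [e H]]] := arr_ext2 T5 ij iT jT.
have H' : arr T [:: j; i; c; d; e] by arrtac H.
have := muE H; rewrite /mu ij iT jT /= => ->.
have := muE H'; rewrite /mu eq_sym ij iT jT /= => ->.
by rewrite sgC erowC scalerN scaleNr opprK.
Qed.

Lemma mu0 i j : i \in T -> j \in T -> i != j -> (mu i j == 0) = (erow x y i j <= W)%MS.
Proof.
move=> iT jT ij.
have [c [d [e H]]] := arr_ext2 T5 ij iT jT.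
by rewrite (muE H) -sub_coker eqmx_scale // sg_neq0 // (arr_uniq H).
Qed.

Lemma mu_conds a b c d e : arr T [:: a; b; c; d; e] ->
  wedge (mu a b) (mu c d) /\ wedge (mu a b) (mu a c + mu a d + mu a e).
Proof.
move=> H.
have U : uniq [:: v; a; b; c; d; e].
  by rewrite cons_uniq (arr_uniq H) andbT -(arr_mem _ H).
have [aT bT cT dT eT] : [/\ a \in T, b \in T, c \in T, d \in T & e \in T].
  by split; rewrite (arr_mem _ H) !inE eqxx ?orbT.
have [h1 h2 h3 h4] := star5_wedge Hgp W0 HT U aT bT cT dT eT.
have H1 : arr T [:: c; d; a; b; e] by arrtac H.
have H2 : arr T [:: a; c; b; d; e] by arrtac H.
have H3 : arr T [:: a; d; b; c; e] by arrtac H.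
have H4 : arr T [:: a; e; b; c; d] by arrtac H.
by rewrite (muE H) (muE H1) (muE H2) (muE H3) (muE H4).
Qed.

Lemma mu_delta a b c d e : arr T [:: a; b; c; d; e] -> mu a b = mu c d ->
  (delta x y a b c d e <= W)%MS.
Proof.
move=> H; have H1 : arr T [:: c; d; a; b; e] by arrtac H.
rewrite (muE H) (muE H1) => E; rewrite deltaE ?(arr_uniq H) //.
by apply: scalemx_sub; rewrite sub_coker mulmxBl E subrr.
Qed.

(** The cases of [classify] for [mu]. In the pencil case equal values on opposite edges become
    membership of [delta], and the independence of [ab] and [ac] modulo [W] becomes the closing
    intersection property. *)
Lemma star5_trichotomy :
  (exists f : 'rV[R]_(3 * n), forall i j, i \in T -> j \in T -> i != j ->
     (erow x y i j <= W + f)%MS) \/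
  ((exists a b c d e, arr T [:: a; b; c; d; e] /\
     forall i j, i \in [:: b; c; d; e] -> j \in [:: b; c; d; e] -> i != j ->
       (erow x y i j <= W)%MS) \/
   (exists a b c d e, arr T [:: a; b; c; d; e] /\
     [/\ (erow x y e a <= W)%MS, (erow x y e b <= W)%MS,
        (erow x y e c <= W)%MS, (erow x y e d <= W)%MS &
     [/\ (delta x y a b c d e <= W)%MS, (delta x y a c b d e <= W)%MS,
       ~~ (erow x y a b <= W)%MS, ~~ (erow x y a c <= W)%MS &
       forall f : 'rV[R]_(3 * n), (f <= W + erow x y a b)%MS ->
         (f <= W + erow x y a c)%MS -> (f <= W)%MS]])).
Proof.
have [h|[[a [b [c [d [e [H h]]]]]]|[a [b [c [d [e [H [h1 h2]]]]]]]]] :=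
  classify (T := T) muC (fun a b c d e H => (mu_conds H).1) (fun a b c d e H => (mu_conds H).2).
- left.
  have [[i0 j0] /= /and4P[ij0 iT0 jT0 n0]|all0] :=
    pickP (fun p : 'I_n * 'I_n => [&& p.1 != p.2, p.1 \in T, p.2 \in T & mu p.1 p.2 != 0]); last first.
    exists 0 => i j iT jT ij; apply: submx_trans (addsmxSl _ _).
    by rewrite -mu0 //; have := all0 (i, j); rewrite /= ij iT jT => /negbFE.
  exists (erow x y i0 j0) => i j iT jT ij.
  suff w : wedge (mu i0 j0) (mu i j).
    have [c E] := wedge_multiple n0 w.
    have [c1 [d1 [e1 H1]]] := arr_ext2 T5 ij iT jT.
    have [c2 [d2 [e2 H2]]] := arr_ext2 T5 ij0 iT0 jT0.
    apply/sub_mod_scale.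
    move: E; rewrite (muE H1) (muE H2) -!scalemxAl scalerA => E.
    exists ((sg x y i j c1 d1 e1)^-1 * (c * sg x y i0 j0 c2 d2 e2)).
    by rewrite -scalerA -E scalerA mulVf ?scale1r // sg_neq0 // (arr_uniq H1).
  have share p q r : p \in T -> q \in T -> r \in T -> p != q -> p != r -> wedge (mu p q) (mu p r).
    move=> pT qT rT pq pr; have [->|qr] := eqVneq q r; first exact: wedge_self.
    have [|d1 [e1 H1]] := arr_ext3 T5 _ pT qT rT; last exact: h H1.
    by rewrite /= !inE negb_or pq pr qr.
  have ji : j != i by rewrite eq_sym.
  have ji00 : j0 != i0 by rewrite eq_sym.
  have [E|ii0] := eqVneq i i0.
    by rewrite -E; apply: share; rewrite // E.
  have [E|ij1] := eqVneq i j0.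
    by rewrite (muC i0) -E; apply: share; rewrite // E.
  have [E|ji0] := eqVneq j i0.
    by rewrite (muC i) -E; apply: share; rewrite // E.
  have [E|jj0] := eqVneq j j0.
    by rewrite (muC i) (muC i0) -E; apply: share; rewrite // E.
  have [|e1 H1] := arr_ext4 T5 _ iT0 jT0 iT jT; last by have [] := mu_conds H1.
  by rewrite /= !inE !negb_or ij0 ij ![i0 == _]eq_sym ii0 ji0 ![j0 == _]eq_sym ij1 jj0.
- right; left; exists a, b, c, d, e; split=> // i j iI jI ij.
  have sT z : z \in [:: b; c; d; e] -> z \in T.
    by move=> zb; rewrite (arr_mem _ H) in_cons zb orbT.
  rewrite -mu0 ?sT //.
  have [k1 k2 k3 [k4 k5 k6]] := h.
  move: iI jI ij; rewrite !inE.
  by move=> /or4P[]/eqP-> /or4P[]/eqP->; rewrite ?eqxx // => _; apply/eqP => //; rewrite muC.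
- right; right; exists a, b, c, d, e; split=> //.
  case: h1 h2 => k1 k2 k3 k4 [k5 k6 k7 k8].
  have U := arr_uniq H; usplit U.
  have [aT bT cT dT eT] : [/\ a \in T, b \in T, c \in T, d \in T & e \in T].
    by split; rewrite (arr_mem _ H) !inE eqxx ?orbT.
  have H1 : arr T [:: a; c; b; d; e] by arrtac H.
  have sw p q : p \in T -> q \in T -> p != q -> mu p q = 0 -> (erow x y p q <= W)%MS.
    by move=> pT qT pq E; rewrite -mu0 // E.
  have [ea eb ec ed] : [/\ e != a, e != b, e != c & e != d] by split; uq.
  split; [exact: sw|exact: sw|exact: sw|exact: sw|].
  split; [exact: mu_delta|exact: mu_delta| | |].
  - by rewrite -mu0 //; apply: contra k8 => /eqP ->; rewrite wedgeC wedge0.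
  - by rewrite -mu0 //; apply: contra k8 => /eqP ->; rewrite wedge0.
  - move=> f; apply: nwedge_cap; apply: contra k8.
    rewrite (muE H) (muE H1) -!scalemxAl => w.
    by apply: wedge_scale; rewrite wedgeC; apply: wedge_scale; rewrite wedgeC.
Qed.

End Five.
End Trichotomy.

Lemma set_extend_card (I : finType) (N Z : {set I}) k : N \subset Z ->
  (#|N| <= k <= #|Z|)%N -> exists N' : {set I}, [/\ N \subset N', N' \subset Z & #|N'| = k].
Proof.
move=> NZ /andP[Nk kZ].
pose s := enum N ++ enum (Z :\: N).
have us : uniq s.
  rewrite cat_uniq !enum_uniq andbT /=; apply/hasPn => z; rewrite !mem_enum inE.
  by case/andP.
have sZ : size s = #|Z|.
  by rewrite size_cat -!cardE -(cardsID N Z) (setIidPr NZ).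
exists [set:: take k s]; split.
- apply/subsetP => z zN; rewrite inE take_cat -cardE.
  case: ltnP => h; last by rewrite mem_cat mem_enum zN.
  by move: h; rewrite ltnNge Nk.
- apply/subsetP => z; rewrite inE => /mem_take; rewrite mem_cat !mem_enum inE.
  by case/orP=> [/(subsetP NZ)//|/andP[]].
- rewrite cardsE; have /card_uniqP -> : uniq (take k s) by apply: take_uniq.
  by rewrite size_takel // sZ.
Qed.

Lemma cardsD1_in (I : finType) (T : {set I}) z k : z \in T -> #|T| = k.+1 -> #|T :\ z| = k.
Proof. by move=> zT; rewrite (cardsD1 z) zT => -[]. Qed.

Lemma subset_of_card (I : finType) (Z : {set I}) k : k <= #|Z| ->
  exists2 T : {set I}, T \subset Z & #|T| = k.
Proof.
by move=> kZ; have [|T [_ TZ Tk]] := @set_extend_card _ set0 Z k (sub0set _); [rewrite cards0|exists T].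
Qed.

Lemma three_of_card (I : finType) (Z : {set I}) : 3 <= #|Z| ->
  exists a b c, [/\ uniq [:: a; b; c], a \in Z, b \in Z & c \in Z].
Proof.
case/subset_of_card=> T /subsetP TZ; rewrite cardE; have H := arr_enum T.
case: (enum T) H => [|a [|b [|c []]]] // H _; exists a, b, c; split; first exact: arr_uniq H.
all: by apply: TZ; rewrite (arr_mem _ H) !inE eqxx ?orbT.
Qed.

Section Exchange.
Local Open Scope ring_scope.
Variables (F : fieldType) (m N : nat) (W : 'M[F]_(m, N)).

Lemma exchange_sub (u v : 'rV[F]_N) :
  (u <= W + v)%MS -> ~~ (u <= W)%MS -> (v <= W + u)%MS.
Proof.
case/sub_mod_scale => c E; rewrite sub_coker E => h.
have c0 : c != 0 by apply: contraNneq h => ->; rewrite scale0r.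
by apply/sub_mod_scale; exists c^-1; rewrite E scalerA mulVf ?scale1r.
Qed.

Lemma rank_adds_row (u : 'rV[F]_N) : (\rank (W + u)%MS <= \rank W + 1)%N.
Proof.
apply: leq_trans (mxrank_adds_leqif _ _).1 _; rewrite leq_add2l.
exact: rank_leq_row.
Qed.

Lemma rank_adds_row_notin (u : 'rV[F]_N) : ~~ (u <= W)%MS -> \rank (W + u)%MS = (\rank W + 1)%N.
Proof.
move=> h; apply/eqP; rewrite eqn_leq rank_adds_row addn1 /=.
rewrite ltn_neqAle mxrankS ?addsmxSl // andbT.
by apply: contra h; rewrite (mxrank_leqif_sup (addsmxSl _ _)) addsmx_sub => /andP[].
Qed.

End Exchange.

(** * Rank comparison with an additional row, and the vectors [delta] *)

Section Pencil.
Local Open Scope ring_scope.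
Variables (R : realFieldType) (n : nat) (x y : 'I_n -> R).
Hypothesis hgen : generic x y.
Implicit Types (G B : {set edge n}) (T U N : {set 'I_n}) (i j u v w a b c d e : 'I_n).

Let Hgp := generic_gp hgen.

(** The extra row [dl] makes the comparison available for [delta], which may lie in a span without
    being the row of an edge. *)
Lemma generic_S (dl : ('I_n -> R) -> ('I_n -> R) -> 'rV[R]_(3 * n)) G x' y' :
  (forall k, ratpoly (fun x y => dl x y 0 k)) ->
  (\rank (rowspan x' y' G + dl x' y')%MS <= \rank (rowspan x y G + dl x y)%MS)%N.
Proof.
move=> hd.
have E z t : \rank (rowspan z t G + dl z t)%MS = \rank (col_mx (rows z t G) (dl z t)).
  by rewrite -addsmxE (adds_eqmx (rowsE z t G) (eqmx_refl (dl z t))).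
rewrite !E; apply: (generic_rank hgen (M := fun z t => col_mx (rows z t G) (dl z t))).
move=> i j; rewrite -[i]splitK; case: (split i) => k /=.
  have hk := ratpoly_erow R (val (enum_val k)).1 (val (enum_val k)).2 j.
  by apply: (ratpoly_ext _ hk) => z t; rewrite col_mxEu [RHS]mxE cofrowE.
have hk := hd j.
by apply: (ratpoly_ext _ hk) => z t; rewrite col_mxEd (ord1 k).
Qed.

(** Moving [v] changes only its star, provided [dl] does not involve [v]. This supplies the rank
    hypotheses of [star4_rows] and [star5_wedge]. *)
Lemma generic_star (dl : ('I_n -> R) -> ('I_n -> R) -> 'rV[R]_(3 * n)) G v p q :
  (forall k, ratpoly (fun x y => dl x y 0 k)) ->
  dl (upd x v p) (upd y v q) = dl x y ->
  (\rank ((rowspan x y (del G v) + dl x y) + star (upd x v p) (upd y v q) v (nbhd G v))%MS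
     <= \rank (rowspan x y G + dl x y)%MS)%N.
Proof.
move=> hd dE; apply: leq_trans (generic_S G (upd x v p) (upd y v q) hd).
apply: mxrankS; rewrite dE !addsmx_sub addsmxSr andbT.
have := S_del_star (upd x v p) (upd y v q) G v.
rewrite (@S_upd _ _ x y (del G v)) => [E|u]; last by rewrite adj_del eqxx.
by apply/andP; split; apply: submx_trans (addsmxSl _ _); rewrite E ?addsmxSl ?addsmxSr.
Qed.

(** The reason for clearing denominators in [delta]: it depends polynomially on the position. *)
Lemma ratpoly_delta a b c d e k : ratpoly (fun x y : 'I_n -> R => delta x y a b c d e 0 k).
Proof.
apply: (@ratpoly_ext _ _ (fun x y => br x y c d a * br x y c d b * br x y c d e * erow x y a b 0 k
   - br x y a b c * br x y a b d * br x y a b e * erow x y c d 0 k)).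
  have E (s t : R) (u v : 'rV[R]_(3 * n)) : s * u 0 k - t * v 0 k = (s *: u - t *: v) 0 k.
    by rewrite !mxE.
  by move=> z t; rewrite E.
by apply: ratpolyB; apply: ratpolyM; (try exact: ratpoly_erow);
  apply: ratpolyM; (try exact: ratpoly_br); apply: ratpolyM; exact: ratpoly_br.
Qed.

Lemma delta_upd v p q a b c d e : v \notin [:: a; b; c; d; e] ->
  delta (upd x v p) (upd y v q) a b c d e = delta x y a b c d e.
Proof.
rewrite !inE !negb_or => /and5P[va vb vc vd ve].
by rewrite /delta !br_upd 1?eq_sym // !erow_upd // 1?eq_sym.
Qed.

Lemma delta_blk v a b c d e : v \notin [:: a; b; c; d; e] -> a != b -> c != d ->
  delta x y a b c d e *m blk R v = 0.
Proof.
rewrite !inE !negb_or => /and5P[va vb vc vd ve] ab cd.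
by rewrite /delta mulmxBl -!scalemxAl !erow_blk // (negPf va) (negPf vb) (negPf vc) (negPf vd)
  !scaler0 subr0.
Qed.

Lemma generic_delta B w p q a b c d e : w \notin [:: a; b; c; d; e] ->
  (\rank ((rowspan x y (del B w) + delta x y a b c d e)
     + star (upd x w p) (upd y w q) w (nbhd B w))%MS
     <= \rank (rowspan x y B + delta x y a b c d e)%MS)%N.
Proof.
move=> wT; apply: (generic_star (dl := fun x y => delta x y a b c d e)).
  exact: ratpoly_delta.
exact: delta_upd.
Qed.

Lemma addsmx_delta m (W : 'M[R]_(m, 3 * n)) a b c d e :
  (erow x y a b <= W)%MS -> (erow x y c d <= W)%MS -> (delta x y a b c d e <= W)%MS.
Proof. by move=> h1 h2; rewrite /delta addmx_sub ?eqmx_opp ?scalemx_sub. Qed.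

Lemma S_add2 G i j : i != j -> (rowspan x y (G :|: Kset [set i; j]) :=: rowspan x y G + erow x y i j)%MS.
Proof.
move=> ij; apply/eqmxP/andP; split.
  apply: S_subP => u v; rewrite adj_setU adj_Kset => /orP[h|].
    by apply: submx_trans (addsmxSl _ _); apply: S_adj.
  rewrite !inE => /and3P[uv /orP[]/eqP hu /orP[]/eqP hv]; subst; rewrite ?eqxx // in uv.
    exact: addsmxSr.
  by rewrite erowC eqmx_opp addsmxSr.
rewrite addsmx_sub S_sub ?subsetUl //=; apply: S_adj.
by rewrite adj_setU adj_Kset ij !inE !eqxx !orbT.
Qed.

Lemma Kset2 i j : i != j -> exists2 f : edge n, Kset [set i; j] = [set f] & val f = (i, j) \/ val f = (j, i).
Proof.
move=> ij; have [f hf] := edge_of ij; exists f => //.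
apply/setP => g; rewrite -!adj_edgeE adj_Kset edge_neq /= !inE.
apply/idP/idP => [/andP[/orP[]/eqP h1 /orP[]/eqP h2]|].
- by have := edge_neq g; rewrite h1 h2 eqxx.
- by apply/adjP; exists f; rewrite ?inE // h1 h2.
- by apply/adjP; exists f; rewrite ?inE // h1 h2; case: hf; [right|left].
- by have := edge_neq g; rewrite h1 h2 eqxx.
by rewrite adj_edgeE inE => /eqP ->; case: hf => -> /=; rewrite !eqxx ?orbT.
Qed.

Lemma coord_neq i j : i != j -> x i != x j.
Proof.
move=> ij; rewrite -subr_eq0.
apply: (generic_neq0 hgen (x' := fun z => (z == i)%:R) (y' := fun _ => 0)
  (ratpolyB (ratpoly_x R i) (ratpoly_x R j))).
by rewrite eqxx [j == i]eq_sym (negPf ij) subr0 oner_eq0.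
Qed.

Lemma erow_notin_S G v u : v != u -> (forall w, adj G v w = false) ->
  ~~ (erow x y v u <= rowspan x y G)%MS.
Proof.
move=> vu h; apply/negP => /(submxMr (blk R v)).
rewrite (S_blk0 x y h) => /submx0null; rewrite erow_blk // eqxx => E.
have := congr1 (fun M : 'rV[R]_3 => M 0 0) E; rewrite !mxE /= => /eqP.
by rewrite sqrf_eq0 subr_eq0 (negPf (coord_neq vu)).
Qed.

Lemma indep_pendant G v u : v != u -> (forall w, adj G v w = false) -> indep x y G ->
  indep x y (G :|: Kset [set v; u]).
Proof.
move=> vu h iG; have [f -> hf] := Kset2 vu; rewrite setUC.
apply: indep_setU1 => //; rewrite -(erow_edge x y hf); exact: erow_notin_S.
Qed.

(* If [p] had at most two neighbours, the direction from [p] to the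
   non-neighbour [q] would be independent of those to the neighbours. *)
Lemma deg_ge3 B p q h w (f : 'rV[R]_(3 * n)) (c : R) : adj B p h -> ~~ adj B p q -> uniq [:: p; q; h; w] ->
  c != 0 -> f *m blk R p = 0 -> ((c *: erow x y p q + f)%R <= rowspan x y B)%MS ->
  (3 <= #|nbhd B p|)%N.
Proof.
move=> ph pq U c0 f0 hs; rewrite ltnNge; apply/negP => le2.
usplit U.
(* [u] is the second neighbour of [p] if there is one, and the spare vertex [w] otherwise; three
   directions at [p] are compared in either case. *)
have [u [up uqq uh sub]] : exists u, [/\ u != p, u != q, u != h & nbhd B p \subset [set h; u]].
  have hN : h \in nbhd B p by rewrite nbhdE.
  have c1 : (#|nbhd B p :\ h| <= 1)%N by move: le2; rewrite (cardsD1 h) hN.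
  have [E|/set0Pn[u]] := eqVneq (nbhd B p :\ h) set0.
    exists w; split; try by rewrite eq_sym.
    by rewrite -(setD1K hN) E setU0 sub1set !inE eqxx.
  rewrite in_setD1 => /andP[uh uN].
  exists u; split=> //.
  - by move: uN; rewrite nbhdE => /adj_neq; rewrite eq_sym.
  - by apply: contraNneq pq => <-; rewrite -nbhdE.
  - apply/subsetP => z zN; rewrite !inE; have [//|zh /=] := eqVneq z h.
    by apply/eqP; apply: (card_le1_eqP c1); rewrite in_setD1 ?zh ?uh.
have : (rowspan x y B <= rowspan x y (del B p) + col_mx (erow x y p h) (erow x y p u))%MS.
  rewrite (S_del_star x y B p) addsmx_sub addsmxSl /=.
  apply: submx_trans (addsmxSr _ _); apply/sumsmx_subP => z /(subsetP sub).
  have : (col_mx (erow x y p h) (erow x y p u) <= col_mx (erow x y p h) (erow x y p u))%MS by [].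
  by rewrite {1}col_mx_sub => /andP[h1 h2]; rewrite !inE genmxE => /orP[]/eqP ->.
move=> /(submx_trans hs) /sub_addsmxP[[r s] /= E].
have := congr1 (fun M => M *m blk R p) E.
rewrite /= mulmxDl f0 addr0 [in RHS]mulmxDl -mulmxA S_del_blk mulmx0 add0r -scalemxAl.
rewrite -[s](@hsubmxK _ 1 1 1) mul_row_col [in RHS]mulmxDl -!mulmxA !erow_blk // 1?eq_sym // eqxx.
set s1 := lsubmx s; set s2 := rsubmx s.
rewrite (mx11_scalar s1) (mx11_scalar s2) !mul_scalar_mx => /eqP.
rewrite -subr_eq0 opprD addrA -!scaleNr => /eqP.
have n1 : br x y p q h != 0 by apply: br_neq0 => //; uq.
have n2 : br x y p q u != 0 by apply: br_neq0 => //; uq.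
have n3 : br x y p h u != 0 by apply: br_neq0 => //; uq.
by case/dv_free; rewrite ?br_cross // => c00; rewrite c00 eqxx in c0.
Qed.

Lemma affine_root (al be t : R) : al * (1 - t) + be * t = 0 -> (al != 0) || (be != 0) ->
  t = al / (al - be).
Proof.
move=> E; have [ab|ne] := eqVneq al be; last first.
  move=> _; have nz : al - be != 0 by rewrite subr_eq0.
  apply: (mulIf nz); rewrite divfK //; apply/eqP; rewrite -subr_eq0.
  by rewrite -[X in _ == X]oppr0 -E; apply/eqP; ring.
rewrite ab in E *; have -> : be = 0 by rewrite -[RHS]E; ring.
by rewrite eqxx.
Qed.

Lemma br_pair_neq0 u w c d : u != w -> c != d -> ~~ ((c \in [set u; w]) && (d \in [set u; w])) ->
  (br x y u w c != 0) || (br x y u w d != 0).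
Proof.
move=> uw cd; rewrite negb_and !inE !negb_or => /orP[]/andP[h1 h2].
  by rewrite br_neq0 //; uq.
by rewrite [X in _ || X]br_neq0 ?orbT //; uq.
Qed.

(* Move [a] onto the line through [c] and [d], where the coefficient of
   [erow a b] in [delta] vanishes. *)
Lemma degree3_nbrs B a b c d e : uniq [:: a; b; c; d; e] -> indep x y B ->
  adj B a e -> ~~ adj B a b -> #|nbhd B a| = 3%N ->
  (delta x y a b c d e <= rowspan x y B)%MS -> ~~ (erow x y c d <= rowspan x y B)%MS ->
  adj B a c && adj B a d.
Proof.
move=> U iB ae ab d3 hd; apply: contraNT => ncd; usplit U.
have aN : a \notin nbhd B a by rewrite nbhdE adj_irr.
have eN : e \in nbhd B a by rewrite nbhdE.
have c2 : #|nbhd B a :\ e| = 2 by have := cardsD1 e (nbhd B a); rewrite eN d3; case.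
have [u1 [u2 u12 NE]] : exists u1, exists2 u2, u1 != u2 & nbhd B a :\ e = [set u1; u2].
  by have /cards2P[u1 [u2 [u12 E]]] : #|nbhd B a :\ e| == 2; [rewrite c2|exists u1, u2].
have : (u1 \in nbhd B a :\ e) && (u2 \in nbhd B a :\ e) by rewrite NE !inE !eqxx orbT.
rewrite !in_setD1 => /andP[/andP[u1e u1N] /andP[u2e u2N]].
have u1a : u1 != a by apply: contraNneq aN => E; rewrite -[X in X \in _]E.
have u2a : u2 != a by apply: contraNneq aN => E; rewrite -[X in X \in _]E.
have nset (u w : 'I_n) : [set u; w] \subset nbhd B a -> ~~ ((c \in [set u; w]) && (d \in [set u; w])).
  move=> /subsetP sub; apply: contra ncd => /andP[/sub h1 /sub h2].
  by rewrite -!nbhdE h1 h2.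
have nb (w : 'I_n) : ~~ ((c \in [set b; w]) && (d \in [set b; w])).
  rewrite !inE ![_ == b]eq_sym (negPf uq_3) (negPf uq_4) /=.
  by apply/negP => /andP[/eqP E1 /eqP E2]; move: uq_6; rewrite E1 E2 eqxx.
(* The parameter at which the moved [a] becomes collinear with [u] and [w]. Avoiding the listed
   values keeps the three edges at [a] independent and the coefficient of the row [cd] in [delta]
   nonzero. *)
pose f u w := br x y u w c / (br x y u w c - br x y u w d).
have [t] := exists_notin [:: f e u1; f e u2; f u1 u2; f b c; f b d; f b e].
rewrite !inE !negb_or -?andbA => /and5P[t1 t2 t3 t4 /andP[t5 t6]].
pose x' := upd x a (x c + t * (x d - x c)); pose y' := upd y a (y c + t * (y d - y c)).
have nz u w : u != w -> u != a -> w != a -> ~~ ((c \in [set u; w]) && (d \in [set u; w])) ->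
    t != f u w -> br x' y' a u w != 0.
  move=> uw ua wa nin; rewrite /x' /y' br_line_cd //; apply: contra => /eqP E; apply/eqP.
  by apply: affine_root E _; apply: br_pair_neq0.
have sub2 (u w : 'I_n) : u \in nbhd B a -> w \in nbhd B a -> [set u; w] \subset nbhd B a.
  by move=> h1 h2; apply/subsetP => z; rewrite !in_set2 => /orP[]/eqP ->.
have ea : e != a by rewrite eq_sym.
have fr : row_free (col_mx (erow x' y' a e) (col_mx (erow x' y' a u1) (erow x' y' a u2)) *m blk R a).
  apply: star3_free => //; apply: nz => //; rewrite 1?eq_sym //; by apply: nset; apply: sub2.
have [rk sb] := add_free_star (S_del_blk x y B a) fr.
set M := col_mx _ _ in fr rk sb.
have hM : (rowspan x y (del B a) + M <= rowspan x' y' B)%MS.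
  rewrite (S_del_star x' y' B a) (@S_upd _ _ x y (del B a)); last by move=> u; rewrite adj_del eqxx.
  by apply: addsmxS => //; apply: sub_star3.
have rB : (\rank (rowspan x y (del B a)) + 3)%N = \rank (rowspan x y B).
  rewrite (eqP (indep_sub (del_sub B a) iB)) (eqP iB) (card_del B a) d3 //.
(* At the generic position [delta] does not enlarge the span of [B], so at the special one it cannot
   enlarge the rank beyond that of [B], which the rows of [M] over [del B a] already reach. *)
have hr : (\rank (rowspan x' y' B + delta x' y' a b c d e)%MS <= \rank (rowspan x y (del B a) + M)%MS)%N.
  rewrite rk rB.
  have := generic_S B x' y' (ratpoly_delta a b c d e).
  suff -> : \rank (rowspan x y B + delta x y a b c d e)%MS = \rank (rowspan x y B) by [].
  by apply/eqP; rewrite eqn_leq !mxrankS ?addsmxSl // addsmx_sub hd submx_refl.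
have hdM : (delta x' y' a b c d e <= rowspan x y (del B a) + M)%MS.
  have s1 : (rowspan x y (del B a) + M <= rowspan x' y' B + delta x' y' a b c d e)%MS.
    exact: submx_trans hM (addsmxSl _ _).
  apply: submx_trans (addsmxSr (rowspan x' y' B) _) _.
  by rewrite -(mxrank_leqif_sup s1) eqn_leq hr mxrankS.
have A0 : br x' y' c d a = 0.
  by rewrite br_rot br_rot /x' /y' br_line_cd 1?eq_sym // /br; ring.
have B0 : br x' y' a b c * br x' y' a b d * br x' y' a b e != 0.
  by rewrite !mulf_neq0 //; apply: nz; rewrite // eq_sym.
have cdM : (erow x y c d <= rowspan x y (del B a) + M)%MS.
  move: hdM; rewrite /delta A0 !mul0r scale0r sub0r eqmx_opp (eqmx_scale _ B0).
  by rewrite /x' /y' erow_upd // eq_sym.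
apply: submx_trans (S_sub x y (del_sub B a)); apply: sb => //.
by rewrite erow_blk // (negPf uq_0) (negPf uq_1).
Qed.

Lemma delta_swap a b c d e : delta x y b a c d e = - delta x y a b c d e.
Proof.
rewrite /delta (erowC x y a b) !(brC x y a b).
move: (erow x y a b) (erow x y c d) => u v.
by apply/rowP => k; rewrite !mxE; ring.
Qed.

Lemma delta_coefA a b c d e : uniq [:: a; b; c; d; e] ->
  br x y c d a * br x y c d b * br x y c d e != 0.
Proof. by move=> U; usplit U; rewrite !mulf_neq0 //; apply: br_neq0 => //; uq. Qed.

Lemma delta_coefB a b c d e : uniq [:: a; b; c; d; e] ->
  br x y a b c * br x y a b d * br x y a b e != 0.
Proof. by move=> U; usplit U; rewrite !mulf_neq0 //; apply: br_neq0 => //; uq. Qed.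

Lemma delta_sub m (W : 'M[R]_(m, 3 * n)) a b c d e : uniq [:: a; b; c; d; e] ->
  (delta x y a b c d e <= W)%MS -> (erow x y c d <= W)%MS -> (erow x y a b <= W)%MS.
Proof.
move=> U hd hc; rewrite -(eqmx_scale _ (delta_coefA U)).
by rewrite -[X in (X <= _)%MS](subrK ((br x y a b c * br x y a b d * br x y a b e) *: erow x y c d))
  addmx_sub // scalemx_sub.
Qed.

(* Modulo [W], the difference of the weighted rows of [ab] and [cd] vanishes by
   hypothesis, and their sum by the relation of K_5. *)
Lemma delta_K4 m (W : 'M[R]_(m, 3 * n)) a b c d e : uniq [:: a; b; c; d; e] ->
  (delta x y a b c d e <= W)%MS ->
  [/\ (erow x y e a <= W)%MS, (erow x y e b <= W)%MS, (erow x y e c <= W)%MS & (erow x y e d <= W)%MS] ->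
  [/\ (erow x y a c <= W)%MS, (erow x y a d <= W)%MS, (erow x y b c <= W)%MS & (erow x y b d <= W)%MS] ->
  (erow x y a b <= W)%MS.
Proof.
move=> U hd [h1 h2 h3 h4] [h5 h6 h7 h8].
have n2 : 2%:R * sg x y a b c d e != 0 by rewrite mulf_neq0 ?pnatr_eq0 // sg_neq0.
rewrite -(eqmx_scale _ n2).
have r := K5rel (gp5_of Hgp U).
have hd' : (sg x y a b c d e *: erow x y a b - sg x y c d a b e *: erow x y c d <= W)%MS.
  move: hd; rewrite (deltaE Hgp U) eqmx_scale // invr_neq0 // mulf_neq0 ?sg_neq0 //.
  by usplit U; uq.
set X := sg x y a b c d e *: erow x y a b in r hd' *.
set Y := sg x y c d a b e *: erow x y c d in r hd' *.
have -> : (2%:R * sg x y a b c d e) *: erow x y a b = (X - Y) -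
   (sg x y a c b d e *: erow x y a c + sg x y a d b c e *: erow x y a d
    + sg x y a e b c d *: erow x y a e + sg x y b c a d e *: erow x y b c
    + sg x y b d a c e *: erow x y b d + sg x y b e a c d *: erow x y b e
    + sg x y c e a b d *: erow x y c e + sg x y d e a b c *: erow x y d e).
  rewrite -[RHS]addr0 -r -scalerA -/X scaler_nat mulr2n.
  move: (sg x y a c b d e *: _) (sg x y a d b c e *: _) (sg x y a e b c d *: _)
    (sg x y b c a d e *: _) (sg x y b d a c e *: _) (sg x y b e a c d *: _)
    (sg x y c e a b d *: _) (sg x y d e a b c *: _) => t1 t2 t3 t4 t5 t6 t7 t8.
  by clearbody X Y; apply/rowP => k; rewrite !mxE; ring.
by rewrite addmx_sub // eqmx_opp !addmx_sub // scalemx_sub // erowN_sub.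
Qed.

End Pencil.

(** * Excluding pencils *)

Section PencilClaim.
Local Open Scope ring_scope.
Variables (R : realFieldType) (n : nat) (x y : 'I_n -> R).
Hypothesis hgen : generic x y.
Implicit Types (G B : {set edge n}) (T U N : {set 'I_n}) (i j u v w a b c d e : 'I_n).

Let Hgp := generic_gp hgen.
Local Notation S := (rowspan x y).
Local Notation erow := (erow x y).
Local Notation delta := (delta x y).

(** The edge set ranges over all subsets of [Kset U], because the induction, on the size of [U],
    adjoins edges to it when a vertex is removed. *)
Definition pencil_claim U := forall G a b c d e, G \subset Kset U ->
  uniq [:: a; b; c; d; e] -> {subset [:: a; b; c; d; e] <= U} ->
  [/\ (erow e a <= S G)%MS, (erow e b <= S G)%MS, (erow e c <= S G)%MS & (erow e d <= S G)%MS] ->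
  (delta a b c d e <= S G)%MS -> (erow a b <= S G)%MS.

(** * Degrees outside the pencil in a counterexample *)

Section Reduce.
Variables (U : {set 'I_n}) (B : {set edge n}) (w a b c d e : 'I_n).
Hypothesis IH : pencil_claim (U :\ w).
Hypothesis wT : w \notin [:: a; b; c; d; e].
Hypothesis TU : {subset [:: a; b; c; d; e] <= U}.
Hypothesis Uabcde : uniq [:: a; b; c; d; e].
Hypothesis BU : B \subset Kset U.
Hypothesis iB : indep x y B.
Hypothesis hub : [/\ adj B e a, adj B e b, adj B e c & adj B e d].
Hypothesis hd : (delta a b c d e <= S B)%MS.
Hypothesis nab : ~~ (erow a b <= S B)%MS.

Let W := S (del B w).
Let N := nbhd B w.
Let dl := delta a b c d e.

Lemma red_TU : {subset [:: a; b; c; d; e] <= U :\ w}.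
Proof. by move=> z zT; rewrite in_setD1 TU // andbT; apply: contraNneq wT => <-. Qed.

Lemma red_delU : del B w \subset Kset (U :\ w).
Proof.
apply/adj_subP => i j; rewrite adj_del adj_Kset !in_setD1 => /and3P[-> ->].
by move=> /(adj_subP _ _ BU); rewrite adj_Kset.
Qed.

Lemma red_WB : (W <= S B)%MS.
Proof. exact/S_sub/del_sub. Qed.

Lemma red_hub : [/\ (erow e a <= W)%MS, (erow e b <= W)%MS, (erow e c <= W)%MS & (erow e d <= W)%MS].
Proof.
move: wT; rewrite !inE !negb_or => /and5P[wa wb wc wd we].
have h i j : w != i -> w != j -> adj B i j -> (erow i j <= W)%MS.
  by move=> wi wj ij; apply: S_adj; rewrite adj_del ij ![_ == w]eq_sym wi wj.
by case: hub => h1 h2 h3 h4; split; apply: h.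
Qed.

Lemma red_IH G : G \subset Kset (U :\ w) -> (W <= S G)%MS -> (dl <= S G)%MS ->
  (erow a b <= S G)%MS.
Proof.
move=> GU WG dG; have [h1 h2 h3 h4] := red_hub.
by apply: (IH GU Uabcde red_TU) => //; split; apply: submx_trans WG.
Qed.

(** Otherwise the induction hypothesis for [U :\ w] would already put [ab] into the span. *)
Lemma red_dlW : ~~ (dl <= W)%MS.
Proof.
apply: contra nab => h; apply: submx_trans red_WB.
by apply: (red_IH red_delU).
Qed.

Lemma red_W2B : (W + dl <= S B)%MS.
Proof. by rewrite addsmx_sub red_WB. Qed.

Lemma red_add G : G \subset Kset (U :\ w) -> (dl <= S (del B w :|: G))%MS ->
  (erow a b <= S (del B w :|: G))%MS.
Proof.
move=> GU; apply: red_IH; first by rewrite subUset red_delU.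
by apply: S_sub; apply: subsetUl.
Qed.

(** If the row of [ij] required [dl], exchange would put [dl] into the span of [W] and the true edge
    [ij]. Induction applied to that edge set yields [ab] inside [W + dl], against [nab]. *)
Lemma red_edge i j : i \in U :\ w -> j \in U :\ w -> i != j ->
  (erow i j <= W + dl)%MS -> (erow i j <= W)%MS.
Proof.
move=> iU jU ij h; apply: contraNT nab => nW.
have dW := exchange_sub h nW.
have E := S_add2 x y (del B w) ij.
apply: submx_trans red_W2B.
have /submx_trans -> // : (erow a b <= S (del B w) + erow i j)%MS.
  rewrite -E; apply: red_add; last by rewrite E.
  apply/adj_subP => p q; rewrite !adj_Kset !in_set2 => /and3P[-> /orP[]/eqP -> /orP[]/eqP ->];
  by rewrite ?iU ?jU.
by rewrite addsmx_sub addsmxSl.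
Qed.

Lemma red_W20 : (W + dl)%MS *m blk R w = 0.
Proof.
have U' := Uabcde; usplit U'.
apply/eqP; rewrite -submx0 addsmxMr addsmx_sub /W S_del_blk /dl delta_blk // ?sub0mx //.
Qed.

Lemma red_NU u : u \in N -> u \in U :\ w.
Proof.
rewrite nbhdE => h; rewrite in_setD1 eq_sym (adj_neq h) /=.
by have := adj_subP _ _ BU _ _ h; rewrite adj_Kset => /and3P[].
Qed.

Lemma red_wN : w \notin N.
Proof. by rewrite nbhdE adj_irr. Qed.

Lemma red_rank : \rank (S B) = (\rank W + #|N|)%N.
Proof. by rewrite (eqP iB) (eqP (indep_sub (del_sub B w) iB)) (card_del B w). Qed.

Lemma red_clique T : T \subset N ->
  (forall i j, i \in T -> j \in T -> i != j -> (erow i j <= W)%MS) ->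
  (\rank (W + star x y w T)%MS <= \rank W + 3)%N.
Proof.
move=> TN h; apply: rank_clique_star => //.
by apply: contra red_wN; apply: (subsetP TN).
Qed.

Lemma red_gen p q : (\rank ((W + dl) + star (upd x w p) (upd y w q) w N)%MS <= \rank (S B))%N.
Proof.
have := generic_delta hgen B p q wT.
suff -> : \rank (S B + delta a b c d e)%MS = \rank (S B) by [].
by apply/eqP; rewrite eqn_leq !mxrankS ?addsmxSl // addsmx_sub hd submx_refl.
Qed.

Lemma red_rank2 : \rank (W + dl)%MS = (\rank W + 1)%N.
Proof. exact: rank_adds_row_notin red_dlW. Qed.

(** At most three rows at [w] have independent blocks, so [dl], whose block at [w] is zero, would
    lie in [W]. *)
Lemma red_card3 : (3 < #|N|)%N.
Proof.
rewrite ltnNge; apply/negP => N3.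
have NU : N \subset U :\ w by apply/subsetP => u; apply: red_NU.
have U5 : (3 <= #|U :\ w|)%N.
  have := uniq_leq_size (s2 := enum (U :\ w)) Uabcde.
  rewrite -cardE => /(_ _)/(leq_trans _) -> //.
  by move=> z /red_TU; rewrite mem_enum.
have [|N' [NN' N'U N'3]] := @set_extend_card _ N (U :\ w) 3 NU; first by rewrite N3.
have := mem_enum N'; have := enum_uniq N'.
have : size (enum N') = 3 by rewrite -cardE.
case: (enum N') => [|u1 [|u2 [|u3 []]]] // _ uU memN'.
have nw z : z \in [:: u1; u2; u3] -> z != w.
  by rewrite memN' => /(subsetP N'U); rewrite in_setD1 => /andP[].
have [w1 w2 w3] : [/\ u1 != w, u2 != w & u3 != w] by split; apply: nw; rewrite !inE eqxx ?orbT.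
usplit uU.
have fr : row_free (col_mx (erow w u1) (col_mx (erow w u2) (erow w u3)) *m blk R w).
  by apply: star3_free => //; apply: br_neq0 => //; uq.
have [_ sb] := add_free_star (S_del_blk x y B w) fr.
set M := col_mx _ _ in fr sb.
apply/negP: red_dlW; apply/negPn; apply: sb; last first.
  by have U' := Uabcde; usplit U'; apply: delta_blk.
apply: submx_trans hd _; rewrite (S_del_star x y B w) addsmx_sub addsmxSl /=.
apply: submx_trans (addsmxSr _ _).
have : (M <= M)%MS by []; rewrite {1}/M !col_mx_sub => /and3P[h1 h2 h3].
apply/sumsmx_subP => z /(subsetP NN'); rewrite -memN' genmxE !inE.
by case/or3P=> /eqP ->.
Qed.

(** One of the four dimensions that the star adds to [W] is taken by [dl], so [star4_rows] applies
    over [W + dl]. By [red_edge] the neighbours form a clique in [W], whose star has rank at most 3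
    over [W], while [B] is independent. *)
Lemma red_card4 : #|N| != 4.
Proof.
apply/eqP => N4.
have HT p q : (\rank ((W + dl) + star (upd x w p) (upd y w q) w N)%MS <= \rank (W + dl)%MS + 3)%N.
  by apply: leq_trans (red_gen p q) _; rewrite red_rank red_rank2 N4 -addnA.
have := red_clique (subxx N); rewrite -(S_del_star x y B w) red_rank N4 leq_add2l => h.
suff: (4 <= 3)%N by []; apply: h => i j iN jN ij.
apply: red_edge => //; try exact: red_NU.
have [|z|s' sz H] := @arr_extend _ N [:: i; j]; first by rewrite /= inE ij.
  by rewrite in_cons mem_seq1 => /orP[]/eqP->.
move: sz H; rewrite N4; case: s' => [|k [|l []]] // _ H.
have mN z : z \in [:: i; j; k; l] -> z \in N by rewrite (arr_mem _ H).
apply: (@star4_rows _ _ _ _ Hgp _ _ w N red_W20 i j k l HT); try by rewrite mN // !inE eqxx ?orbT.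
by rewrite cons_uniq (arr_uniq H) andbT -(arr_mem _ H) red_wN.
Qed.

(** Of the five dimensions of the star one is taken by [dl], so the trichotomy holds over [W + dl];
    each of its cases contradicts [nab] or the independence of [B]. *)
Lemma red_card5 : #|N| != 5.
Proof.
apply/eqP => N5.
have HT p q : (\rank ((W + dl) + star (upd x w p) (upd y w q) w N)%MS <= \rank (W + dl)%MS + 4)%N.
  by apply: leq_trans (red_gen p q) _; rewrite red_rank red_rank2 N5 -addnA.
have KN : Kset N \subset Kset (U :\ w).
  by apply/Kset_sub/subsetP => u; apply: red_NU.
case: (star5_trichotomy Hgp red_W20 N5 red_wN HT) => [[f hf]|[[a1 [b1 [c1 [d1 [e1 [H h]]]]]]|]].
(* The clique on [N] added to [W] has rank at least [rank W + 2], since its star adds only 3, and at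
   most this much even together with [dl]. It thus contains [dl], hence [ab] by induction, and with
   the star it has the same span as [B]. *)
- have rL1 : (\rank (S (del B w :|: Kset N) + dl)%MS <= \rank W + 2)%N.
    apply: (@leq_trans (\rank ((W + dl) + f)%MS)).
      apply: mxrankS; rewrite addsmx_sub; apply/andP; split; last first.
        by apply: submx_trans (addsmxSl _ _); apply: addsmxSr.
      rewrite S_setU addsmx_sub; apply/andP; split.
        by apply: submx_trans (addsmxSl _ _); apply: addsmxSl.
      by apply: S_subP => i j; rewrite adj_Kset => /and3P[ij iN jN]; apply: hf.
    by apply: leq_trans (rank_adds_row _ _) _; rewrite red_rank2 -addnA.
  have rL3 : (\rank (S (del B w :|: Kset N) + star x y w N)%MS
      <= \rank (S (del B w :|: Kset N)) + 3)%N.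
    apply: rank_clique_star => //; first exact: red_wN.
    by move=> i j iN jN ij; apply: S_adj; rewrite adj_setU adj_Kset ij iN jN orbT.
  have BL : (S B <= S (del B w :|: Kset N) + star x y w N)%MS.
    by rewrite (S_del_star x y B w) addsmxS // S_sub // subsetUl.
  have r2 : (\rank W + 2 <= \rank (S (del B w :|: Kset N)))%N.
    have := leq_trans (mxrankS BL) rL3; rewrite red_rank N5.
    by rewrite -(leq_add2r 3 (_ + 2)) -addnA.
  have dL : (dl <= S (del B w :|: Kset N))%MS.
    apply: submx_trans (addsmxSr (S (del B w :|: Kset N)) _) _.
    rewrite -(mxrank_leqif_sup (addsmxSl _ _)) eqn_leq mxrankS ?addsmxSl //=.
    exact: leq_trans rL1 r2.
  case/negP: nab; apply: submx_trans (red_add KN dL) _.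
  apply: submx_trans (addsmxSl _ (star x y w N)) _.
  rewrite -(mxrank_leqif_sup BL) eqn_leq mxrankS //=.
  apply: leq_trans rL3 _; rewrite red_rank N5; apply: (@leq_trans ((\rank W + 2) + 3)%N).
    by rewrite leq_add2r; apply: leq_trans rL1; rewrite mxrankS ?addsmxSl.
  by rewrite -addnA.
(* Four of the neighbours form a clique in [W]: their star adds at most 3 and the fifth row at most
   1, but [B] requires 5. *)
- have mN z : z \in [:: a1; b1; c1; d1; e1] -> z \in N by rewrite (arr_mem _ H).
  pose T := [set:: [:: b1; c1; d1; e1]].
  have TN : T \subset N.
    by apply/subsetP => z; rewrite inE => zT; apply: mN; rewrite in_cons zT orbT.
  have rc : (\rank (W + star x y w T)%MS <= \rank W + 3)%N.
    apply: red_clique => // i j iT jT ij.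
    apply: red_edge => //; [exact/red_NU/(subsetP TN)|exact/red_NU/(subsetP TN)|].
    by apply: h => //; [move: iT|move: jT]; rewrite inE.
  have : (\rank (S B) <= \rank ((W + star x y w T) + erow w a1)%MS)%N.
    rewrite (S_del_star x y B w); apply: mxrankS; rewrite addsmx_sub; apply/andP; split.
      by apply: submx_trans (addsmxSl _ _); apply: addsmxSl.
    apply/sumsmx_subP => z; rewrite -/N (arr_mem _ H) genmxE in_cons => /orP[/eqP ->|zT].
      exact: addsmxSr.
    by apply: submx_trans (addsmxSl _ _); apply: submx_trans (addsmxSr _ _);
      apply: sub_star; rewrite inE.
  move=> /leq_trans /(_ (rank_adds_row _ _)); rewrite red_rank N5 => r5.
  have := leq_trans r5 (leq_add rc (leqnn 1)).
  by rewrite -addnA leq_add2l.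
- case=> [a1 [b1 [c1 [d1 [e1 [H [ha hb hc hd1 [d12 d13 nx ny cap]]]]]]]].
  have mN z : z \in [:: a1; b1; c1; d1; e1] -> z \in U :\ w.
    by rewrite -(arr_mem _ H); apply: red_NU.
  have [aU bU cU dU eU] : [/\ a1 \in U :\ w, b1 \in U :\ w, c1 \in U :\ w, d1 \in U :\ w & e1 \in U :\ w].
    by split; apply: mN; rewrite !inE eqxx ?orbT.
  have U1 := arr_uniq H.
  have U1' := U1; usplit U1'.
  have hub1 : [/\ (erow e1 a1 <= W)%MS, (erow e1 b1 <= W)%MS, (erow e1 c1 <= W)%MS & (erow e1 d1 <= W)%MS].
    by split; apply: red_edge => //; rewrite eq_sym.
  (* The [delta] of the new pencil is not in [W] by induction, so it can replace [dl]. Written with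
     the two edges [a1 b2] and [c2 d1] it admits induction; as [delta] itself is in [W + dl], only
     the row of [a1 b2] is needed beyond [W + dl]. *)
  have key b2 c2 : arr N [:: a1; b2; c2; d1; e1] -> (delta a1 b2 c2 d1 e1 <= W + dl)%MS ->
     ~~ (erow a1 b2 <= W + dl)%MS ->
     [/\ (erow e1 a1 <= W)%MS, (erow e1 b2 <= W)%MS, (erow e1 c2 <= W)%MS & (erow e1 d1 <= W)%MS] ->
     (erow a b <= (W + dl) + erow a1 b2)%MS.
    move=> H2 hd2 n2 hub2.
    have mN2 z : z \in [:: a1; b2; c2; d1; e1] -> z \in U :\ w.
      by rewrite -(arr_mem _ H2); apply: red_NU.
    have V := arr_uniq H2.
    have nW : ~~ (delta a1 b2 c2 d1 e1 <= W)%MS.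
      apply: contra n2 => h2; apply: submx_trans (addsmxSl _ _).
      exact: (IH red_delU V mN2 hub2 h2).
    have dW := exchange_sub hd2 nW.
    have V' := V; usplit V'.
    have s2 : ((W + erow a1 b2) + erow c2 d1 <= (W + dl) + erow a1 b2)%MS.
      rewrite !addsmx_sub addsmxSr andbT; apply/andP; split.
        by apply: submx_trans (addsmxSl _ _); apply: addsmxSl.
      rewrite -(eqmx_scale _ (delta_coefB hgen V)).
      rewrite -[X in (X <= _)%MS](subKr
        ((br x y c2 d1 a1 * br x y c2 d1 b2 * br x y c2 d1 e1) *: erow a1 b2)).
      rewrite addmx_sub ?scalemx_sub ?addsmxSr // eqmx_opp.
      exact: submx_trans hd2 (addsmxSl _ _).
    apply: submx_trans s2.
    have E : (S (del B w :|: (Kset [set a1; b2] :|: Kset [set c2; d1])) :=: (W + erow a1 b2) + erow c2 d1)%MS.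
      rewrite setUA; apply: eqmx_trans (S_add2 x y _ _) _ => //.
      by apply: adds_eqmx => //; apply: S_add2.
    have mU2 : {subset [:: a1; b2; c2; d1] <= U :\ w}.
      move=> z zT; apply: mN2; move: zT; rewrite !inE.
      by do 4 (case: (z == _)).
    rewrite -E; apply: red_add.
      have sub2 i j : i \in U :\ w -> j \in U :\ w -> Kset [set i; j] \subset Kset (U :\ w).
        move=> iU jU; apply/adj_subP => p q; rewrite !adj_Kset !in_set2.
        by case/and3P=> -> /orP[]/eqP -> /orP[]/eqP ->; rewrite ?iU ?jU.
      by rewrite subUset !sub2 //; apply: mU2; rewrite !inE eqxx ?orbT.
    rewrite E; apply: submx_trans dW _; rewrite addsmx_sub; apply/andP; split.
      by apply: submx_trans (addsmxSl _ _); apply: addsmxSl.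
    apply: addsmx_delta; last exact: addsmxSr.
    by apply: submx_trans (addsmxSl _ _); apply: addsmxSr.
  (* Both [a1 b1] and [a1 c1] may serve as the additional row; they are independent modulo [W + dl],
     so [ab] needs neither. *)
  case/negP: nab; apply: submx_trans red_W2B; apply: cap.
    exact: (key b1 c1).
  have H2 : arr N [:: a1; c1; b1; d1; e1] by arrtac H.
  by apply: (key c1 b1) => //; case: hub1.
Qed.

End Reduce.

(** A counterexample has a base [B] containing the four edges at the hub [e]. Vertices outside the
    pencil have degree at least 6, so the edge count forces [a] and [b] down to degree 3. Both are
    then joined to [c] and [d], and [delta_K4] gives the edge [ab] after all. *)
Lemma pencil_all U : pencil_claim U.
Proof.
move: {2}#|U| (erefl #|U|) => k; elim: k U => [|k IHk] U Uk G a b c d e GU Uu TU hub hd.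
  by have := TU a; rewrite (cards0_eq Uk) !inE eqxx => /(_ isT).
have mU z : z \in [:: a; b; c; d; e] -> z \in U by exact: TU.
have [aU bU cU dU eU] : [/\ a \in U, b \in U, c \in U, d \in U & e \in U].
  by split; apply: mU; rewrite !inE eqxx ?orbT.
have V := Uu; usplit V.
(* Built from the empty set so that each edge is pendant to the previous ones, as [indep_pendant]
   requires. *)
pose H := set0 :|: Kset [set a; e] :|: Kset [set b; e] :|: Kset [set c; e] :|: Kset [set d; e].
have adjH i j : adj H i j = (i != j) && [|| (i \in [set a; e]) && (j \in [set a; e]),
   (i \in [set b; e]) && (j \in [set b; e]), (i \in [set c; e]) && (j \in [set c; e]) |
   (i \in [set d; e]) && (j \in [set d; e])].
  by rewrite /H !adj_setU !adj_Kset adj_set0; case: (i == j); rewrite //= !orbA.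
have neqs : [/\ b != a, c != a, d != a, c != b & d != b] /\ d != c.
  by split; [split|]; rewrite eq_sym.
case: neqs => [[nba nca nda ncb ndb] ndc].
have iH : indep x y H.
  do 4 (apply: indep_pendant => //; first by
    move=> w; rewrite ?adj_setU ?adj_Kset ?adj_set0 ?in_set2 ?(negPf uq_2) ?(negPf uq_5)
      ?(negPf uq_7) ?(negPf uq_8) ?(negPf nba) ?(negPf nca) ?(negPf nda) ?(negPf ncb)
      ?(negPf ndb) ?(negPf ndc) ?andbF).
  exact: indep0.
have HG : (S H <= S G)%MS.
  have hz z : (erow e z <= S G)%MS -> forall i j, i != j -> (i \in [set z; e]) && (j \in [set z; e]) ->
     (erow i j <= S G)%MS.
    move=> h i j ij; rewrite !in_set2 => /andP[/orP[]/eqP E1 /orP[]/eqP E2];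
      move: ij; rewrite E1 E2 ?eqxx // => _; by rewrite erowN_sub.
  case: hub => h1 h2 h3 h4.
  by apply: S_subP => i j; rewrite adjH => /andP[ij /or4P[]]; apply: hz.
have [B [HB BGH iB sB]] := base_extend (subsetUr G H) iH.
have GB : (S G <= S B)%MS by apply: submx_trans sB; apply: S_sub; apply: subsetUl.
have BG : (S B <= S G)%MS.
  by apply: submx_trans (S_sub x y BGH) _; rewrite S_setU addsmx_sub HG submx_refl.
have BU : B \subset Kset U.
  apply: subset_trans BGH _; rewrite subUset GU /=.
  apply/adj_subP => i j; rewrite adjH adj_Kset !in_set2 => /andP[-> /=].
  by case/or4P=> /andP[/orP[]/eqP -> /orP[]/eqP ->]; rewrite ?aU ?bU ?cU ?dU ?eU.
have hubB : [/\ adj B e a, adj B e b, adj B e c & adj B e d].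
  by split; apply: (adj_subP _ _ HB); rewrite adjH !in_set2 !eqxx ?orbT !andbT eq_sym.
have hdB : (delta a b c d e <= S B)%MS by apply: submx_trans GB.
apply: submx_trans BG; apply/contraT => nab.
have deg6 w : w \in U -> w \notin [:: a; b; c; d; e] -> (6 <= #|nbhd B w|)%N.
  move=> wU wT; have Uw : #|U :\ w| = k by rewrite (cardsD1_in wU Uk).
  have IH : pencil_claim (U :\ w) by apply: IHk.
  have := red_card3 IH wT TU Uu BU hubB hdB nab.
  have := red_card4 IH wT TU Uu BU iB hubB hdB nab.
  have := red_card5 IH wT TU Uu BU iB hubB hdB nab.
  by case: #|_| => [|[|[|[|[|[]]]]]].
have ncd : ~~ (erow c d <= S B)%MS by apply: contra nab; apply: (delta_sub hgen Uu).
have nadj i j : ~~ (erow i j <= S B)%MS -> ~~ adj B i j by apply: contra => h; apply: S_adj.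
have [ea eb ec ed] := hubB.
have cA := delta_coefA hgen Uu; have cB := delta_coefB hgen Uu.
have da : (3 <= #|nbhd B a|)%N.
  apply: (@deg_ge3 _ _ _ _ hgen B a b e c
    (- ((br x y a b c * br x y a b d * br x y a b e) *: erow c d)) _ _ _ _ cA _ hdB).
  - by rewrite adjC.
  - exact: nadj.
  - by uq.
  - by rewrite mulNmx -scalemxAl erow_blk // (negPf uq_0) (negPf uq_1) scaler0 oppr0.
have db : (3 <= #|nbhd B b|)%N.
  apply: (@deg_ge3 _ _ _ _ hgen B b a e c (- ((br x y a b c * br x y a b d * br x y a b e) *: erow c d))
    (- (br x y c d a * br x y c d b * br x y c d e))).
  - by rewrite adjC.
  - by rewrite adjC; apply: nadj.
  - by uq.
  - by rewrite oppr_eq0.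
  - by rewrite mulNmx -scalemxAl erow_blk // (negPf uq_3) (negPf uq_4) scaler0 oppr0.
  - by rewrite erowC scalerN scaleNr opprK.
have dc : (3 <= #|nbhd B c|)%N.
  apply: (@deg_ge3 _ _ _ _ hgen B c d e a ((br x y c d a * br x y c d b * br x y c d e) *: erow a b)
    (- (br x y a b c * br x y a b d * br x y a b e))).
  - by rewrite adjC.
  - exact: nadj.
  - by uq.
  - by rewrite oppr_eq0.
  - by rewrite -scalemxAl erow_blk // (negPf nca) (negPf ncb) scaler0.
  - by rewrite scaleNr addrC.
have dd : (3 <= #|nbhd B d|)%N.
  apply: (@deg_ge3 _ _ _ _ hgen B d c e a ((br x y c d a * br x y c d b * br x y c d e) *: erow a b)
    (br x y a b c * br x y a b d * br x y a b e)).
  - by rewrite adjC.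
  - by rewrite adjC; apply: nadj.
  - by uq.
  - by [].
  - by rewrite -scalemxAl erow_blk // (negPf nda) (negPf ndb) scaler0.
  - by rewrite erowC scalerN addrC.
pose T := a |: (b |: (c |: (d |: [set e]))).
have sumT (F : 'I_n -> nat) : (\sum_(z in T) F z = F a + (F b + (F c + (F d + F e))))%N.
  rewrite /T; do 4 (rewrite big_setU1 /=; last by rewrite !inE ?negb_or ?uq_ ?uq_0 ?uq_1 ?uq_2
    ?uq_3 ?uq_4 ?uq_5 ?uq_6 ?uq_7 ?uq_8).
  by rewrite big_set1.
have TU' : T \subset U.
  by apply/subsetP => z; rewrite !inE => zT; apply: mU; rewrite !inE.
have cT : #|T| = 5%N by rewrite -sum1_card sumT.
have de : (4 <= #|nbhd B e|)%N.
  have : T :\ e \subset nbhd B e.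
    apply/subsetP => z; rewrite nbhdE !inE => /andP[ze].
    by rewrite (negPf ze) orbF => /or4P[]/eqP ->.
  move=> /subset_leq_card; have := cardsD1 e T.
  by rewrite cT !inE eqxx !orbT add1n => -[<-].
have cardB : (#|B| + 7 <= 3 * #|U|)%N.
  have U3 : (3 <= #|U|)%N by apply: leq_trans (subset_leq_card TU'); rewrite cT.
  have rK := rank_Kset Hgp U3.
  have sBK := S_sub x y BU.
  have lt : (\rank (S B) < \rank (S (Kset U)))%N.
    rewrite ltn_neqAle mxrankS // andbT (mxrank_leqif_sup sBK).
    by apply: contra nab; apply: submx_trans; apply: S_adj; rewrite adj_Kset uq_ aU bU.
  rewrite (eqP iB) in lt; move: lt rK; move: (\rank (S (Kset U))) #|B| #|U|; clear; lia.
have hs := handshake BU.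
have rest : (6 * (#|U| - 5) <= \sum_(z in U :\: T) #|nbhd B z|)%N.
  have -> : (#|U| - 5)%N = #|U :\: T| by rewrite cardsD (setIidPr TU') cT.
  rewrite mulnC -sum_nat_const.
  apply: leq_sum => z; rewrite in_setD => /andP[zT zU]; apply: deg6 => //.
  by move: zT; rewrite !inE.
(* The degree sum is at most [6 |U| - 14], and the outside vertices use at least [6 |U| - 30] of it.
   The remaining 16 equals the minimum 3 + 3 + 3 + 3 + 4 for the pencil, so all its bounds are
   attained. *)
have [da3 db3] : #|nbhd B a| = 3%N /\ #|nbhd B b| = 3%N.
  have U5 : (5 <= #|U|)%N by rewrite -cT subset_leq_card.
  move: hs; rewrite (big_setID T) /= (setIidPr TU') sumT => hs.
  move: hs rest cardB da db dc dd de U5.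
  move: #|nbhd B a| #|nbhd B b| #|nbhd B c| #|nbhd B d| #|nbhd B e| #|B| #|U| (bigop.body _ _ _).
  clear; move=> *; lia.
have Ub : uniq [:: b; a; c; d; e] by uq.
have nadjab := nadj _ _ nab.
have nadjba : ~~ adj B b a by rewrite adjC.
have ae : adj B a e by rewrite adjC.
have be : adj B b e by rewrite adjC.
have /andP[ac ad] := degree3_nbrs hgen Uu iB ae nadjab da3 hdB ncd.
have hdB' : (delta b a c d e <= S B)%MS by rewrite delta_swap eqmx_opp.
have /andP[bc bd] := degree3_nbrs hgen Ub iB be nadjba db3 hdB' ncd.
case/negP: nab; apply: (delta_K4 hgen Uu hdB); split; exact: S_adj.
Qed.

End PencilClaim.

(** * Linear relations between the rows *)

Section Stress.
Local Open Scope ring_scope.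
Variables (R : realFieldType) (n : nat) (x y : 'I_n -> R).
Hypothesis hgen : generic x y.
Hypothesis hn : (5 <= n)%N.
Implicit Types (G D X : {set edge n}) (T U N K A : {set 'I_n}) (i j u v w a b c d : 'I_n).
Implicit Types (s : edge n -> R) (e f : edge n).

Let Hgp := generic_gp hgen.
Local Notation S := (rowspan x y).
Local Notation erow := (erow x y).
Local Notation cofrow := (cofrow x y).

(** Called a stress as in rigidity theory. The coefficients are a function on all edges, so
    relations with different supports can be subtracted. *)
Definition stress s := \sum_(e : edge n) s e *: cofrow e = 0.
Definition supp s := [set e | s e != 0].

Lemma stress_ext s s' : (forall e, s e = s' e) -> stress s -> stress s'.
Proof. by rewrite /stress => h hs; rewrite -[RHS]hs; apply: eq_bigr => e _; rewrite h. Qed.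

Lemma stress_sub s s' (c : R) : stress s -> stress s' -> stress (fun e => s e - c * s' e).
Proof.
rewrite /stress => h h'.
under eq_bigr => e _ do rewrite scalerBl -scalerA.
by rewrite big_split /= h sumrN -scaler_sumr h' scaler0 subr0.
Qed.

Lemma stress_closed s e : stress s -> e \in supp s -> (cofrow e <= S (supp s :\ e))%MS.
Proof.
rewrite inE => h se; rewrite -(eqmx_scale _ se).
move: h; rewrite /stress (bigD1 e) //= => /eqP; rewrite addr_eq0 => /eqP ->.
rewrite eqmx_opp; apply: summx_sub => f fe.
have [->|sf] := eqVneq (s f) 0; first by rewrite scale0r sub0mx.
by apply/scalemx_sub/S_edge; rewrite !inE fe.
Qed.

Lemma dep_stress D : ~~ indep x y D ->
  exists c : edge n -> R, [/\ stress c, supp c \subset D & exists e, e \in supp c].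
Proof.
move=> nD.
have : ~~ row_free (rows x y D) by rewrite /row_free (rowsE x y D).
rewrite -kermx_eq0 => /rowV0Pn[u /sub_kermxP uR u0].
pose c e := \sum_(k < #|D|) (enum_val k == e)%:R * u 0 k.
have cE k : c (enum_val k) = u 0 k.
  rewrite /c (bigD1 k) //= eqxx mul1r big1 ?addr0 // => l lk.
  by rewrite (inj_eq enum_val_inj) (negPf lk) mul0r.
exists c; split.
- rewrite /stress -[RHS]uR.
  have -> : u *m rows x y D = \sum_(k < #|D|) u 0 k *: cofrow (enum_val k).
    by rewrite mulmx_sum_row; apply: eq_bigr => k _; rewrite rowK.
  under eq_bigr => e _ do rewrite /c scaler_suml.
  rewrite exchange_big /=; apply: eq_bigr => k _.
  rewrite (bigD1 (enum_val k)) //= eqxx mul1r big1 ?addr0 // => e ek.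
  by rewrite eq_sym (negPf ek) mul0r scale0r.
- apply/subsetP => e; rewrite inE; apply: contraR => eD; apply/eqP.
  rewrite /c big1 // => k _; case: eqP => [E|_]; last by rewrite mul0r.
  by move: eD; rewrite -E enum_valP.
- have [k uk] : exists k, u 0 k != 0.
    apply/existsP; rewrite -negb_forall; apply: contra u0 => /forallP z.
    by apply/eqP/rowP => k; rewrite mxE; apply/eqP.
  by exists (enum_val k); rewrite inE cE.
Qed.

Lemma nbhd_D1 D e v u : val e = (v, u) \/ val e = (u, v) -> nbhd (D :\ e) v = nbhd D v :\ u.
Proof.
move=> he; apply/setP => z; rewrite in_setD1 !nbhdE.
apply/adjP/andP => [[f /[!inE] /andP[fe fD] hf]|[zu /adjP[f fD hf]]].
  split; last by apply/adjP; exists f.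
  apply: contraNneq fe => zu; apply/eqP; apply: (edge_eqP (i := v) (j := u)) => //.
  by rewrite -zu.
exists f; rewrite // !inE fD andbT; apply: contraNneq zu => fe; subst f.
case: he hf => -> [[]|[]]; do ?[by move=> ->|by move=> _ ->]; try by move=> -> ->.
Qed.

Lemma del_D1 D e v : incident v e -> del (D :\ e) v = del D v.
Proof.
move=> ve; apply/setP => f; rewrite !inE.
by have [->|fe] := eqVneq f e; rewrite ?ve ?andbF.
Qed.

Lemma exists_fresh (s : seq 'I_n) : (size s < n)%N -> exists w, w \notin s.
Proof.
move=> hs; case: (boolP [forall w, w \in s]) => [/forallP h|].
  have := uniq_leq_size (s2 := s) (enum_uniq 'I_n) (fun z _ => h z).
  by rewrite -cardE card_ord leqNgt hs.
by rewrite negb_forall => /existsP.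
Qed.

(** An edge of the support at [v] lies in the span of the others, and [deg_ge3] then demands three
    more edges at [v]. *)
Lemma stress_star3 s v : stress s -> (#|nbhd (supp s) v| <= 3)%N -> nbhd (supp s) v = set0.
Proof.
move=> hs c3; apply/eqP; apply: contraTT c3 => /set0Pn[u]; rewrite -ltnNge => uT.
have uT' := uT; move: uT'; rewrite nbhdE => vu; have [e es he] := adjP _ _ _ vu.
have hcl : (erow v u <= S (supp s :\ e))%MS by rewrite (erow_edge x y he); apply: stress_closed.
have NE := nbhd_D1 (supp s) he.
rewrite (cardsD1 u) uT add1n ltnS -NE.
have nadj : ~~ adj (supp s :\ e) v u by rewrite -nbhdE NE in_setD1 eqxx.
have [E|/set0Pn[h]] := eqVneq (nbhd (supp s :\ e) v) set0.
  have h0 w : adj (supp s :\ e) v w = false by rewrite -nbhdE E inE.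
  by have := erow_notin_S hgen (adj_neq vu) h0; rewrite hcl.
rewrite nbhdE => vh.
have [|w] := @exists_fresh [:: v; u; h]; first by apply: leq_trans hn.
rewrite !inE !negb_or => /and3P[wv wu wh].
have uh : u != h by apply: contraNneq nadj => ->.
apply: (@deg_ge3 _ _ _ _ hgen _ v u h w 0 1) => //.
- have vu' := adj_neq vu; have vh' := adj_neq vh; uq.
- by rewrite oner_eq0.
- by rewrite mul0mx.
by rewrite scale1r addr0.
Qed.

(** The coefficients of [K5rel], written without a labelling of the five vertices. *)
Definition K5_stress K e : R := if e \in Kset K then
  (\prod_(k in K :\ (val e).1 :\ (val e).2) br x y (val e).1 (val e).2 k)^-1 else 0.

Definition K5in X K := (#|K| == 5%N) && (Kset K \subset X).

Definition span5 X s := exists al : {set 'I_n} -> R,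
  forall e, s e = \sum_(K : {set 'I_n} | K5in X K) al K * K5_stress K e.

Lemma span5D X s s' (c : R) : span5 X s -> span5 X s' -> span5 X (fun e => s e + c * s' e).
Proof.
move=> [al h] [be h']; exists (fun K => al K + c * be K) => e.
rewrite h h' mulr_sumr -big_split; apply: eq_bigr => K _ /=; ring.
Qed.

Lemma span5_om X K : K5in X K -> span5 X (K5_stress K).
Proof.
move=> hK; exists (fun A => (A == K)%:R) => e.
rewrite (bigD1 K) //= eqxx mul1r big1 ?addr0 // => A /andP[_ /negPf ->].
by rewrite mul0r.
Qed.

Lemma span5_0 X : span5 X (fun _ => 0).
Proof. by exists (fun _ => 0) => e; rewrite big1 // => K _; rewrite mul0r. Qed.

Lemma span5_ext X s s' : (forall e, s e = s' e) -> span5 X s -> span5 X s'.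
Proof. by move=> h [al hal]; exists al => e; rewrite -h. Qed.

Lemma K5_stress_notin K e : e \notin Kset K -> K5_stress K e = 0.
Proof. by rewrite /K5_stress => /negPf ->. Qed.

Lemma K5_stress_neq0 K e : e \in Kset K -> K5_stress K e != 0.
Proof.
move=> eK; rewrite /K5_stress eK invr_neq0 //; apply/prodf_neq0 => k.
rewrite !in_setD1 => /and3P[k2 k1 kK].
by apply: br_neq0 => //; have := edge_neq e; move=> e12; uq.
Qed.

Lemma sum_star (V : lmodType R) G v (F : edge n -> V) (f : 'I_n -> 'I_n -> V) :
  (forall e i j, e \in G -> val e = (i, j) \/ val e = (j, i) -> F e = f i j) ->
  \sum_(e in G) F e = \sum_(e in del G v) F e + \sum_(u in nbhd G v) f v u.
Proof.
move=> h; rewrite (bigID (fun e => ~~ incident v e)) /=; congr (_ + _).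
  by apply: eq_bigl => e; rewrite inE.
have -> : nbhd G v = other v @: [set e in G | incident v e].
  apply/setP => u; rewrite nbhdE; apply/adjP/imsetP => [[e eG he]|[e]].
    have ve : incident v e by rewrite /incident; case: he => -> /=; rewrite eqxx ?orbT.
    exists e; first by rewrite inE eG.
    have := edge_neq e; rewrite /other; case: he => -> /=; rewrite ?eqxx // => uv.
    by rewrite (negPf uv).
  by rewrite inE => /andP[eG ve] ->; exists e => //; apply: otherP.
rewrite big_imset /=; last first.
  move=> e e'; rewrite !inE => /andP[_ h1] /andP[_ h2] E.
  by apply: (@edge_eqP _ e e' v (other v e)); [|rewrite E]; apply: otherP.
apply: eq_big => [e|e]; first by rewrite inE negbK.
by move=> /andP[eG]; rewrite negbK => ve; apply: h => //; apply: otherP.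
Qed.

Lemma stress_K5_stress K : #|K| = 5%N -> stress (K5_stress K).
Proof.
move=> K5; rewrite /stress.
have H := arr_enum K; have := K5; rewrite cardE.
case: (enum K) H => [|a [|b [|c [|d [|e []]]]]] // H _.
pose f i j := (\prod_(k in K :\ i :\ j) br x y i j k)^-1 *: erow i j.
pose F g := K5_stress K g *: cofrow g.
have fE p q r t z : arr K [:: p; q; r; t; z] -> f p q = sg x y p q r t z *: erow p q.
  move=> Hp; have V := arr_uniq Hp; usplit V; rewrite /f /sg; congr (_^-1 *: _).
  have -> : K :\ p :\ q = r |: (t |: [set z]).
    apply/setP => k; rewrite !in_setD1 !in_setU1 in_set1 (arr_mem k Hp) !inE.
    have [->|kp] := eqVneq k p; first by rewrite (negPf uq_0) (negPf uq_1) (negPf uq_2) andbF.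
    have [->|kq] := eqVneq k q; first by rewrite (negPf uq_3) (negPf uq_4) (negPf uq_5).
    by [].
  rewrite big_setU1 /=; last by rewrite !inE negb_or uq_6 uq_7.
  by rewrite big_setU1 /= ?inE // big_set1 mulrA.
have fC i j : i \in K -> j \in K -> i != j -> f i j = f j i.
  move=> iK jK ij; have [p [q [r Hp]]] := arr_ext2 K5 ij iK jK.
  have Hp' : arr K [:: j; i; p; q; r] by arrtac Hp.
  by rewrite (fE _ _ _ _ _ Hp) (fE _ _ _ _ _ Hp') sgC erowC scalerN scaleNr opprK.
have Ff g i j : g \in Kset K -> val g = (i, j) \/ val g = (j, i) -> F g = f i j.
  move=> gK hg; have gK' := gK; move: gK'; rewrite inE => /andP[g1 g2].
  have E : F g = f (val g).1 (val g).2 by rewrite /F /K5_stress gK cofrowE.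
  have := edge_neq g; rewrite E; move: g1 g2.
  by case: hg => -> //= h1 h2 h3; apply: fC.
have -> : \sum_(g : edge n) K5_stress K g *: cofrow g = \sum_(g in Kset K) F g.
  rewrite (bigID (mem (Kset K))) /= [X in _ + X]big1 ?addr0 // => g gK.
  by rewrite /K5_stress (negPf gK) scale0r.
have sub A g i j : A \subset K -> g \in Kset A -> val g = (i, j) \/ val g = (j, i) -> F g = f i j.
  move=> AK gA; apply: Ff; move: gA; rewrite !inE => /andP[h1 h2].
  by rewrite !(subsetP AK).
have V := arr_uniq H; usplit V.
have KE : K = a |: (b |: (c |: (d |: [set e]))).
  by apply/setP => z; rewrite (arr_mem z H) !inE.
(* Splitting off one vertex at a time lists the ten edges explicitly, in the order of [K5rel] up to
   regrouping. *)
have step A p : p \notin A -> p |: A \subset K ->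
   \sum_(g in Kset (p |: A)) F g = \sum_(g in Kset A) F g + \sum_(u in A) f p u.
  move=> pA sK; rewrite (@sum_star _ _ p F f) => [|g i j gA]; last exact: (sub _ _ _ _ sK gA).
  by rewrite del_Kset nbhd_Kset ?setU11 // setU1K.
rewrite KE step -?KE //; last by rewrite !inE !negb_or uq_ uq_0 uq_1 uq_2.
have s1 : b |: (c |: (d |: [set e])) \subset K by rewrite KE subsetUr.
rewrite step //; last by rewrite !inE !negb_or uq_3 uq_4 uq_5.
have s2 : c |: (d |: [set e]) \subset K by apply: subset_trans s1; rewrite subsetUr.
rewrite step //; last by rewrite !inE !negb_or uq_6 uq_7.
have s3 : d |: [set e] \subset K by apply: subset_trans s2; rewrite subsetUr.
rewrite step //; last by rewrite !inE uq_8.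
have -> : \sum_(g in Kset [set e]) F g = 0.
  apply: big_pred0 => g; rewrite !inE; apply/negP => /andP[/eqP h1 /eqP h2].
  by have := edge_neq g; rewrite h1 h2 eqxx.
have e1 (g : 'I_n -> 'rV[R]_(3 * n)) : \sum_(u in d |: [set e]) g u = g d + g e.
  by rewrite big_setU1 ?big_set1 // inE.
have e2 (g : 'I_n -> 'rV[R]_(3 * n)) :
    \sum_(u in c |: (d |: [set e])) g u = g c + (g d + g e).
  by rewrite big_setU1 ?e1 // !inE negb_or uq_6.
have e3 (g : 'I_n -> 'rV[R]_(3 * n)) :
    \sum_(u in b |: (c |: (d |: [set e]))) g u = g b + (g c + (g d + g e)).
  by rewrite big_setU1 ?e2 // !inE !negb_or uq_3 uq_4.
rewrite e3 e2 e1.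
rewrite !big_set1.
have H1 : arr K [:: a; c; b; d; e] by arrtac H.
have H2 : arr K [:: a; d; b; c; e] by arrtac H.
have H3 : arr K [:: a; e; b; c; d] by arrtac H.
have H4 : arr K [:: b; c; a; d; e] by arrtac H.
have H5 : arr K [:: b; d; a; c; e] by arrtac H.
have H6 : arr K [:: b; e; a; c; d] by arrtac H.
have H7 : arr K [:: c; d; a; b; e] by arrtac H.
have H8 : arr K [:: c; e; a; b; d] by arrtac H.
have H9 : arr K [:: d; e; a; b; c] by arrtac H.
rewrite (fE _ _ _ _ _ H) (fE _ _ _ _ _ H1) (fE _ _ _ _ _ H2) (fE _ _ _ _ _ H3) (fE _ _ _ _ _ H4).
rewrite (fE _ _ _ _ _ H5) (fE _ _ _ _ _ H6) (fE _ _ _ _ _ H7) (fE _ _ _ _ _ H8) (fE _ _ _ _ _ H9).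
rewrite -[RHS](K5rel (gp5_of Hgp (arr_uniq H))).
move: (sg x y a b c d e *: _) (sg x y a c b d e *: _) (sg x y a d b c e *: _)
 (sg x y a e b c d *: _) (sg x y b c a d e *: _) (sg x y b d a c e *: _)
 (sg x y b e a c d *: _) (sg x y c d a b e *: _) (sg x y c e a b d *: _) (sg x y d e a b c *: _).
by clear; move=> *; apply/rowP => k; rewrite !mxE; ring.
Qed.

End Stress.

(** * Relations as combinations of K_5 relations *)

Section StressSpan.
Local Open Scope ring_scope.
Variables (R : realFieldType) (n : nat) (x y : 'I_n -> R).
Hypothesis hgen : generic x y.
Hypothesis hn : (5 <= n)%N.
Implicit Types (G D X : {set edge n}) (T U N K A : {set 'I_n}) (i j u v w a b c d : 'I_n).
Implicit Types (s : edge n -> R) (e f : edge n).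

Let Hgp := generic_gp hgen.
Local Notation S := (rowspan x y).
Local Notation erow := (erow x y).
Local Notation stress := (stress x y).
Local Notation K5_stress := (K5_stress x y).
Local Notation span5 := (span5 x y).

Definition flat X := forall i j, i != j -> (erow i j <= S X)%MS -> adj X i j.

(** While [v] has more than three neighbours, a multiple of the relation of the K_5 on [v] and four
    of them cancels one edge at [v] and adds no new edge there. From three neighbours on,
    [stress_star3] clears [v] completely. *)
Lemma clique_peel X U v s : stress s -> supp s \subset X :&: Kset U ->
  (forall i j, i \in nbhd (supp s) v -> j \in nbhd (supp s) v -> i != j -> adj X i j) ->
  exists s', [/\ span5 X s', stress (fun e => s e - s' e) &
    supp (fun e => s e - s' e) \subset X :&: Kset (U :\ v)].
Proof.
move: {2}#|nbhd (supp s) v|.+1 (ltnSn #|nbhd (supp s) v|) => k.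
elim: k s => // k IH s ck hs sX cl.
have [c3|c3] := leqP #|nbhd (supp s) v| 3.
- exists (fun _ => 0); split; first exact: span5_0.
    by apply: stress_ext hs => e; rewrite subr0.
  have N0 := stress_star3 hgen hn hs c3.
  apply/subsetP => e; rewrite inE subr0 => se.
  have eD : e \in supp s by rewrite inE.
  have := subsetP sX _ eD; rewrite in_setI => /andP[eX eU]; rewrite in_setI eX /=.
  have h := adj_edge eD.
  have nv i j : adj (supp s) i j -> i != v.
    by move=> ij; apply/eqP => E; move: ij; rewrite E -nbhdE N0 inE.
  have h1 := nv _ _ h; have h2 := nv _ _ (etrans (adjC _ _ _) h).
  by move: eU; rewrite !inE h1 h2.
- have [T4 T4N c4] := subset_of_card c3.
  have vT4 : v \notin T4.
    by apply/negP => /(subsetP T4N); rewrite nbhdE => /adj_neq; rewrite eqxx.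
  pose K := v |: T4.
  have K5 : #|K| = 5%N by rewrite cardsU1 vT4 c4.
  have sXa := adj_subP _ _ sX.
  have aX i j : adj (supp s) i j -> adj X i j.
    by move=> /sXa /(adj_subP _ _ (subsetIl X _)).
  have aU i j : adj (supp s) i j -> (i \in U) && (j \in U).
    by move=> /sXa /(adj_subP _ _ (subsetIr X _)); rewrite adj_Kset => /and3P[_ -> ->].
  have KX : Kset K \subset X.
    apply/adj_subP => i j; rewrite adj_Kset !in_setU1 => /and3P[ij].
    case/orP=> [/eqP Ei|/(subsetP T4N) iN]; case/orP=> [/eqP Ej|/(subsetP T4N) jN].
    - by rewrite Ei Ej eqxx in ij.
    - by rewrite Ei; apply: aX; rewrite -nbhdE.
    - by rewrite Ej adjC; apply: aX; rewrite -nbhdE.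
    - exact: cl.
  have [a aT4] : exists a, a \in T4 by apply/set0Pn; rewrite -card_gt0 c4.
  have va : adj (supp s) v a by rewrite -nbhdE (subsetP T4N).
  have KU : K \subset U.
    apply/subsetP => z; rewrite in_setU1 => /orP[/eqP ->|/(subsetP T4N)].
      by have /andP[] := aU _ _ va.
    by rewrite nbhdE => /aU /andP[].
  have [e0 e0s he0] := adjP _ _ _ va.
  have e0K : e0 \in Kset K.
    by rewrite inE; case: he0 => -> /=; rewrite !in_setU1 eqxx aT4 ?orbT.
  have om0 := K5_stress_neq0 hgen e0K.
  pose al := s e0 / K5_stress K e0.
  pose s1 e := s e - al * K5_stress K e.
  have hs1 : stress s1 by apply: stress_sub => //; apply: stress_K5_stress.
  have sup1 e : e \in supp s1 -> (e \in supp s) || (e \in Kset K).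
    rewrite inE /s1; apply: contraNT; rewrite negb_or inE negbK => /andP[/eqP -> eK].
    by rewrite K5_stress_notin // mulr0 subr0.
  have s1X : supp s1 \subset X :&: Kset U.
    apply/subsetP => e /sup1 /orP[/(subsetP sX)//|eK].
    rewrite in_setI (subsetP KX) //=; move: eK; rewrite !inE => /andP[h1 h2].
    by rewrite -!in_setU1 in h1 h2; rewrite !(subsetP KU).
  have N1 : nbhd (supp s1) v \subset nbhd (supp s) v :\ a.
    apply/subsetP => u; rewrite in_setD1 !nbhdE => /adjP[e es1 he].
    apply/andP; split.
      apply: contraTneq es1 => ua; rewrite ua in he.
      by rewrite (edge_eqP he he0) inE negbK /s1 /al divfK // subrr.
    case/orP: (sup1 _ es1) => h; first by apply/adjP; exists e.
    have := edge_neq e; move: h; rewrite inE !in_setU1 -nbhdE.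
    case: he => -> /= /andP[h1 h2] vu; apply: (subsetP T4N).
      by case/orP: h2 => // /eqP E; rewrite E eqxx in vu.
    by case/orP: h1 => // /eqP E; rewrite E eqxx in vu.
  have ck1 : (#|nbhd (supp s1) v| < k)%N.
    apply: leq_ltn_trans (subset_leq_card N1) _.
    by have := cardsD1 a (nbhd (supp s) v); rewrite nbhdE va add1n => E; move: ck; rewrite E ltnS.
  have [|s2 [sp2 st2 su2]] := IH s1 ck1 hs1 s1X.
    move=> i j /(subsetP N1) iN /(subsetP N1) jN.
    by move: iN jN; rewrite !in_setD1 => /andP[_ iN] /andP[_ jN]; apply: cl.
  have Es e : s1 e - s2 e = s e - (s2 e + al * K5_stress K e) by rewrite /s1; ring.
  exists (fun e => s2 e + al * K5_stress K e); split.
  + by apply: span5D => //; apply: span5_om; rewrite /K5in K5 eqxx.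
  + exact: stress_ext st2.
  + apply/subsetP => e; rewrite inE -Es => h; apply: (subsetP su2).
    by rewrite inE.
Qed.

(** In a circuit the star of [v] adds one less than its degree to the rank, which is the hypothesis
    of the star lemmas. In degree 5, values on one line give the clique by equality of ranks, a cone
    contradicts the independence of the circuit minus an edge, and a pencil contradicts
    [pencil_all]. *)
Lemma circuit_clique X s v : flat X -> stress s -> supp s \subset X ->
  (forall D, D \proper supp s -> indep x y D) -> v \in Vset (supp s) ->
  (#|nbhd (supp s) v| <= 5)%N ->
  forall i j, i \in nbhd (supp s) v -> j \in nbhd (supp s) v -> i != j -> adj X i j.
Proof.
move=> fX hs sX circ; set D := supp s in sX circ *; set T := nbhd D v => vD d5.
have [e0 e0D ve0] : exists2 e, e \in D & incident v e.
  by move: vD; rewrite inE => /existsP[e /andP[]]; exists e.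
have d4 : (4 <= #|T|)%N.
  rewrite ltnNge; apply/negP => d3.
  by move: vD; rewrite VsetE (stress_star3 hgen hn hs d3) eqxx.
have iD e : e \in D -> indep x y (D :\ e) by move=> eD; apply/circ/properD1.
have rD : \rank (S D) = #|D|.-1.
  apply/eqP; rewrite (cardsD1 e0) e0D /= -(eqP (iD _ e0D)) eqn_leq; apply/andP; split; apply: mxrankS.
    apply/sumsmx_subP => e eD; rewrite genmxE; have [->|ne] := eqVneq e e0.
      exact: stress_closed.
    by apply: S_edge; rewrite in_setD1 ne eD.
  by apply: S_sub; apply: subsetDl.
have delD : del D v \proper D.
  rewrite properE del_sub; apply/subsetPn; exists e0 => //.
  by rewrite !inE ve0 andbF.
pose W := S (del D v).
have rW : (\rank W + #|T|)%N = #|D| by rewrite (eqP (circ _ delD)) -card_del.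
have D0 : (0 < #|D|)%N by apply/card_gt0P; exists e0.
have WD : (W <= S D)%MS by apply/S_sub/del_sub.
have DX : (S D <= S X)%MS by apply: S_sub.
have W0 : W *m blk R v = 0 by apply: S_del_blk.
have vT : v \notin T by rewrite nbhdE adj_irr.
have HT p q : (\rank (W + star (upd x v p) (upd y v q) v T)%MS <= #|D|.-1)%N.
  have h0 k : ratpoly (fun _ _ : 'I_n -> R => (0 : 'rV[R]_(3 * n)) 0 k).
    by apply: ratpoly_ext (ratpoly_nat R n 0) => z t; rewrite mxE.
  have := @generic_star _ _ _ _ hgen (fun _ _ => 0) D v p q h0 erefl.
  move=> h; rewrite -rD; apply: leq_trans (leq_trans _ h) _; apply: mxrankS.
    by rewrite addsmxS ?addsmxSl.
  by rewrite addsmx_sub submx_refl sub0mx.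
have card45 : #|T| = 4%N \/ #|T| = 5%N.
  by move: d4 d5; case: #|T| => [|[|[|[|[|[]]]]]] //; [left|right].
case: card45 => T4.
  have HT4 p q : (\rank (W + star (upd x v p) (upd y v q) v T)%MS <= \rank W + 3)%N.
    by apply: leq_trans (HT p q) _; rewrite -rW T4 addnS.
  move=> i j iT jT ij; apply: fX => //; apply: submx_trans DX; apply: submx_trans WD.
  have [|z|s' sz H] := @arr_extend _ T [:: i; j]; first by rewrite /= inE ij.
    by rewrite in_cons mem_seq1 => /orP[]/eqP->.
  move: sz H; rewrite T4; case: s' => [|k [|l []]] // _ H.
  have mN z : z \in [:: i; j; k; l] -> z \in T by rewrite (arr_mem _ H).
  apply: (@star4_rows _ _ _ _ Hgp _ _ v T W0 i j k l HT4); try by rewrite mN // !inE eqxx ?orbT.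
  by rewrite cons_uniq (arr_uniq H) andbT -(arr_mem _ H).
have HT5 p q : (\rank (W + star (upd x v p) (upd y v q) v T)%MS <= \rank W + 4)%N.
  by apply: leq_trans (HT p q) _; rewrite -rW T4 addnS.
case: (star5_trichotomy Hgp W0 T4 vT HT5) => [[f hf]|[[a [b [c [d [e [H h]]]]]]|]].
- have rL : (\rank (S (del D v :|: Kset T)) <= \rank W + 1)%N.
    apply: (@leq_trans (\rank (W + f)%MS)); last exact: rank_adds_row.
    apply: mxrankS; rewrite S_setU addsmx_sub addsmxSl /=.
    by apply: S_subP => i j; rewrite adj_Kset => /and3P[ij iN jN]; apply: hf.
  have rL3 : (\rank (S (del D v :|: Kset T) + star x y v T)%MS
      <= \rank (S (del D v :|: Kset T)) + 3)%N.
    apply: rank_clique_star => // i j iN jN ij.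
    by apply: S_adj; rewrite adj_setU adj_Kset ij iN jN orbT.
  have BL : (S D <= S (del D v :|: Kset T) + star x y v T)%MS.
    by rewrite (S_del_star x y D v) addsmxS // S_sub // subsetUl.
  have LB : (S (del D v :|: Kset T) + star x y v T <= S D)%MS.
    rewrite -(mxrank_leqif_sup BL) eqn_leq mxrankS //=.
    apply: leq_trans rL3 _; rewrite rD -rW T4.
    by apply: (@leq_trans ((\rank W + 1) + 3)%N); rewrite ?leq_add2r // -addnA !addnS.
  move=> i j iT jT ij; apply: fX => //; apply: submx_trans DX; apply: submx_trans LB.
  by apply: submx_trans (addsmxSl _ _); apply: S_adj; rewrite adj_setU adj_Kset ij iT jT orbT.
- have mN z : z \in [:: a; b; c; d; e] -> z \in T by rewrite (arr_mem _ H).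
  have aT : a \in T by rewrite mN // inE eqxx.
  have [g gD hg] : exists2 g, g \in D & val g = (v, a) \/ val g = (a, v).
    by apply/adjP; rewrite -nbhdE.
  have vg : incident v g by rewrite /incident; case: hg => -> /=; rewrite eqxx ?orbT.
  have rg : \rank (S (D :\ g)) = #|D|.-1.
    by rewrite (eqP (iD _ gD)) (cardsD1 g D) gD.
  have : (\rank (S (D :\ g)) <= \rank W + 3)%N.
    rewrite (S_del_star x y (D :\ g) v) del_D1 // (nbhd_D1 D hg).
    apply: rank_clique_star => //; first by rewrite in_setD1 (negPf vT) andbF.
    move=> i j; rewrite !in_setD1 -/T => /andP[ia iT] /andP[ja jT] ij.
    have sub z : z \in T -> z != a -> z \in [:: b; c; d; e].
      by rewrite (arr_mem _ H) in_cons => /orP[/eqP ->|//]; rewrite eqxx.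
    by apply: h => //; apply: sub.
  by rewrite rg -rW T4 addnS /= leq_add2l.
case=> [a [b [c [d [e [H [ha hb hc hd [d12 d13 nx ny cap]]]]]]]].
case/negP: nx.
have sub : {subset [:: a; b; c; d; e] <= [set: 'I_n]} by move=> z _; rewrite in_setT.
apply: (pencil_all hgen (U := setT) (G := del D v) _ (arr_uniq H) sub) => //.
by apply/adj_subP => i j ij; rewrite adj_Kset (adj_neq ij) !in_setT.
Qed.

(** Induction on [U] and, inside it, on the support. A support that is no circuit is split into two
    smaller ones. On a circuit a vertex of degree at most 5 is peeled off; this may enlarge the
    support, but the vertex leaves [U]. *)
Lemma stress_span X s : flat X -> stress s -> supp s \subset X -> span5 X s.
Proof.
move=> fX hs sX.
have sXU : supp s \subset X :&: Kset setT.
  apply/subsetP => e /(subsetP sX) eX; rewrite in_setI eX.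
  by rewrite !inE.
move: {sX} [set: 'I_n] sXU => U; move: {2}#|U| (erefl #|U|) => k.
elim: k U s hs => [|k IHk] U s hs Uk.
  rewrite (cards0_eq Uk) => sX; apply: span5_ext (span5_0 x y X) => e.
  apply/esym/eqP; apply: contraT => se.
  have : e \in supp s by rewrite inE.
  by move=> /(subsetP sX); rewrite in_setI => /andP[_]; rewrite !inE.
move: {2}#|supp s| (leqnn #|supp s|) => m; elim: m s hs => [|m IHm] s hs sm sX.
  apply: span5_ext (span5_0 x y X) => e.
  apply/esym/eqP; apply: contraT => se.
  by move: sm; rewrite leqn0 cards_eq0 => /eqP/setP/(_ e); rewrite !inE se.
case: (boolP [exists D : {set edge n}, (D \proper supp s) && ~~ indep x y D]).
  case/existsP=> D /andP[Ds /dep_stress [c [hc cD [e ec]]]].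
  have cs : supp c \subset supp s by apply: subset_trans cD (proper_sub Ds).
  have ce : c e != 0 by rewrite inE in ec.
  pose be := s e / c e.
  have c1 : span5 X c.
    apply: IHm => //; last exact: subset_trans cs sX.
    by rewrite -ltnS; apply: leq_trans sm; apply: leq_ltn_trans (subset_leq_card cD) (proper_card Ds).
  pose s2 f := s f - be * c f.
  have s2s : supp s2 \subset supp s :\ e.
    apply/subsetP => f; rewrite !inE /s2 => h; apply/andP; split.
      by apply: contraNneq h => ->; rewrite /be divfK // subrr.
    apply: contraNneq h => sf; rewrite sf sub0r oppr_eq0 mulf_eq0.
    have : f \notin supp c by apply: contraTN isT => /(subsetP cs); rewrite inE sf eqxx.
    by rewrite inE negbK => ->; rewrite orbT.
  have c2 : span5 X s2.
    apply: IHm; [exact: stress_sub| |].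
      rewrite -ltnS; apply: leq_trans sm; apply: leq_ltn_trans (subset_leq_card s2s) _.
      by rewrite [X in (_ < X)%N](cardsD1 e) (subsetP cs _ ec).
    by apply: subset_trans s2s _; apply: subset_trans sX; apply: subsetDl.
  by apply: span5_ext (span5D be c2 c1) => f; rewrite /s2; ring.
rewrite negb_exists => /forallP circ.
have {}circ D : D \proper supp s -> indep x y D.
  by move=> Ds; have := circ D; rewrite Ds negbK.
have [s0|/set0Pn[e0 e0s]] := eqVneq (supp s) set0.
  apply: IHm => //; by rewrite s0 cards0.
set D := supp s in sm sX circ e0s.
have DX : D \subset X by apply: subset_trans sX (subsetIl _ _).
have DU : D \subset Kset U by apply: subset_trans sX (subsetIr _ _).
have DV : D \subset Kset (Vset D).
  apply/adj_subP => i j ij; rewrite adj_Kset (adj_neq ij) (adj_Vset ij).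
  by rewrite adjC in ij; rewrite (adj_Vset ij).
have deg4 v : v \in Vset D -> (4 <= #|nbhd D v|)%N.
  move=> vD; rewrite ltnNge; apply/negP => d3.
  by move: vD; rewrite VsetE (stress_star3 hgen hn hs d3) eqxx.
have V3 : (3 <= #|Vset D|)%N.
  have /deg4 : (val e0).1 \in Vset D by apply: adj_Vset (adj_edge e0s).
  move=> h; apply: ltnW; apply: leq_trans h (subset_leq_card _).
  by apply/subsetP => z; rewrite nbhdE adjC; apply: adj_Vset.
(* A circuit has one edge more than its rank, which is at most [3 |V| - 6]; the average degree is
   thus below 6. *)
have cD : (#|D| + 5 <= 3 * #|Vset D|)%N.
  have := rank_Kset Hgp V3.
  have := mxrankS (S_sub x y DV).
  have : (#|D|.-1 <= \rank (S D))%N.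
    have h := circ _ (properD1 e0s); rewrite (cardsD1 e0) e0s /= -(eqP h).
    by apply/mxrankS/S_sub/subsetDl.
  move: (\rank (S D)) (\rank (S (Kset (Vset D)))) #|D| #|Vset D|; clear; lia.
have [v vD d5] : exists2 v, v \in Vset D & (#|nbhd D v| <= 5)%N.
  apply/exists_inP; apply: contraT; rewrite negb_exists_in => /forall_inP h.
  have := handshake DV.
  have : (6 * #|Vset D| <= \sum_(v in Vset D) #|nbhd D v|)%N.
    rewrite mulnC -sum_nat_const; apply: leq_sum => v /h; by rewrite -ltnNge.
  by move: cD; move: (\sum_(v in Vset D) #|nbhd D v|)%N #|D| #|Vset D|; clear; lia.
have cl := circuit_clique fX hs DX circ vD d5.
have [s' [sp st su]] := clique_peel hs sX cl.
have vU : v \in U.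
  move: vD; rewrite VsetE => /set0Pn[u]; rewrite nbhdE => /(adj_subP _ _ DU).
  by rewrite adj_Kset => /and3P[].
have Uv : #|U :\ v| = k by rewrite (cardsD1_in vU Uk).
apply: span5_ext (span5D 1 sp (IHk _ _ st Uv su)) => e; ring.
Qed.

End StressSpan.

(* The weights 7 and 5 of a vertex of degree 4 and 3 are the least for which
   the induction in [good_count] goes through. *)
Lemma K5_subgraph_count (b01 b02 b03 b04 b12 b13 b14 b23 b24 b34 : bool) :
  let w k := if k == 4 then 7 else if k == 3 then 5 else 0 in
  let d0 := b01 + b02 + b03 + b04 in
  let d1 := b01 + b12 + b13 + b14 in
  let d2 := b02 + b12 + b23 + b24 in
  let d3 := b03 + b13 + b23 + b34 in
  let d4 := b04 + b14 + b24 + b34 in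
  4 <= d0 + d1 + d2 + d3 + d4 ->
  w d0 + w d1 + w d2 + w d3 + w d4 + 4 <= 2 * (d0 + d1 + d2 + d3 + d4).
Proof.
by case: b01; case: b02; case: b03; case: b04; case: b12; case: b13; case: b14;
  case: b23; case: b24; case: b34.
Qed.

(** * Flats, merging of cliques, private edges *)

Section Cyclic.
Local Open Scope ring_scope.
Variables (R : realFieldType) (n : nat) (x y : 'I_n -> R).
Hypothesis hgen : generic x y.
Implicit Types (G D X Y L M : {set edge n}) (T U N K A : {set 'I_n}) (i j u v w a b c d : 'I_n).
Implicit Types (s : edge n -> R) (e f g : edge n).

Let Hgp := generic_gp hgen.
Local Notation S := (rowspan x y).
Local Notation erow := (erow x y).
Local Notation cofrow := (cofrow x y).
Local Notation stress := (stress x y).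
Local Notation K5_stress := (K5_stress x y).
Local Notation span5 := (span5 x y).
Local Notation flat := (flat x y).

Lemma closed_stress G f : (cofrow f <= S G)%MS -> f \notin G ->
  exists t, [/\ stress t, t f != 0 & supp t \subset f |: G].
Proof.
rewrite -(rowsE x y G) => /submxP[u uE] fG.
pose t e := (e == f)%:R - \sum_(k < #|G|) (enum_val k == e)%:R * u 0 k.
exists t; split.
- change (\sum_(e : edge n) t e *: cofrow e = 0).
  rewrite /t; under eq_bigr => e _ do rewrite scalerBl scaler_suml.
  rewrite sumrB (bigD1 f) //= eqxx scale1r big1 ?addr0; last first.
    by move=> e /negPf ->; rewrite scale0r.
  rewrite uE mulmx_sum_row exchange_big /= -sumrB big1 // => k _.
  rewrite (bigD1 (enum_val k)) //= eqxx mul1r big1 ?addr0 ?rowK ?subrr // => e ek.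
  by rewrite eq_sym (negPf ek) mul0r scale0r.
- rewrite /t eqxx big1 ?subr0 ?oner_eq0 // => k _.
  have /negPf -> : enum_val k != f by apply: contraNneq fG => <-; apply: enum_valP.
  by rewrite mul0r.
- apply/subsetP => e; rewrite inE in_setU1; apply: contraNT; rewrite negb_or => /andP[/negPf ef eG].
  rewrite /t ef sub0r oppr_eq0 big1 // => k _.
  have /negPf -> : enum_val k != e by apply: contraNneq eG => <-; apply: enum_valP.
  by rewrite mul0r.
Qed.

(** An edge in the closure of [Y] but not in [Y] would give a relation leaving [Y] in this edge
    alone. *)
Lemma flat_subset X Y : flat X -> Y \subset X ->
  (forall t f, stress t -> supp t \subset f |: Y -> supp t \subset X -> f \in X ->
     f \notin Y -> t f = 0) ->
  flat Y.
Proof.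
move=> fX YX h i j ij hS.
have /adjP[f fX' hf] : adj X i j by apply: fX => //; apply: submx_trans hS (S_sub x y YX).
apply/adjP; exists f => //; apply/contraT => fY.
rewrite (erow_edge x y hf) in hS; have [t [ht tf ts]] := closed_stress hS fY.
have tX : supp t \subset X by apply: subset_trans ts _; rewrite subUset sub1set fX' YX.
by move: tf; rewrite (h t f) ?eqxx.
Qed.

Lemma span5_K5 X s e : span5 X s -> s e != 0 -> exists2 K, K5in X K & e \in Kset K.
Proof.
case=> al h; rewrite h => h0.
case: (boolP [exists K, K5in X K && (e \in Kset K)]) => [/existsP[K /andP[h1 h2]]|].
  by exists K.
rewrite negb_exists => /forallP hK; move: h0; rewrite big1 ?eqxx // => K XK.
by have := hK K; rewrite XK /= => /K5_stress_notin ->; rewrite mulr0.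
Qed.

(** Edges on which every relation vanishes are coloops. *)
Lemma rank_add_free Y M : [disjoint Y & M] ->
  (forall t f, stress t -> supp t \subset Y :|: M -> f \in M -> t f = 0) ->
  \rank (S (Y :|: M)) = (\rank (S Y) + #|M|)%N.
Proof.
move: {2}#|M| (erefl #|M|) => k; elim: k M => [|k IH] M cM dis h.
  by rewrite (cards0_eq cM) setU0 cards0 addn0.
have /set0Pn[f fM] : M != set0 by rewrite -card_gt0 cM.
have cM' : #|M :\ f| = k by rewrite (cardsD1_in fM cM).
have sub : M :\ f \subset M by apply: subsetDl.
have sub2 : Y :|: M :\ f \subset Y :|: M by apply: setUS.
have E : Y :|: M = f |: (Y :|: M :\ f) by rewrite setUCA setD1K.
rewrite E rank_setU1.
  rewrite (IH _ cM') ?cM' ?cM ?addnS //; first by apply: disjointWr dis.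
  move=> t g ht ts gM; apply: (h t g ht _ (subsetP sub _ gM)).
  exact: subset_trans ts sub2.
apply/negP => hf; have fN : f \notin Y :|: M :\ f.
  rewrite in_setU in_setD1 eqxx orbF; apply/negP => fY.
  by have /pred0P/(_ f) := dis; rewrite /= fY fM.
have [t [ht tf ts]] := closed_stress hf fN.
by move: tf; rewrite (h t f ht _ fM) ?eqxx // E.
Qed.

(** What [stress_span] makes of cyclicity in a flat; this form passes easily to the smaller sets of
    the induction. *)
Definition cyc5 X := forall e, e \in X -> exists2 K, K5in X K & e \in Kset K.

(** A missing pair and three common vertices form a K_5 that lacks a single edge. *)
Lemma clique_merge X A K : flat X -> Kset A \subset X -> Kset K \subset X ->
  (3 <= #|A :&: K|)%N -> Kset (A :|: K) \subset X.
Proof.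
move=> fX AX KX c3.
have [p [q [r [U]]]] := three_of_card c3; rewrite !in_setI.
move=> /andP[pA pK] /andP[qA qK] /andP[rA rK]; usplit U.
have rowA i j : i \in A -> j \in A -> i != j -> (erow i j <= S X)%MS.
  by move=> iA jA ij; apply: S_adj; apply: (adj_subP _ _ AX); rewrite adj_Kset ij iA jA.
have rowK i j : i \in K -> j \in K -> i != j -> (erow i j <= S X)%MS.
  by move=> iA jA ij; apply: S_adj; apply: (adj_subP _ _ KX); rewrite adj_Kset ij iA jA.
have key i j : i \in A -> i \notin K -> j \in K -> j \notin A -> (erow i j <= S X)%MS.
  move=> iA iK jK jA.
  have [ip iq ir] : [/\ i != p, i != q & i != r] by split; apply: contraNneq iK => ->.
  have [jp jq jr] : [/\ j != p, j != q & j != r] by split; apply: contraNneq jA => ->.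
  have ij : i != j by apply: contraNneq iK => ->.
  apply: (@K5_close _ _ x y Hgp _ _ i j p q r); first by uq.
  - by split; apply: rowA.
  - by split; apply: rowK.
  - by split; apply: rowA.
apply/adj_subP => i j; rewrite adj_Kset !in_setU => /and3P[ij hi hj]; apply: fX => //.
case: (boolP (i \in A)) hi => iA /= hi; case: (boolP (j \in A)) hj => jA /= hj.
- exact: rowA.
- by case: (boolP (i \in K)) => iK; [apply: rowK|apply: key].
- by case: (boolP (j \in K)) => jK; [apply: rowK|rewrite erowN_sub; apply: key].
- exact: rowK.
Qed.

Definition good X w := (w \in Vset X) && (Kset (nbhd X w) \subset X).

Definition private X K := [set e in Kset K |
  [forall A : {set 'I_n}, (K5in X A && (e \in Kset A)) ==> (A == K)]].

Lemma privateP X K e : reflect (e \in Kset K /\ forall A, K5in X A -> e \in Kset A -> A = K)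
  (e \in private X K).
Proof.
have -> : (e \in private X K) = (e \in Kset K) &&
    [forall A : {set 'I_n}, (K5in X A && (e \in Kset A)) ==> (A == K)] by rewrite in_set.
apply: (iffP andP) => -[eK h]; split=> //.
  by move=> A XA eA; have := forallP h A; rewrite XA eA => /eqP.
by apply/forallP => A; apply/implyP => /andP[h1 h2]; apply/eqP/h.
Qed.

(** Only the summand of [K] reaches its private edges, so there the relation is a nowhere zero
    pattern times one scalar. *)
Lemma private_stress X K s e f : K5in X K -> e \in private X K -> f \in private X K ->
  span5 X s -> s e = 0 -> s f = 0.
Proof.
move=> XK /privateP[eK eu] /privateP[fK fu] [al h].
have one g : g \in Kset K -> (forall A, K5in X A -> g \in Kset A -> A = K) -> s g = al K * K5_stress K g.
  move=> gK gu; rewrite h (bigD1 K) //= big1 ?addr0 // => A /andP[XA AK].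
  have [gA|/K5_stress_notin ->] := boolP (g \in Kset A); last by rewrite mulr0.
  by rewrite (gu A XA gA) eqxx in AK.
rewrite !one // => /eqP; rewrite mulf_eq0 (negPf (K5_stress_neq0 hgen eK)) orbF => /eqP ->.
by rewrite mul0r.
Qed.

Lemma K5in_sub X Y K : X \subset Y -> K5in X K -> K5in Y K.
Proof. by rewrite /K5in => XY /andP[-> /subset_trans ->]. Qed.

Lemma K5in_del X v K : K5in (del X v) K -> v \notin K.
Proof.
case/andP=> /eqP K5 KX; apply/negP => vK.
have /card_gt0P[z] : (0 < #|K :\ v|)%N by rewrite (cardsD1_in vK K5).
rewrite in_setD1 => /andP[zv zK].
have : adj (del X v) v z by apply: (adj_subP _ _ KX); rewrite adj_Kset eq_sym zv vK zK.
by rewrite adj_del eqxx.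
Qed.

Lemma nbhd_K5 X K w : K5in X K -> w \in K -> K :\ w \subset nbhd X w.
Proof.
case/andP=> _ KX wK; apply/subsetP => z; rewrite in_setD1 nbhdE => /andP[zw zK].
by apply: (adj_subP _ _ KX); rewrite adj_Kset eq_sym zw wK zK.
Qed.

Lemma cyc5_deg X w : cyc5 X -> w \in Vset X -> (4 <= #|nbhd X w|)%N.
Proof.
move=> cX; rewrite VsetE => /set0Pn[u]; rewrite nbhdE => /adjP[e eX he].
have [K XK eK] := cX e eX.
have wK : w \in K by move: eK; rewrite inE; case: he => -> /= /andP[].
apply: leq_trans (subset_leq_card (nbhd_K5 XK wK)).
by case/andP: XK => /eqP K5 _; move: (cardsD1 w K); rewrite wK K5 add1n => -[<-].
Qed.

Lemma cyc5_Vset X w : cyc5 X -> w \in Vset X -> exists2 K, K5in X K & w \in K.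
Proof.
move=> cX; rewrite VsetE => /set0Pn[u]; rewrite nbhdE => /adjP[e eX he].
have [K XK eK] := cX e eX; exists K => //.
by move: eK; rewrite inE; case: he => -> /= /andP[].
Qed.

Lemma rank_del3 X w : (3 <= #|nbhd X w|)%N -> (\rank (S (del X w)) + 3 <= \rank (S X))%N.
Proof.
move=> c3.
have [p [q [r [U pN qN rN]]]] := three_of_card c3; usplit U.
have nw z : z \in nbhd X w -> z != w by rewrite nbhdE => /adj_neq; rewrite eq_sym.
have [pw qw rw] := And3 (nw _ pN) (nw _ qN) (nw _ rN).
have fr : row_free (col_mx (erow w p) (col_mx (erow w q) (erow w r)) *m blk R w).
  by apply: star3_free => //; apply: br_neq0 => //; uq.
have [<- _] := add_free_star (S_del_blk x y X w) fr.
rewrite (S_del_star x y X w); apply/mxrankS/addsmxS => //; exact: sub_star3.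
Qed.

(** The row of an edge at [v] has a nonzero block there, which rows avoiding [v] cannot produce. *)
Lemma flat_del X v : flat X -> flat (del X v).
Proof.
move=> fX i j ij h.
have hX : (erow i j <= S X)%MS by apply: submx_trans h (S_sub x y (del_sub X v)).
have n0 u : adj (del X v) v u = false by rewrite adj_del eqxx.
rewrite adj_del fX // andbT; apply/andP; split; apply/eqP => E.
  have vj : v != j by rewrite -E.
  by have := erow_notin_S hgen vj n0; rewrite -[X in erow X j]E h.
have vi : v != i by rewrite -E eq_sym.
by have := erow_notin_S hgen vi n0; rewrite -[X in erow X i]E erowN_sub h.
Qed.

End Cyclic.

(** * Counting good vertices *)

Section Count.
Variables (R : realFieldType) (n : nat) (x y : 'I_n -> R).
Hypothesis hgen : generic x y.
Hypothesis hn : 5 <= n.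
Implicit Types (G D X Y L M : {set edge n}) (T U N K A : {set 'I_n}) (i j u v w a b c d : 'I_n).
Implicit Types (s : edge n -> R) (e f g : edge n).

Let Hgp := generic_gp hgen.
Local Notation S := (rowspan x y).
Local Notation flat := (flat x y).
Local Notation good_set X := [set w | good X w].

Lemma sum_arr K (s : seq 'I_n) (F : 'I_n -> nat) : arr K s ->
  \sum_(z in K) F z = \sum_(z <- s) F z.
Proof. by case/andP=> us /eqP ->; rewrite big_uniq //; apply: eq_bigl => z; rewrite inE. Qed.

Lemma card_nbhd L w : #|nbhd L w| = \sum_(z : 'I_n) (adj L w z : nat).
Proof.
by rewrite -sum1_card big_mkcond; apply: eq_bigr => z _; rewrite nbhdE; case: (adj L w z).
Qed.

Lemma good_intro X w A : w \in Vset X -> nbhd X w \subset A -> Kset A \subset X -> good X w.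
Proof.
move=> wX NA AX; rewrite /good wX; apply: subset_trans AX.
exact: Kset_sub.
Qed.

Lemma good_clique X w : good X w -> Kset (w |: nbhd X w) \subset X.
Proof.
case/andP=> _ h; apply/adj_subP => i j; rewrite adj_Kset !in_setU1 => /and3P[ij].
case/orP=> [/eqP Ei|iN]; case/orP=> [/eqP Ej|jN].
- by rewrite Ei Ej eqxx in ij.
- by rewrite Ei -nbhdE.
- by rewrite Ej adjC -nbhdE.
- by apply: (adj_subP _ _ h); rewrite adj_Kset ij iN jN.
Qed.

(** * Removing the private edges of one K_5 *)

Section RemovePrivate.
Variables (X : {set edge n}) (K : {set 'I_n}).
Hypothesis fX : flat X.
Hypothesis cX : cyc5 X.
Hypothesis XK : K5in X K.
Hypothesis L2 : 1 < #|private X K|.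

Let L := private X K.
Let Y := X :\: L.

Lemma rp_K5 : #|K| = 5. Proof. by case/andP: XK => /eqP. Qed.
Lemma rp_KX : Kset K \subset X. Proof. by case/andP: XK. Qed.

Lemma rp_LK : L \subset Kset K.
Proof. by apply/subsetP => e /privateP[]. Qed.

Lemma rp_XE : X = Y :|: L.
Proof.
apply/setP => e; rewrite in_setU in_setD.
by case: (boolP (e \in L)) => [/(subsetP rp_LK)/(subsetP rp_KX) ->|_]; rewrite ?orbT ?orbF.
Qed.

Lemma rp_adj i j : adj X i j = adj Y i j || adj L i j.
Proof. by rewrite {1}rp_XE adj_setU. Qed.

Lemma rp_YX : Y \subset X. Proof. exact: subsetDl. Qed.

Lemma rp_adjL i j : adj L i j -> (i \in K) && (j \in K).
Proof. by move/(adj_subP _ _ rp_LK); rewrite adj_Kset => /and3P[_ -> ->]. Qed.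

Lemma rp_other e : e \in L -> exists2 f, f \in L & f != e.
Proof.
move=> eL; have : 0 < #|L :\ e| by move: L2; rewrite (cardsD1 e) -/L eL.
by case/card_gt0P=> f; rewrite in_setD1 => /andP[fe fL]; exists f.
Qed.

Lemma rp_free t e f : stress x y t -> supp t \subset X -> e \in L -> f \in L ->
  t e = 0%R -> t f = 0%R.
Proof.
move=> ht tX eL fL; apply: (private_stress hgen XK eL fL).
exact: (stress_span hgen hn fX ht tX).
Qed.

(** A relation meeting [L] in a single edge vanishes at a second edge of [L], hence on all of [L];
    here two private edges are required. *)
Lemma rp_flat : flat Y.
Proof.
apply: (flat_subset fX rp_YX) => t f ht ts tX fX' fY.
have fL : f \in L by move: fY; rewrite in_setD fX' andbT negbK.
have [e eL ef] := rp_other fL; apply: (rp_free ht tX eL fL).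
apply/eqP; apply: contraTT isT => te.
have : e \in f |: Y by apply: (subsetP ts); rewrite inE.
by rewrite in_setU1 (negPf ef) in_setD eL.
Qed.

(** An edge outside [L] lies in a K_5 of [X] other than [K], and such a K_5 contains no edge private
    to [K]. *)
Lemma rp_cyc : cyc5 Y.
Proof.
move=> e; rewrite in_setD => /andP[eL eX].
have [A [XA eA AK]] : exists A, [/\ K5in X A, e \in Kset A & A != K].
  have [A XA eA] := cX eX.
  have [E|ne] := eqVneq A K; last by exists A.
  have : ~~ [forall A : {set 'I_n}, (K5in X A && (e \in Kset A)) ==> (A == K)].
    apply: contra eL => h; apply/privateP; split; first by rewrite -E.
    by move=> A' XA' eA'; have := forallP h A'; rewrite XA' eA' => /eqP.
  rewrite negb_forall => /existsP[A']; rewrite negb_imply => /andP[/andP[h1 h2] h3].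
  by exists A'.
exists A => //; rewrite /K5in; case/andP: (XA) => -> /= AX.
apply/subsetP => g gA; rewrite in_setD (subsetP AX) // andbT.
by apply: contra AK => /privateP[_ h]; apply/eqP/h.
Qed.

(** A relation that avoids one chosen edge of [L] vanishes on [L], so the other edges of [L] are
    coloops over [Y]. *)
Lemma rp_rank : \rank (S Y) + #|L| <= \rank (S X) + 1.
Proof.
have [e0 e0L] : exists e0, e0 \in L by apply/card_gt0P; apply: ltnW.
have -> : #|L| = #|L :\ e0| + 1 by rewrite (cardsD1 e0) e0L addnC.
rewrite addnA leq_add2r.
have sX : Y :|: L :\ e0 \subset X by rewrite {1}rp_XE; apply/setUS/subsetDl.
rewrite -(@rank_add_free _ _ x y Y (L :\ e0)); first exact/mxrankS/S_sub.
  rewrite -setI_eq0; apply/eqP/setP => e; rewrite in_setI in_setD in_setD1 in_set0.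
  by case: (e \in L); rewrite /= ?andbF.
move=> t f ht ts; rewrite in_setD1 => /andP[fe fL].
apply: (rp_free ht _ e0L fL); first exact: subset_trans ts sX.
apply/eqP; apply: contraTT isT => te.
have : e0 \in Y :|: L :\ e0 by apply: (subsetP ts); rewrite inE.
by rewrite in_setU in_setD in_setD1 eqxx e0L.
Qed.

Lemma rp_deg w : w \in K -> #|nbhd L w| + #|nbhd Y w :&: K| = 4.
Proof.
move=> wK.
have -> : 4 = #|K :\ w| by rewrite (cardsD1_in wK rp_K5).
rewrite -(cardsID (nbhd L w) (K :\ w)); congr (_ + _); apply: eq_card => z.
  rewrite in_setI in_setD1 nbhdE.
  case: (boolP (adj L w z)) => h; rewrite ?andbF // andbT.
  by have /andP[_ ->] := rp_adjL h; rewrite eq_sym (adj_neq h).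
rewrite in_setI in_setD in_setD1 !nbhdE.
case: (boolP (z \in K)) => zK; rewrite ?andbF // !andbT.
have [->|zw] := eqVneq z w.
  by rewrite andbF adj_irr.
rewrite andbT; have [e he] := edge_of zw.
have he' : val e = (w, z) \/ val e = (z, w) by case: he; auto.
have eqa M : adj M w z = (e \in M).
  apply/adjP/idP => [[f fM hf]|eM]; last by exists e.
  by rewrite (edge_eqP he' hf).
rewrite !eqa in_setD; case: (e \in L) => //=.
by apply: (subsetP rp_KX); rewrite inE; case: he => -> /=; rewrite zK wK.
Qed.

Let wt k := if k == 4 then 7 else if k == 3 then 5 else 0.

Lemma rp_weight : \sum_(w in K) wt #|nbhd L w| + 4 <= 4 * #|L|.
Proof.
have hs := handshake rp_LK.
have H := arr_enum K; have := rp_K5; rewrite cardE.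
case: (enum K) H => [|a [|b [|c [|d [|e []]]]]] // H _.
have nE w : #|nbhd L w| = \sum_(z <- [:: a; b; c; d; e]) (adj L w z : nat).
  rewrite card_nbhd -(sum_arr _ H) [RHS]big_mkcond /=; apply: eq_bigr => z _.
  by case: (boolP (adj L w z)) => [/rp_adjL /andP[_ ->]|]; case: (z \in K).
move: hs; rewrite !(sum_arr _ H) !big_cons !big_nil !addn0 !nE !big_cons !big_nil !adj_irr.
rewrite (adjC L b a) (adjC L c a) (adjC L d a) (adjC L e a) (adjC L c b) (adjC L d b)
  (adjC L e b) (adjC L d c) (adjC L e c) (adjC L e d).
move=> hs.
have := @K5_subgraph_count (adj L a b) (adj L a c) (adj L a d) (adj L a e) (adj L b c)
  (adj L b d) (adj L b e) (adj L c d) (adj L c e) (adj L d e).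
rewrite /= in hs *; rewrite ?addn0 ?add0n ?addnA in hs *.
rewrite hs => /(_ _)/leq_trans -> //; last by rewrite mulnA.
by rewrite -[4]/(2 * 2) leq_pmul2l.
Qed.

Let J := K :\: Vset Y.
(** The vertices at which goodness may get lost: merging with [K] needs [w] and two of its
    neighbours in [Y] to lie in [K]. *)
Let Bad := [set w in K :&: Vset Y | #|nbhd Y w :&: K| <= 1].

(** By [rp_deg] vertices of [J] have degree 4 in [L] and those of [Bad] at least 3, so their weights
    are at least 7 and 5. *)
Lemma rp_JBad : 7 * #|J| + 5 * #|Bad| + 4 <= 4 * #|L|.
Proof.
apply: leq_trans rp_weight; rewrite leq_add2r (big_setID (Vset Y)) /= addnC leq_add //.
  rewrite mulnC -sum_nat_const [X in X <= _]big_mkcond [X in _ <= X]big_mkcond /=.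
  apply: leq_sum => w _; rewrite in_set; case: ifP => // /andP[wK h]; rewrite wK.
  have wK' : w \in K by move: wK; rewrite in_setI => /andP[].
  have := rp_deg wK'; move: h; case: #|nbhd Y w :&: K| => [|[]] // _.
    by rewrite addn0 => ->.
  by rewrite addn1 => -[->].
rewrite mulnC -sum_nat_const; apply: leq_sum => w; rewrite in_setD => /andP[wY wK].
have := rp_deg wK.
have -> : nbhd Y w = set0 by apply/eqP; move: wY; rewrite VsetE negbK.
by rewrite set0I cards0 addn0 => ->.
Qed.

Lemma rp_Vset : #|Vset X| <= #|Vset Y| + #|J|.
Proof.
rewrite -cardsUI; apply: leq_trans (leq_addr _ _); apply: subset_leq_card.
apply/subsetP => w; rewrite VsetE => /set0Pn[u]; rewrite nbhdE rp_adj in_setU in_setD.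
case/orP=> [/adj_Vset -> //|/rp_adjL /andP[-> _]].
by case: (w \in Vset Y).
Qed.

(** A vertex of [J] has all its neighbours in the clique [K]. A good vertex of [Y] in [K] but not in
    [Bad] stays good, its clique merging with [K]; outside [K] nothing changes. *)
Lemma rp_good : #|good_set Y| + #|J| <= #|good_set X| + #|Bad|.
Proof.
have dJ : [disjoint good_set Y & J].
  rewrite -setI_eq0; apply/eqP/setP => w; rewrite in_setI in_setD in_set0.
  apply/idP => /and3P[h wY _]; move: h; rewrite in_set => /andP[wY' _].
  by rewrite wY' in wY.
have -> : #|good_set Y| + #|J| = #|good_set Y :|: J|.
  by rewrite cardsU (eqP (_ : good_set Y :&: J == set0)) ?setI_eq0 // cards0 subn0.
rewrite -[X in _ <= X]cardsUI; apply: leq_trans (leq_addr _ _); apply: subset_leq_card.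
have Kin : {subset K <= Vset X}.
  move=> w wK; rewrite VsetE; have : 0 < #|K :\ w|.
    by rewrite (cardsD1_in wK rp_K5).
  by move=> h; rewrite -card_gt0; apply: leq_trans h (subset_leq_card (nbhd_K5 XK wK)).
apply/subsetP => w; rewrite in_setU => /orP[|wJ]; rewrite in_setU; last first.
  rewrite in_set; apply/orP; left; move: wJ; rewrite in_setD => /andP[wY wK].
  apply: (@good_intro X w K); rewrite ?Kin ?rp_KX //.
  apply/subsetP => z; rewrite nbhdE rp_adj => /orP[/adj_Vset|/rp_adjL /andP[]//].
  by rewrite (negPf wY).
rewrite in_set => gw; have /andP[wY wc] := gw.
have wX : w \in Vset X by apply: Vset_sub wY; apply: rp_YX.
have DX : Kset (w |: nbhd Y w) \subset X := subset_trans (good_clique gw) rp_YX.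
case: (boolP (w \in K)) => wK; last first.
  apply/orP; left; rewrite in_set; apply: (good_intro wX _ DX).
  apply/subsetP => z; rewrite nbhdE rp_adj in_setU1 nbhdE => /orP[->|/rp_adjL]; first by rewrite orbT.
  by rewrite (negPf wK).
have -> : (w \in Bad) = (#|nbhd Y w :&: K| <= 1) by rewrite in_set in_setI wK wY.
case: leqP => h; rewrite ?orbT // orbF in_set.
apply: (@good_intro X w ((w |: nbhd Y w) :|: K)) => //; last first.
  apply: (clique_merge hgen fX DX rp_KX).
  rewrite (_ : _ :&: K = w |: (nbhd Y w :&: K)); last first.
    by apply/setP => z; rewrite in_setU1 !in_setI in_setU1; case: (eqVneq z w) => [->|]; rewrite ?wK.
  by rewrite cardsU1 in_setI nbhdE adj_irr add1n.
apply/subsetP => z; rewrite nbhdE rp_adj in_setU in_setU1 nbhdE.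
by case/orP=> [->|/rp_adjL /andP[_ ->]]; rewrite !orbT.
Qed.

End RemovePrivate.

(** * Removing a vertex when no K_5 has two private edges *)

Section RemoveVertex.
Variables (X : {set edge n}) (v : 'I_n).
Hypothesis fX : flat X.
Hypothesis cX : cyc5 X.
Hypothesis vX : v \in Vset X.
Hypothesis L1 : forall K, K5in X K -> #|private X K| <= 1.

(** Taken instead of [del X v], as restricting to copies of K_5 avoiding [v] preserves [cyc5]. *)
Let F := [set e in X | [exists A : {set 'I_n}, [&& K5in X A, v \notin A & e \in Kset A]]].

Lemma rv_in e A : K5in X A -> v \notin A -> e \in Kset A -> e \in F.
Proof.
move=> XA vA eA; rewrite in_set; case/andP: (XA) => _ AX; rewrite (subsetP AX) //=.
by apply/existsP; exists A; rewrite XA vA eA.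
Qed.

Lemma rv_FX : F \subset X.
Proof. by apply/subsetP => e; rewrite in_set => /andP[]. Qed.

Lemma rv_K5 A : K5in X A -> v \notin A -> K5in F A.
Proof.
move=> XA vA; rewrite /K5in; case/andP: (XA) => -> _ /=.
by apply/subsetP => e; apply: rv_in.
Qed.

Lemma rv_cyc : cyc5 F.
Proof.
move=> e; rewrite in_set => /andP[_ /existsP[A /and3P[XA vA eA]]].
by exists A => //; apply: rv_K5.
Qed.

Lemma rv_adjv u : adj F v u = false.
Proof.
apply/adjP => -[e]; rewrite in_set => /andP[_ /existsP[A /and3P[_ vA]]].
rewrite inE => /andP[h1 h2] [] h; move: h1 h2; rewrite h /= => h1 h2.
  by rewrite h1 in vA.
by rewrite h2 in vA.
Qed.

Lemma rv_Fdel : F \subset del X v.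
Proof.
apply/adj_subP => i j h; rewrite adj_del (adj_subP _ _ rv_FX) // andbT.
apply/andP; split; apply/eqP => E; move: h; rewrite E; first by rewrite rv_adjv.
by rewrite adjC rv_adjv.
Qed.

(** Relations in the flat [del X v] live on its copies of K_5, and the edges of these are in [F]. *)
Lemma rv_flat : flat F.
Proof.
have fd := flat_del hgen (v := v) fX.
apply: (flat_subset fd rv_Fdel) => t f ht _ tX _; apply: contraNeq => tf.
have [A XA fA] := span5_K5 (stress_span hgen hn fd ht tX) tf.
have [/(K5in_sub (del_sub X v)) XA' vA] := (XA, K5in_del XA); exact: rv_in fA.
Qed.

(* Two K_5 sharing an edge and [v] span a clique on at least 6 vertices,
   hence a K_5 avoiding [v]. *)
Lemma rv_merge i j A K : K5in X A -> Kset K \subset X -> 3 <= #|K :&: A| ->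
  ~~ (K \subset A) -> i != j -> i \in K :|: A -> j \in K :|: A -> i != v -> j != v -> adj F i j.
Proof.
move=> XA KX c3 KA ij iU jU iv jv.
have [A5 AX] := andP XA.
have mX := clique_merge hgen fX KX AX c3.
have c6 : 6 <= #|K :|: A|.
  case/subsetPn: KA => z zK zA.
  apply: (@leq_trans #|z |: A|); first by rewrite cardsU1 zA (eqP A5).
  by apply: subset_leq_card; rewrite subUset sub1set in_setU zK subsetUr.
have [B [ijB BU B5]] : exists B : {set 'I_n}, [/\ [set i; j] \subset B, B \subset (K :|: A) :\ v & #|B| = 5].
  apply: set_extend_card.
    by apply/subsetP => z; rewrite in_set2 in_setD1 => /orP[]/eqP ->; rewrite ?iv ?jv.
  rewrite cards2 ij /=; move: (cardsD1 v (K :|: A)) c6.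
  by case: (v \in _) => -> /=; [rewrite add1n ltnS|rewrite add0n => /ltnW].
have [iB jB] : i \in B /\ j \in B by split; apply: (subsetP ijB); rewrite in_set2 eqxx ?orbT.
have XB : K5in X B.
  rewrite /K5in B5 eqxx; apply: subset_trans mX.
  by apply/Kset_sub/(subset_trans BU)/subsetDl.
have vB : v \notin B by apply/negP => /(subsetP BU); rewrite in_setD1 eqxx.
have : adj (Kset B) i j by rewrite adj_Kset ij iB jB.
by case/adjP=> e eB he; apply/adjP; exists e => //; apply: rv_in vB eB.
Qed.

(** A second K_5 through [ij] either avoids [v], or shares [i], [j], [v] with [K], and then the
    merged clique provides one that does. *)
Lemma rv_unique K i j : K5in X K -> v \in K -> i \in K -> j \in K -> i != j ->
  i != v -> j != v -> ~~ adj (private X K) i j -> adj F i j.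
Proof.
move=> XK vK iK jK ij iv jv np.
have /adjP[e eK he] : adj (Kset K) i j by rewrite adj_Kset ij iK jK.
have : e \notin private X K by apply: contra np => h; apply/adjP; exists e.
have [A5 AX] := andP XK.
have -> : (e \in private X K) = [forall A : {set 'I_n}, (K5in X A && (e \in Kset A)) ==> (A == K)].
  by rewrite /private in_set eK.
rewrite negb_forall => /existsP[A]; rewrite negb_imply => /andP[/andP[XA eA] AK].
have [vA|vA] := boolP (v \in A); last by apply/adjP; exists e => //; apply: rv_in vA eA.
have [A5' AX'] := andP XA.
have [iA jA] : i \in A /\ j \in A.
  by move: eA; rewrite inE; case: he => -> /= /andP[].
apply: (@rv_merge i j K A) => //; rewrite ?in_setU ?iA ?jA //.
  have : [set i; j] :|: [set v] \subset A :&: K.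
    apply/subsetP => z; rewrite in_setU in_set2 in_set1 in_setI.
    by case/orP=> [/orP[]|] /eqP ->; rewrite ?iA ?jA ?iK ?jK ?vA ?vK.
  move/subset_leq_card; apply: leq_trans.
  by rewrite setUC cardsU1 cards2 ij in_set2 ![v == _]eq_sym (negPf iv) (negPf jv).
apply: contra AK => sub; rewrite eqEcard sub (eqP A5) (eqP A5') //.
Qed.

(** Of the three edges from [w] to the rest of [K], at most one is private by [L1]; the others
    survive in [F]. *)
Lemma rv_two K w : K5in X K -> v \in K -> w \in K -> w != v ->
  2 <= #|(K :\ v :\ w) :&: nbhd F w|.
Proof.
move=> XK vK wK wv; have [K5 KX] := andP XK.
have c3 : #|K :\ v :\ w| = 3.
  move: (cardsD1 v K) (cardsD1 w (K :\ v)); rewrite vK in_setD1 wv wK (eqP K5) !add1n.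
  by move=> [<-] [<-].
have cp : #|nbhd (private X K) w| <= 1.
  by apply: leq_trans (L1 XK); rewrite (card_del (private X K) w) leq_addl.
suff : #|K :\ v :\ w| <= #|(K :\ v :\ w) :&: nbhd F w| + 1 by rewrite c3 addn1 ltnS.
rewrite -(cardsID (nbhd F w) (K :\ v :\ w)) leq_add2l.
apply: leq_trans cp; apply: subset_leq_card; apply/subsetP => z.
rewrite in_setD !in_setD1 !nbhdE => /and4P[nF zw zv zK]; apply: contraR nF => np.
by apply: (rv_unique XK) => //; rewrite eq_sym.
Qed.

Lemma rv_Vset : #|Vset X| <= #|Vset F| + 1.
Proof.
rewrite (cardsD1 v) vX addnC leq_add2r; apply: subset_leq_card; apply/subsetP => u.
rewrite in_setD1 => /andP[uv uX].
have [K XK uK] := cyc5_Vset cX uX.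
have [vK|vK] := boolP (v \in K).
  have := rv_two XK vK uK uv; move=> /ltnW /card_gt0P[z]; rewrite in_setI => /andP[_ zF].
  by rewrite VsetE; apply/set0Pn; exists z.
have /andP[K5 KF] := rv_K5 XK vK.
rewrite VsetE -card_gt0.
apply: leq_trans (subset_leq_card (nbhd_K5 (rv_K5 XK vK) uK)).
by rewrite (cardsD1_in uK (eqP K5)).
Qed.

(** By [rv_two], every K_5 through [v] and a good vertex [w] of [F] shares three vertices with the
    clique of [w], so the two merge. In [X] the vertex [w] can thus gain only the neighbour [v], and
    this inside a merged clique. *)
Lemma rv_good : good_set F \subset good_set X.
Proof.
apply/subsetP => w; rewrite !in_set => gw; have /andP[wF wc] := gw.
have DF := good_clique gw.
have DX : Kset (w |: nbhd F w) \subset X := subset_trans DF rv_FX.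
have wX : w \in Vset X by apply: Vset_sub wF; apply: rv_FX.
have wv : w != v.
  apply/eqP => E; move: wF; rewrite VsetE E => /set0Pn[z]; by rewrite nbhdE rv_adjv.
have c4 := cyc5_deg rv_cyc wF.
have wN : w \notin nbhd F w by rewrite nbhdE adj_irr.
have share K : K5in X K -> v \in K -> w \in K -> 3 <= #|(w |: nbhd F w) :&: K|.
  move=> XK vK wK; have := rv_two XK vK wK wv => h.
  have -> : (w |: nbhd F w) :&: K = w |: (nbhd F w :&: K).
    by apply/setP => z; rewrite in_setU1 !in_setI in_setU1; case: (eqVneq z w) => [->|]; rewrite ?wK.
  rewrite cardsU1 in_setI (negPf wN) add1n ltnS; apply: leq_trans h _.
  apply: subset_leq_card; apply/subsetP => z; rewrite !in_setI !in_setD1.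
  by case/andP=> /and3P[_ _ ->] ->.
have cD : 5 <= #|w |: nbhd F w| by rewrite cardsU1 wN.
have DK K : v \in K -> #|K| = 5 -> ~~ (w |: nbhd F w \subset K).
  move=> vK K5; apply/negP => sub.
  have /eqP E : w |: nbhd F w == K by rewrite eqEcard sub K5.
  move: vK; rewrite -E in_setU1 eq_sym (negPf wv) nbhdE adjC rv_adjv //.
have sub u : u \in nbhd X w -> u != v -> u \in nbhd F w.
  rewrite nbhdE => wu uv; have [e eX he] := adjP _ _ _ wu.
  have [K XK eK] := cX eX; have [K5 KX] := andP XK.
  have [wK uK] : w \in K /\ u \in K.
    by move: eK; rewrite inE; case: he => -> /= /andP[].
  have [vK|vK] := boolP (v \in K); last first.
    by rewrite nbhdE; apply/adjP; exists e => //; apply: rv_in vK eK.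
  rewrite nbhdE; apply: (rv_merge XK DX) => //; rewrite ?share ?DK ?(eqP K5) //.
  - exact: adj_neq wu.
  - by rewrite in_setU wK orbT.
  - by rewrite in_setU uK orbT.
have [vw|vw] := boolP (v \in nbhd X w); last first.
  apply: (good_intro wX _ DX); apply/subsetP => u uN; rewrite in_setU1 sub ?orbT //.
  by apply: contraNneq vw => <-.
move: (vw); rewrite nbhdE => /adjP[e eX he].
have [K XK eK] := cX eX; have [K5 KX] := andP XK.
have [wK vK] : w \in K /\ v \in K.
  by move: eK; rewrite inE; case: he => -> /= /andP[].
apply: (good_intro (A := (w |: nbhd F w) :|: K) wX).
  apply/subsetP => u uN; rewrite in_setU in_setU1.
  have [->|uv] := eqVneq u v; first by rewrite vK orbT.
  by rewrite sub ?orbT.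
exact: (clique_merge hgen fX DX KX (share _ XK vK wK)).
Qed.

Lemma rv_rank : \rank (S F) + 3 <= \rank (S X).
Proof.
have c3 : 3 <= #|nbhd X v| by apply: ltnW; apply: cyc5_deg.
apply: leq_trans (rank_del3 hgen c3); rewrite leq_add2r; exact/mxrankS/S_sub/rv_Fdel.
Qed.

Lemma rv_proper : F \proper X.
Proof.
rewrite properE rv_FX; apply/negP => /adj_subP h.
move: vX; rewrite VsetE => /set0Pn[u]; rewrite nbhdE => /h.
by rewrite rv_adjv.
Qed.

End RemoveVertex.

(** Removing private edges changes the left side by at most [12 |J|] and the right side by at least
    [5 (|J| - |Bad|) + 4 (|L| - 1)]; the comparison is [rp_JBad]. Removing a vertex costs 12 on the
    left and at least 4 * 3 in the rank term. *)
Lemma good_count X : flat X -> cyc5 X ->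
  12 * #|Vset X| <= 5 * #|good_set X| + 4 * \rank (S X).
Proof.
move: {2}#|X|.+1 (ltnSn #|X|) => k; elim: k X => // k IH X cXk fX cX.
have [->|/set0Pn[v vX]] := eqVneq (Vset X) set0; first by rewrite cards0.
case: (boolP [exists K : {set 'I_n}, K5in X K && (1 < #|private X K|)]) => [/existsP[K /andP[XK L2]]|].
  have cY : #|X :\: private X K| < k.
    rewrite -ltnS; apply: leq_trans cXk; rewrite ltnS; apply: proper_card.
    rewrite properE subsetDl; have /card_gt0P[e eL] : 0 < #|private X K| by apply: ltnW.
    apply/subsetPn; exists e; last by rewrite in_setD eL.
    exact: (subsetP (rp_KX XK) _ (subsetP (rp_LK X K) _ eL)).
  have h1 := IH _ cY (rp_flat fX XK L2) (rp_cyc cX).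
  have h2 := rp_rank fX XK L2; have h3 := rp_JBad XK L2; have h4 := rp_Vset XK.
  have h5 := rp_good fX XK.
  move: h1 h2 h3 h4 h5; move: (\rank (S (X :\: private X K))) (\rank (S X)).
  move: #|Vset X| #|Vset _| #|good_set X| #|good_set _| #|private X K| #|_ :\: _| #|[set w in _ | _]|.
  clear; lia.
rewrite negb_exists => /forallP h.
have L1 K : K5in X K -> #|private X K| <= 1 by move=> XK; have := h K; rewrite XK /= -leqNgt.
have cF := leq_trans (proper_card (rv_proper vX)) (_ : #|X| <= k).
have h1 := IH _ (cF cXk) (rv_flat fX) (@rv_cyc X v).
have h2 := rv_rank cX vX.
have h3 := subset_leq_card (rv_good v fX cX L1).
have h4 := rv_Vset fX cX vX L1.
move: h1 h2 h3 h4; set F := [set e in X | _].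
move: (\rank (S F)) (\rank (S X)) #|Vset X| #|Vset F| #|good_set X| #|good_set F|.
clear; lia.
Qed.

Lemma exists_good X : flat X -> cyc5 X -> X != set0 -> exists w, good X w.
Proof.
move=> fX cX /set0Pn[e eX].
have vX : (val e).1 \in Vset X by apply: adj_Vset (adj_edge eX).
have V3 : 3 <= #|Vset X|.
  have h := cyc5_deg cX vX; apply: ltnW; apply: leq_trans h (subset_leq_card _).
  by apply/subsetP => z; rewrite nbhdE adjC; apply: adj_Vset.
have XV : X \subset Kset (Vset X).
  apply/adj_subP => i j ij; rewrite adj_Kset (adj_neq ij) (adj_Vset ij).
  by rewrite adjC in ij; rewrite (adj_Vset ij).
have h1 := good_count fX cX; have h2 := rank_Kset Hgp V3; have h3 := mxrankS (S_sub x y XV).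
have : 0 < #|good_set X|.
  move: h1 h2 h3; move: (\rank (S X)) (\rank (S (Kset (Vset X)))) #|Vset X| #|good_set X|.
  by clear; lia.
by case/card_gt0P=> w; rewrite in_set; exists w.
Qed.

End Count.

(** * K_5-sequences *)

Section Sequences.
Variable n : nat.
Implicit Types (s : seq {set 'I_n}) (U T : {set 'I_n}) (i j w z : 'I_n) (X : {set edge n}).

Lemma Cle_rcons s U : Cle (rcons s U) = Cle s :|: Kset U.
Proof. by rewrite /Cle -cats1 big_cat big_seq1. Qed.

Lemma adj_Cle s i j : adj (Cle s) i j -> exists2 U, U \in s & adj (Kset U) i j.
Proof.
elim/last_ind: s => [|s U IH]; first by rewrite /Cle big_nil adj_set0.
rewrite Cle_rcons adj_setU => /orP[/IH[A As h]|h].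
  by exists A; rewrite // mem_rcons inE As orbT.
by exists U; rewrite // mem_rcons mem_head.
Qed.

Lemma Cle_sub s X : (forall U, U \in s -> K5in X U) -> Cle s \subset X.
Proof.
move=> h; apply/adj_subP => i j /adj_Cle[U Us].
by case/andP: (h U Us) => _ /adj_subP UX; apply: UX.
Qed.

Lemma proper_rcons s U :
  proper_K5seq (rcons s U) <->
  [/\ proper_K5seq s, #|U| = 5 & 0 < size s -> ~~ (Kset U \subset Cle s)].
Proof.
split=> [[h5 hp]|[[h5 hp] U5 hU]].
  split; first split.
  - by move=> A As; apply: h5; rewrite mem_rcons inE As orbT.
  - move=> i /andP[i0 is_]; have := hp i; rewrite size_rcons i0 ltnS ltnW // => /(_ isT).
    by rewrite nth_rcons is_ -cats1 takel_cat ?(ltnW is_).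
  - by apply: h5; rewrite mem_rcons mem_head.
  - move=> s0; have := hp (size s); rewrite s0 size_rcons ltnSn => /(_ isT).
    by rewrite nth_rcons ltnn eqxx -cats1 take_size_cat.
split=> [A|i]; first by rewrite mem_rcons inE => /orP[/eqP ->|/h5].
rewrite size_rcons ltnS => /andP[i0]; rewrite leq_eqVlt => /orP[/eqP E|is_].
  by rewrite nth_rcons E ltnn eqxx -cats1 take_size_cat // hU -?E.
by rewrite nth_rcons is_ -cats1 takel_cat ?(ltnW is_) // hp // i0.
Qed.

(** The new edge is [wz]: the members of [s] avoid [w], and the other added sets avoid [z]. *)
Lemma K5_extend s (w : 'I_n) T (zs : seq 'I_n) : proper_K5seq s ->
  (forall U, U \in s -> w \notin U) -> #|T| = 3 -> w \notin T ->
  uniq zs -> (forall z, z \in zs -> z \notin w |: T) ->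
  proper_K5seq (s ++ [seq z |: (w |: T) | z <- zs]).
Proof.
move=> ps sw T3 wT.
elim/last_ind: zs => [|zs z IH]; first by rewrite cats0.
rewrite rcons_uniq => /andP[zzs uz] hz.
have hz' z' : z' \in zs -> z' \notin w |: T by move=> h; apply: hz; rewrite mem_rcons inE h orbT.
have zT : z \notin w |: T by apply: hz; rewrite mem_rcons mem_head.
rewrite map_rcons -rcons_cat; apply/proper_rcons; split; first exact: IH.
  by rewrite !cardsU1 zT wT T3.
move=> _; apply/negP => /adj_subP h.
have zw : z != w by apply: contraNneq zT => ->; rewrite setU11.
have /h wz : adj (Kset (z |: (w |: T))) w z.
  by rewrite adj_Kset eq_sym zw !in_setU1 !eqxx orbT.
have [U] := adj_Cle wz.
rewrite mem_cat adj_Kset => /orP[Us|/mapP[z' z's ->]] /and3P[_ h1 h2].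
  by have := sw U Us; rewrite h1.
move: h2; rewrite in_setU1 (negPf zT) orbF => /eqP E.
by rewrite E z's in zzs.
Qed.

End Sequences.

(** * Bases at good vertices and the rank formula *)

Section Final.
Variables (R : realFieldType) (n : nat) (x y : 'I_n -> R).
Hypothesis hgen : generic x y.
Hypothesis hn : 5 <= n.
Implicit Types (G D X Y L M : {set edge n}) (T U N K A : {set 'I_n}) (i j u v w a b c d : 'I_n).
Implicit Types (e f g : edge n).

Let Hgp := generic_gp hgen.
Local Notation S := (rowspan x y).
Local Notation erow := (erow x y).
Local Notation cofrow := (cofrow x y).
Local Notation flat := (flat x y).

Lemma cflat_flat X : cflat x y X -> flat X.
Proof.
move=> cf i j ij h; have [e he] := edge_of ij.
apply/adjP; exists e => //; rewrite -cf in_set !crankE.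
rewrite (erow_edge x y he) in h.
have E : (S (e |: X) :=: S X)%MS.
  apply/eqmxP; rewrite [X in _ && X]S_sub ?subsetUr // andbT S_setU1 addsmx_sub submx_refl.
  by rewrite h.
by rewrite E.
Qed.

(** By minimality the relation of a circuit has full support, and [stress_span] covers its support
    by copies of K_5 in [X]. *)
Lemma ccyclic_cyc5 X : flat X -> ccyclic x y X -> cyc5 X.
Proof.
move=> fX cX e /cX[D [[nD minD] eD DX]].
rewrite cindepE in nD; have [c [hc cD [f fc]]] := dep_stress nD.
have E : supp c = D.
  apply/eqP; move: cD; rewrite subEproper => /orP[//|/minD]; rewrite cindepE => /eqP i0.
  have h := stress_closed hc fc.
  have Ef : supp c = f |: (supp c :\ f) by rewrite setD1K.
  have : \rank (S (supp c)) <= \rank (S (supp c :\ f)).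
    by apply: mxrankS; rewrite {1}Ef S_setU1 addsmx_sub submx_refl.
  rewrite i0 => /leq_trans/(_ (S_rank_card x y _)).
  by rewrite (cardsD1 f) fc add1n ltnn.
have ce : c e != 0%R by move: eD; rewrite -E inE.
by apply: span5_K5 (stress_span hgen hn fX hc _) ce; rewrite E.
Qed.

Lemma good_row X w : good X w -> forall i j, i \in nbhd X w -> j \in nbhd X w -> i != j ->
  (erow i j <= S (del X w))%MS.
Proof.
case/andP=> _ /adj_subP cN i j iN jN ij; apply: S_adj.
rewrite adj_del (cN i j) ?adj_Kset ?ij ?iN ?jN // andbT.
by move: iN jN; rewrite !nbhdE => /adj_neq iw /adj_neq jw; rewrite ![_ == w]eq_sym iw.
Qed.

Lemma rank_good X w : good X w -> \rank (S X) <= \rank (S (del X w)) + 3.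
Proof.
move=> gw; rewrite (S_del_star x y X w); apply: (rank_clique_star Hgp); last exact: good_row.
by rewrite nbhdE adj_irr.
Qed.

(** Three edges at [w] are added to a base of [del X w]. They are always independent over it, and
    since the neighbours form a clique, the whole star adds no more than 3. *)
Lemma base_good X w : good X w -> 3 <= #|nbhd X w| ->
  exists B : {set edge n}, cbase x y X B /\ #|[set e in B | incident w e]| = 3.
Proof.
move=> gw c3.
have [T TN T3] := subset_of_card c3.
have [B0 [_ B0X iB0 sB0]] := base_extend (sub0set (del X w)) (indep0 x y).
pose st := [set e in X | incident w e && (other w e \in T)].
pose B := B0 :|: st.
have stX : st \subset X by apply/subsetP => e; rewrite in_set => /andP[].
have BX : B \subset X by rewrite subUset (subset_trans B0X (del_sub X w)).
have hB0 e : e \in B0 -> ~~ incident w e by move/(subsetP B0X); rewrite in_set => /andP[].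
have delB : del B w = B0.
  apply/setP => e; rewrite in_set in_setU; case: (boolP (e \in B0)) => eB /=; first exact: hB0.
  by rewrite in_set; case: (incident w e); rewrite ?andbF.
have nB : nbhd B w = T.
  apply/setP => u; rewrite nbhdE /B adj_setU.
  have -> : adj B0 w u = false.
    by apply/idP => /(adj_subP _ _ B0X); rewrite adj_del eqxx.
  apply/adjP/idP => [[e]|uT].
    rewrite in_set => /and3P[_ iw oT] he.
    suff -> : u = other w e by [].
    by have := edge_neq e; rewrite /other; case: he => -> /=; rewrite ?eqxx // => /negPf ->.
  have := subsetP TN _ uT; rewrite nbhdE => /adjP[e eX he]; exists e => //.
  have iw : incident w e by rewrite /incident; case: he => -> /=; rewrite eqxx ?orbT.
  rewrite in_set eX iw /=.
  suff -> : other w e = u by [].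
  by have := edge_neq e; rewrite /other; case: he => -> /=; rewrite ?eqxx // => /negPf ->.
have cB : #|B| = #|B0| + 3 by rewrite (card_del B w) delB nB T3.
have rB : \rank (S B) = #|B|.
  apply/eqP; rewrite eqn_leq S_rank_card /= cB -(eqP iB0) -{1}delB.
  by apply: (rank_del3 hgen); rewrite nB T3.
exists B; rewrite card_star nB T3; split=> //; split=> //; first by rewrite cindepE /indep rB.
move=> B' pB B'X; rewrite cindepE; apply/negP => /eqP iB'.
have := proper_card pB; rewrite ltnNge -iB' cB => /negP; apply.
apply: leq_trans (mxrankS (S_sub x y B'X)) _; apply: leq_trans (rank_good gw) _.
by rewrite leq_add2r -(eqP iB0); apply: mxrankS.
Qed.

Lemma K5_missing_edge m (W : 'M[R]_(m, 3 * n)) U i j : #|U| = 5 -> adj (Kset U) i j ->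
  (forall p q, adj (Kset U) p q -> (p, q) <> (i, j) -> (p, q) <> (j, i) -> (erow p q <= W)%MS) ->
  (erow i j <= W)%MS.
Proof.
move=> U5; rewrite adj_Kset => /and3P[ij iU jU] h.
have [p [q [r H]]] := arr_ext2 U5 ij iU jU.
have V := arr_uniq H.
have mU z : z \in [:: i; j; p; q; r] -> z \in U by rewrite -(arr_mem z H).
have [pU qU rU] : [/\ p \in U, q \in U & r \in U].
  by split; apply: mU; rewrite !inE eqxx ?orbT.
have k a b : a \in U -> b \in U -> a != b -> b != i -> b != j -> (erow a b <= W)%MS.
  move=> aU bU ab bi bj; apply: h; first by rewrite adj_Kset ab aU bU.
    by case=> _ /eqP; rewrite (negPf bj).
  by case=> _ /eqP; rewrite (negPf bi).
by usplit V; apply: (@K5_close _ _ x y Hgp _ _ i j p q r); [uq|split..]; apply: k => //; uq.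
Qed.

(** The edge new in a K_5 is recovered from its other nine, whose rows are in the span: those
    covered before by the induction hypothesis, the others since they have not been deleted. *)
Lemma K5seq_deletion (s : seq {set 'I_n}) : proper_K5seq s ->
  exists E : {set edge n}, [/\ E \subset Cle s, #|E| = size s & (S (Cle s) <= S (Cle s :\: E))%MS].
Proof.
elim/last_ind: s => [|s U IH] ps.
  by exists set0; rewrite sub0set cards0 setD0.
have [/IH[E [Es cE hE]] U5 hU] := (proper_rcons s U).1 ps.
have [e eU eC] : exists2 e, e \in Kset U & e \notin Cle s.
  (* Properness does not restrict the first term; there any edge of the K_5 is new. *)
  apply/subsetPn; case: s hU {IH ps E Es cE hE} => [|A s] hU; last exact: hU.
  apply/subsetPn.
  have /card_gt0P[i iU] : 0 < #|U| by rewrite U5.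
  have /card_gt0P[j] : 0 < #|U :\ i| by rewrite (cardsD1_in iU U5).
  rewrite in_setD1 => /andP[ji jU].
  have /adjP[e eU _] : adj (Kset U) i j by rewrite adj_Kset eq_sym ji iU jU.
  by exists e => //; rewrite /Cle big_nil in_set0.
have eE : e \notin E by apply: contra eC; apply: (subsetP Es).
exists (e |: E); split.
- rewrite Cle_rcons subUset sub1set in_setU eU orbT /=.
  by apply: subset_trans Es _; apply: subsetUl.
- by rewrite cardsU1 eE cE size_rcons.
rewrite Cle_rcons; set W := S (_ :\: _).
have h1 : (S (Cle s) <= W)%MS.
  apply: submx_trans hE _; apply/S_sub/subsetP => f; rewrite !in_setD in_setU1 in_setU.
  by case/andP=> fE fC; rewrite fC negb_or fE !andbT; apply: contraNneq eC => <-.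
have h2 p q : adj (Kset U) p q -> (p, q) <> val e -> (q, p) <> val e -> (erow p q <= W)%MS.
  move=> /adjP[f fU hf] n1 n2.
  have [fC|fC] := boolP (f \in Cle s).
    by apply: submx_trans h1; apply: S_adj; apply/adjP; exists f.
  apply: S_adj; apply/adjP; exists f => //; rewrite in_setD [f \in _ :|: Kset U]in_setU fU orbT andbT.
  rewrite in_setU1 negb_or; apply/andP; split; last by apply: contra fC; apply: (subsetP Es).
  by apply/eqP => E0; move: n1 n2; rewrite -E0; case: hf => ->.
rewrite (S_setU x y (Cle s) (Kset U)) addsmx_sub h1 /=; apply: S_subP => i j ij.
have he : val e = ((val e).1, (val e).2) by case: (val e).
have key : (erow (val e).1 (val e).2 <= W)%MS.
  apply: (K5_missing_edge U5 (adj_edge eU)) => p q pq n1 n2; apply: h2 => //; rewrite he //.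
  by case=> E1 E2; apply: n2; rewrite E1 E2.
have [E1|/eqP E1] := eqVneq (i, j) (val e); first by move: key; rewrite -E1.
have [E2|/eqP E2] := eqVneq (j, i) (val e); last exact: h2.
by rewrite erowN_sub; move: key; rewrite -E2.
Qed.

(** The rows of [X] stay in the span of the union after the deletion of one edge per term, so the
    rank is at most the number of remaining edges. *)
Lemma K5seq_bound X (s : seq {set 'I_n}) : proper_K5seq s ->
  crank x y X + size s <= #|X :|: Cle s|.
Proof.
move=> /K5seq_deletion[E [Es <- hE]]; rewrite crankE.
have -> : #|X :|: Cle s| = #|(X :|: Cle s) :\: E| + #|E|.
  rewrite -(cardsID E (X :|: Cle s)) addnC (setIidPr _) //.
  by apply: subset_trans Es _; apply: subsetUr.
rewrite leq_add2r; apply: leq_trans (S_rank_card x y _); apply: mxrankS.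
apply: submx_trans (S_sub x y (subsetUl X (Cle s))) _; apply: S_subP => i j /adjP[e eX he].
have [eE|eE] := boolP (e \in E); last by apply: S_adj; apply/adjP; exists e; rewrite // in_setD eE.
have : (erow i j <= S (Cle s))%MS.
  by apply: S_adj; apply/adjP; exists e => //; apply: (subsetP Es).
move/submx_trans; apply; apply: submx_trans hE _; apply/S_sub/setSD/subsetUr.
Qed.

Lemma flat_K5seq X : flat X ->
  exists s : seq {set 'I_n}, [/\ proper_K5seq s, forall U, U \in s -> K5in X U &
    \rank (S X) + size s = #|X|].
Proof.
move: {2}#|X|.+1 (ltnSn #|X|) => k; elim: k X => // k IH X cX fX.
have [->|X0] := eqVneq X set0.
  by exists [::]; split; [split=> [U|[|i]]| |rewrite S_set0 mxrank0 cards0].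
pose X1 := [set e in X | [exists K, K5in X K && (e \in Kset K)]].
have X1P e K : K5in X K -> e \in Kset K -> e \in X1.
  move=> XK eK; rewrite in_set; case/andP: (XK) => _ KX; rewrite (subsetP KX) //=.
  by apply/existsP; exists K; rewrite XK.
have X1X : X1 \subset X by apply/subsetP => e; rewrite in_set => /andP[].
(* Edges in no K_5 of [X] are in no relation; they contribute equally to rank and size and can be
   set aside. *)
have [E|ne] := eqVneq X1 X; last first.
  have fX1 : flat X1.
    apply: (flat_subset fX X1X) => t f ht _ tX _; apply: contraNeq => tf.
    by have [K XK fK] := span5_K5 (stress_span hgen hn fX ht tX) tf; apply: X1P fK.
  have c1 : #|X1| < k.
    by rewrite -ltnS; apply: leq_trans cX; rewrite ltnS; apply: proper_card; rewrite properEneq ne.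
  have [s [ps sX1 rs]] := IH X1 c1 fX1.
  exists s; split=> // [U /sX1|]; first exact: K5in_sub.
  have XE : X1 :|: (X :\: X1) = X by rewrite -{1}(setIidPr X1X) setID.
  rewrite -(cardsID X1 X) (setIidPr X1X) -rs addnAC; congr (_ + _).
  rewrite -{1}XE; apply: rank_add_free; first by rewrite -setI_eq0 setIDA setDIl setDv set0I.
  move=> t f ht; rewrite XE in_setD => tX /andP[fN _].
  apply/eqP; apply: contraNT fN => tf.
  by have [K XK fK] := span5_K5 (stress_span hgen hn fX ht tX) tf; apply: X1P fK.
have cyX : cyc5 X.
  by move=> e; rewrite -{1}E in_set => /andP[_ /existsP[K /andP[]]]; exists K.
have [w gw] := exists_good hgen hn fX cyX X0.
have /andP[wX _] := gw.
have c3 : 3 <= #|nbhd X w| by apply: ltnW; apply: cyc5_deg.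
have cd : #|del X w| < k.
  rewrite -ltnS; apply: leq_trans cX; rewrite (card_del X w) ltnS; move: c3; clear; lia.
have [s [ps sX rs]] := IH _ cd (flat_del hgen fX).
have [T TN T3] := subset_of_card c3.
have wN : w \notin nbhd X w by rewrite nbhdE adj_irr.
have wT : w \notin T by apply: contra wN; apply: (subsetP TN).
pose zs := enum (nbhd X w :\: T).
have hz z : z \in zs -> z \in nbhd X w /\ z \notin w |: T.
  rewrite mem_enum in_setD => /andP[zT zN]; split=> //; rewrite in_setU1 negb_or zT andbT.
  by apply: contraNneq wN => zw; rewrite -{1}zw.
have sw U : U \in s -> w \notin U by move=> /sX/K5in_del.
exists (s ++ [seq z |: (w |: T) | z <- zs]); split.
- by apply: K5_extend => //; [exact: enum_uniq|move=> z /hz[]].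
- move=> U; rewrite mem_cat => /orP[/sX/(K5in_sub (del_sub X w))//|/mapP[z /hz[zN zT] ->]].
  rewrite /K5in !cardsU1 zT wT T3 eqxx /=; apply: subset_trans (good_clique gw).
  apply: Kset_sub.
  by rewrite !subUset !sub1set setU11 in_setU1 zN orbT /= subsetU // TN orbT.
(* With [d] neighbours of [w], the size grows by [d], the rank by 3 and the sequence by [d - 3]
   terms. *)
rewrite size_cat size_map -cardE cardsD (setIidPr TN) T3.
have rX : \rank (S X) = \rank (S (del X w)) + 3.
  by apply/eqP; rewrite eqn_leq rank_good //= rank_del3.
rewrite rX (card_del X w) -rs -!addnA; congr (_ + _); by rewrite addnCA subnKC.
Qed.

(** The sequence of the closure [F] serves for [X]: the union stays inside [F], whose size is the
    rank of [X] plus the number of terms. *)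
Lemma K5seq_exists X :
  exists s : seq {set 'I_n}, proper_K5seq s /\ crank x y X + size s = #|X :|: Cle s|.
Proof.
pose F := [set e | (cofrow e <= S X)%MS].
have XF : X \subset F by apply/subsetP => e eX; rewrite in_set S_edge.
have FX : (S F <= S X)%MS.
  by apply: S_subP => i j /adjP[e]; rewrite in_set => he h; rewrite (erow_edge x y h).
have fF : flat F.
  move=> i j ij h; have [e he] := edge_of ij; apply/adjP; exists e => //.
  by rewrite in_set -(erow_edge x y he); apply: submx_trans h FX.
have [s [ps sF rs]] := flat_K5seq fF; exists s; split=> //.
apply/eqP; rewrite eqn_leq K5seq_bound //=.
apply: (@leq_trans #|F|); first by apply: subset_leq_card; rewrite subUset XF Cle_sub.
by rewrite -rs crankE leq_add2r mxrankS.
Qed.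

End Final.

Theorem theorem5p7 (n : nat) (hn : (5 <= n)%N) (R : realFieldType)
  (x y : 'I_n -> R) (hgen : generic x y) (X : {set edge n}) :
  ((exists s : seq {set 'I_n},
       proper_K5seq s /\ (crank x y X + size s = #|X :|: Cle s|)%N) /\
   (forall s : seq {set 'I_n},
       proper_K5seq s -> (crank x y X + size s <= #|X :|: Cle s|)%N))
  /\
  (X != set0 -> ccyclic x y X -> cflat x y X ->
   exists2 v, v \in Vset X &
     Kset (nbhd X v) \subset X /\
     exists B : {set edge n},
       cbase x y X B /\ #|[set e in B | incident v e]| = 3%N).
Proof.
split; first by split=> [|s]; [exact: K5seq_exists|exact: K5seq_bound].
move=> X0 ccX cfX; have fX := cflat_flat cfX; have cX := ccyclic_cyc5 hgen hn fX ccX.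
have [w gw] := exists_good hgen hn fX cX X0; have /andP[wX wN] := gw.
exists w => //; split=> //; apply: (base_good hgen gw).
by apply: ltnW; apply: cyc5_deg.
Qed.
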